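(* Let $M$ be a real supermanifold of dimension $p|q$. Then the sheaf $\mathcal{O}^{\delta(k)}_{\Pi TM}$ of delta forms of degree $k$ is isomorphic (as a sheaf of $\mathcal{O}_M$-modules) to the sheaf $\Sigma^k_M$ of integral forms of degree $k$, for any $k\le p$.
   Context: $x_i|\theta_\alpha$ ($i=1,\dots,p$, $\alpha=1,\dots,q$) are local coordinates on $M$. $\Pi TM$ is the supermanifold of dimension $p+q|p+q$ with coordinates $x_i,\theta_\alpha$ on the base and fibre coordinates $d\theta_\alpha$ (even), $dx_i$ (odd), the fibre coordinates transforming under coordinate changes of $M$ like differentials. Delta forms: these are the integrable pseudoforms (generalized functions on $\Pi TM$ for which the integral against the canonical Berezinian volume of $\Pi TM$ converges) whose dependence on all even fibre coordinates $d\theta_\alpha$ is distributional and supported at the origin. Locally over $U\subset M$ a delta form is a sum $$\omega=\sum_{\underline\epsilon,\underline\ell}f_{\underline\epsilon,\underline\ell}(x|\theta)\,(dx_1)^{\epsilon_1}\cdots(dx_p)^{\epsilon_p}\,\delta^{(\ell_1)}(d\theta_1)\cdots\delta^{(\ell_q)}(d\theta_q),\quad\epsilon_i\in\{0,1\},\ \ell_\alpha\ge0,$$ with coefficients $f_{\underline\epsilon,\underline\ell}$ functions on $M$, where $\delta^{(\ell)}(d\theta_\alpha)$ is the $\ell$-th derivative of the Dirac delta at $0$ in $d\theta_\alpha$; all $q$ delta symbols (or derivatives) must occur. Delta forms are treated algebraically: the symbols $\delta^{(\ell)}(d\theta_\alpha)$ are odd and anticommute; the super Weyl–Clifford algebra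 generated by $d\theta_\alpha,\partial_{d\theta_\alpha}|dx_i,\partial_{dx_i}$ (relations $[\partial_{d\theta_\alpha},d\theta_\beta]=\delta_{\alpha\beta}$, $\{\partial_{dx_i},dx_j\}=\delta_{ij}$) acts with $dx_i,\partial_{dx_i}$ acting as exterior multiplication and contraction, $\partial_{d\theta_\alpha}\delta^{(\ell)}(d\theta_\alpha)=\delta^{(\ell+1)}(d\theta_\alpha)$ and $d\theta_\alpha\cdot\delta^{(0)}(d\theta_\alpha)=0$. The $\mathbb{Z}$-degree of a monomial is $\sum_i\epsilon_i-\sum_\alpha\ell_\alpha$ (so degrees are $\le p$), and $\mathcal{O}^{\delta(k)}_{\Pi TM}$ is the subsheaf of degree-$k$ delta forms, regarded as a sheaf of $\mathcal{O}_M$-modules on $M$. Delta forms of degree $p-k$ are generated by acting with order-$k$ operators in $\partial_{dx_i},\partial_{d\theta_\alpha}$ on $\omega_{(p)}=dx_1\cdots dx_p\,\delta(d\theta_1)\cdots\delta(d\theta_q)$. Transformation rule under coordinate changes: substitute the transformed $dx'_i$, $d\theta'_\alpha$, Taylor-expand delta symbols in the nilpotent terms containing the odd $dx_i$, and use the formal scaling rule $\delta\big(\sum_\beta g_{1\beta}d\theta_\beta\big)\cdots\delta\big(\sum_\beta g_{q\beta}d\theta_\beta\big)=\det(g)^{-1}\delta(d\theta_1)\cdots\delta(d\theta_q)$ for an invertible even matrix $g$, with derivatives transforming by the chain rule. Integral forms: $\Sigma^{p-i}_M:=\mathcal{B}er(M)\otimes_{\mathcal{O}_M}S^i\Pi\mathcal{T}_M$,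 $i\ge0$, where $\mathcal{T}_M$ is the tangent sheaf, $\Pi$ parity reversal, $S^i$ supersymmetric power, and $\mathcal{B}er(M)$ is the Berezinian sheaf: locally free of total rank one with generators $\mathcal{D}(x)$ transforming as $\mathcal{D}(x')=\mathcal{D}(x)\,Ber(J)$, $J$ the super Jacobian with blocks $A=\partial x'/\partial x$, $B=\partial x'/\partial\theta$, $C=\partial\theta'/\partial x$, $D=\partial\theta'/\partial\theta$, $Ber(J)=\det(A-BD^{-1}C)\det(D)^{-1}$ (right derivatives with respect to odd coordinates, normalized so that $\partial\theta_\alpha/\partial\theta_\beta=\delta_{\alpha\beta}$). *)

(* Defs.v *)
From HB Require Import structures.
From mathcomp Require Import all_boot all_order all_algebra generic_quotient.
From mathcomp Require Import all_classical all_reals topology normedtype derive.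

Set Implicit Arguments.
Unset Strict Implicit.
Unset Printing Implicit Defensive.

Import Order.TTheory GRing.Theory Num.Theory.
Import numFieldNormedType.Exports.

Local Open Scope classical_set_scope.
Local Open Scope ring_scope.

(* The Z/2-grading is carried by the grade involution f |-> (-1)^|f| f, whose
   eigenspaces for 1 and -1 are the even and the odd part; over a field of
   characteristic <> 2 this is the same data as the decomposition. *)
HB.mixin Record isSuperAlgebra (R : fieldType) A of GRing.PzRing A := {
  scal : R -> A;
  scalD : {morph scal : c d / c + d};
  scalM : {morph scal : c d / c * d};
  scal1 : scal 1 = 1;
  ginv : A -> A;
  ginvD : {morph ginv : f g / f + g};
  ginvM : {morph ginv : f g / f * g};
  ginvK : involutive ginv;
  ginv_scal : forall c, ginv (scal c) = scal c;
  superC : forall (a b : bool) f g,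
    ginv f = (-1) ^+ a * f -> ginv g = (-1) ^+ b * g ->
    f * g = (-1) ^+ (a && b) * (g * f) }.

#[short(type="superAlgType")]
HB.structure Definition SuperAlgebra (R : fieldType) :=
  {A of GRing.PzRing A & isSuperAlgebra R A}.

Section SuperAlgebraTheory.
Context {R : realType} {A : superAlgType R}.
Implicit Types f g : A.

Definition evenpart f : A := scal 2^-1 * (f + ginv f).
Definition oddpart f : A := scal 2^-1 * (f - ginv f).

Lemma ginv0 : ginv (0 : A) = 0.
Proof. by apply: (addrI (ginv 0)); rewrite -ginvD !addr0. Qed.

Lemma ginvN f : ginv (- f) = - ginv f.
Proof. by apply: (addrI (ginv f)); rewrite -ginvD !subrr ginv0. Qed.

Lemma ginv1 : ginv (1 : A) = 1.
Proof.
by rewrite -[RHS]ginvK -[ginv 1 in RHS]mul1r ginvM ginvK mulr1.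
Qed.

Lemma ginv_sum (J : Type) (r : seq J) (P : pred J) (F : J -> A) :
  ginv (\sum_(j <- r | P j) F j) = \sum_(j <- r | P j) ginv (F j).
Proof. exact: (big_morph _ ginvD ginv0). Qed.

Lemma ginv_prod (J : Type) (r : seq J) (P : pred J) (F : J -> A) :
  ginv (\prod_(j <- r | P j) F j) = \prod_(j <- r | P j) ginv (F j).
Proof. exact: (big_morph _ ginvM ginv1). Qed.

Lemma scal_half2 f : scal 2^-1 * (f + f) = f.
Proof.
rewrite -[f in f + f]mul1r -mulrDl -scal1 -scalD mulrA -scalM.
by rewrite -mulr2n mulVf ?pnatr_eq0 // scal1 mul1r.
Qed.

Lemma evenpart_odd f : evenpart f + oddpart f = f.
Proof.
by rewrite /evenpart /oddpart -mulrDr addrACA subrr addr0 scal_half2.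
Qed.

Lemma ginv_even f : ginv (evenpart f) = evenpart f.
Proof. by rewrite /evenpart ginvM ginv_scal ginvD ginvK addrC. Qed.

Lemma ginv_odd f : ginv (oddpart f) = - oddpart f.
Proof.
by rewrite /oddpart ginvM ginv_scal ginvD ginvN ginvK -mulrN opprB addrC.
Qed.

Lemma evenpart_ginv f : evenpart (ginv f) = evenpart f.
Proof. by rewrite /evenpart ginvK addrC. Qed.

Lemma oddpart_ginv f : oddpart (ginv f) = - oddpart f.
Proof. by rewrite /oddpart ginvK -mulrN opprB. Qed.

Lemma even_odd_ginv f : evenpart f - oddpart f = ginv f.
Proof. by rewrite -ginv_odd -{1}ginv_even -ginvD evenpart_odd. Qed.

Lemma evenC f g : ginv f = f -> f * g = g * f.
Proof.
move=> f0; have H (b : bool) h : ginv h = (-1) ^+ b * h -> f * h = h * f.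
  move=> hb; have := @superC _ _ false b f h.
  by rewrite expr0 !mul1r; apply.
rewrite -(evenpart_odd g) mulrDr mulrDl (H false) ?(H true) //.
  by rewrite ginv_odd expr1 mulN1r.
by rewrite ginv_even expr0 mul1r.
Qed.

Lemma oddC f g : ginv f = - f -> f * g = ginv g * f.
Proof.
move=> f1; rewrite -{1}(evenpart_odd g) mulrDr -(@evenC _ f (ginv_even g)).
rewrite (@superC _ _ true true f (oddpart g)) ?ginv_odd ?f1 ?expr1 ?mulN1r //.
by rewrite -mulNr -mulrDl even_odd_ginv.
Qed.

End SuperAlgebraTheory.

(** Open sets and sheaves *)

Record opens (X : topologicalType) :=
  Opens { oset :> set X; osetP : open oset }.
Definition opens_mem X (U : opens X) (x : X) : Prop := oset U x.
Coercion opens_mem : opens >-> Funclass.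

Section Opens.
Variable X : topologicalType.
Implicit Types U V W : opens X.

Definition opI U V : opens X := Opens (openI (osetP U) (osetP V)).

Lemma opIl U V : opI U V `<=` U. Proof. exact: subIsetl. Qed.
Lemma opIr U V : opI U V `<=` V. Proof. exact: subIsetr. Qed.
Lemma opIS U U' V V' : U' `<=` U -> V' `<=` V -> opI U' V' `<=` opI U V.
Proof. exact: setISS. Qed.

Variables (F : opens X -> Type)
  (res : forall U V, V `<=` U -> F U -> F V).

Definition sheaf_separated := forall (U : opens X) (C : set (opens X)),
  (forall V, C V -> V `<=` U) -> U `<=` \bigcup_(V in C) (V : set X) ->
  forall s t : F U,
  (forall (V : opens X) (VU : V `<=` U), C V -> res VU s = res VU t) -> s = t.

(* Only the values of the family s at the members of the cover C matter. *)
Definition sheaf_gluing := forall (U : opens X) (C : set (opens X)),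
  (forall V, C V -> V `<=` U) -> U `<=` \bigcup_(V in C) (V : set X) ->
  forall s : (forall V, F V),
  (forall (V W Z : opens X) (ZV : Z `<=` V) (ZW : Z `<=` W), C V -> C W ->
     res ZV (s V) = res ZW (s W)) ->
  exists t : F U, forall (V : opens X) (VU : V `<=` U), C V -> res VU t = s V.

End Opens.

Record superspace (R : realType) := SuperSpace {
  sstop :> topologicalType;
  sO : opens sstop -> superAlgType R;
  sres : forall U V : opens sstop, V `<=` U -> {rmorphism sO U -> sO V};
  sres_scal : forall (U V : opens _) (VU : V `<=` U) (c : R),
    sres VU (scal c) = scal c;
  sres_ginv : forall (U V : opens _) (VU : V `<=` U) (f : sO U),
    sres VU (ginv f) = ginv (sres VU f);
  sres_id : forall (U : opens _) (UU : U `<=` U) (f : sO U), sres UU f = f;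
  sres_comp : forall (U V W : opens _) (VU : V `<=` U) (WV : W `<=` V) (WU : W `<=` U)
    (f : sO U), sres WV (sres VU f) = sres WU f;
  sO_separated : sheaf_separated (fun U V VU => sres (U := U) (V := V) VU);
  sO_gluing : sheaf_gluing (fun U V VU => sres (U := U) (V := V) VU) }.

(** Sheaves of (left) O_M-modules *)

Section OModules.
Context {R : realType} (M : superspace R).

Record omodPresheaf := OModPresheaf {
  psec : forall U : opens M, lmodType (sO U);
  pres : forall U V : opens M, V `<=` U -> psec U -> psec V;
  presD : forall (U V : opens _) (VU : V `<=` U) (s t : psec U),
    pres VU (s + t) = pres VU s + pres VU t;
  presZ : forall (U V : opens _) (VU : V `<=` U) (f : sO U) (s : psec U),
    pres VU (f *: s) = sres VU f *: pres VU s;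
  pres_id : forall (U : opens _) (UU : U `<=` U) (s : psec U), pres UU s = s;
  pres_comp : forall (U V W : opens _) (VU : V `<=` U) (WV : W `<=` V) (WU : W `<=` U)
    (s : psec U), pres WV (pres VU s) = pres WU s }.

Record omodSheaf := OModSheaf {
  omodP :> omodPresheaf;
  omod_separated : sheaf_separated (@pres omodP);
  omod_gluing : sheaf_gluing (@pres omodP) }.

Definition omod_iso (F G : omodSheaf) : Prop :=
  exists phi : forall U : opens M, {linear psec F U -> psec G U},
    (forall U, bijective (phi U)) /\
    (forall (U V : opens _) (VU : V `<=` U) (s : psec F U),
       phi V (pres VU s) = pres VU (phi U s)).

End OModules.

Arguments pres {R M} o {U V}.

(** Sheafification *)

Section Sheafification.
Context {R : realType} (M : superspace R) (P : omodPresheaf M).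
Implicit Types U V W : opens M.

Definition loc_eq V (t t' : psec P V) := forall x, V x ->
  exists W (WV : W `<=` V), W x /\ pres P WV t = pres P WV t'.

(* A section over U of the associated sheaf, encoded by the set of all the
   pairs (V, t), with t a section of P over V contained in U, which represent
   it over V. *)
Record shsec U := ShSec {
  shrep :> forall V, psec P V -> Prop;
  shrep_sub : forall V t, shrep (V := V) t -> V `<=` U;
  shrep_res : forall V W (WV : W `<=` V) t, shrep t -> shrep (pres P WV t);
  shrep_uniq : forall V (t t' : psec P V), shrep t -> shrep t' -> loc_eq t t';
  shrep_local : forall V (t : psec P V), V `<=` U ->
    (forall x, V x -> exists W (WV : W `<=` V), W x /\ shrep (pres P WV t)) ->
    shrep t;
  shrep_cover : forall x, U x -> exists V (t : psec P V), V x /\ shrep t }.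

Lemma pres_irr U V (h h' : V `<=` U) t : pres P h t = pres P h' t.
Proof. by congr (pres P _ t). Qed.

Lemma shsec_eqP U (s s' : shsec U) :
  (forall V (t : psec P V), s V t <-> s' V t) -> s = s'.
Proof.
case: s s' => [r ? ? ? ? ?] [r' ? ? ? ? ?] /= rr'.
have E : r = r'.
  by apply: functional_extensionality_dep => V; apply/funext => t; apply/propext.
by subst r'; congr ShSec.
Qed.

Lemma shsec_le U (s s' : shsec U) :
  (forall V (t : psec P V), s V t -> s' V t) -> s = s'.
Proof.
move=> ss'; apply: shsec_eqP => V t; split; first exact: ss'.
move=> s't; apply: shrep_local (shrep_sub s't) _ => x Vx.
have [W [u [Wx su]]] := shrep_cover s (shrep_sub s't Vx).
have h1 := shrep_res (@opIr _ V W) su.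
have h2 := shrep_res (@opIl _ V W) s't.
have [Z [ZVW [Zx E]]] := shrep_uniq (ss' _ _ h1) h2 (conj Vx Wx).
exists Z, (subset_trans ZVW (@opIl _ V W)); split=> //.
by rewrite -(pres_comp (@opIl _ V W) ZVW) -E; apply: shrep_res.
Qed.

Lemma shsec_loc U (s s' : shsec U) :
  (forall V (t : psec P V), s V t -> forall x, V x ->
     exists W (WV : W `<=` V), W x /\ s' W (pres P WV t)) -> s = s'.
Proof.
move=> ss'; apply: shsec_le => V t st.
exact: shrep_local (shrep_sub st) (ss' _ _ st).
Qed.

Section Generate.
Variables (U : opens M) (Q : forall V, psec P V -> Prop).
Hypothesis Qsub : forall V t, Q (V := V) t -> V `<=` U.
Hypothesis Qres : forall V W (WV : W `<=` V) t, Q t -> Q (pres P WV t).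
Hypothesis Quniq : forall V (t t' : psec P V), Q t -> Q t' -> loc_eq t t'.
Hypothesis Qcover : forall x, U x -> exists V (t : psec P V), V x /\ Q t.

Definition gen_rep V (t : psec P V) := V `<=` U /\ forall x, V x ->
  exists W (WV : W `<=` V), W x /\ Q (pres P WV t).

Lemma gen_res V W (WV : W `<=` V) t : gen_rep t -> gen_rep (pres P WV t).
Proof.
move=> [VU Qt]; split=> [|x Wx]; first exact: subset_trans WV VU.
have [Z [ZV [Zx QZ]]] := Qt x (WV x Wx).
exists (opI W Z), (@opIl _ W Z); split=> //.
rewrite (pres_comp _ _ (subset_trans (@opIr _ W Z) ZV)).
by rewrite -(pres_comp ZV (@opIr _ W Z)); apply: Qres.
Qed.

Lemma gen_uniq V (t t' : psec P V) : gen_rep t -> gen_rep t' -> loc_eq t t'.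
Proof.
move=> [_ Qt] [_ Qt'] x Vx.
have [W [WV [Wx QW]]] := Qt x Vx; have [W' [WV' [Wx' QW']]] := Qt' x Vx.
have h1 := Qres (@opIl _ W W') QW; have h2 := Qres (@opIr _ W W') QW'.
have IV : opI W W' `<=` V := subset_trans (@opIl _ W W') WV.
rewrite (pres_comp _ _ IV) in h1; rewrite (pres_comp _ _ IV) in h2.
have [Z [ZI [Zx E]]] := Quniq h1 h2 (conj Wx Wx').
exists Z, (subset_trans ZI IV); split=> //.
by rewrite -(pres_comp IV ZI) E (pres_comp _ _ (subset_trans ZI IV)).
Qed.

Lemma gen_local V (t : psec P V) : V `<=` U ->
  (forall x, V x -> exists W (WV : W `<=` V), W x /\ gen_rep (pres P WV t)) ->
  gen_rep t.
Proof.
move=> VU H; split=> // x Vx; have [W [WV [Wx [_ QW]]]] := H x Vx.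
have [Z [ZW [Zx QZ]]] := QW x Wx.
exists Z, (subset_trans ZW WV); split=> //.
by rewrite -(pres_comp WV ZW).
Qed.

Lemma gen_in V (t : psec P V) : Q t -> gen_rep t.
Proof.
move=> Qt; split=> [|x Vx]; first exact: Qsub Qt.
by exists V, (@subset_refl _ V); rewrite pres_id.
Qed.

Lemma gen_cover x : U x -> exists V (t : psec P V), V x /\ gen_rep t.
Proof.
by move=> /Qcover [V [t [Vx Qt]]]; exists V, t; split=> //; apply: gen_in.
Qed.

Definition gensec : shsec U := ShSec (fun V t h => proj1 h)
  gen_res gen_uniq gen_local gen_cover.

End Generate.

Section Operations.
Variable U : opens M.
Implicit Types s : shsec U.

Lemma pres0 V W (WV : W `<=` V) : pres P WV 0 = 0.
Proof. by apply: (addrI (pres P WV 0)); rewrite -presD !addr0. Qed.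

Lemma loc_eqxx V (t : psec P V) : loc_eq t t.
Proof. by move=> x Vx; exists V, (@subset_refl _ V). Qed.

Definition shadd s s' : shsec U.
Proof.
refine (@gensec U (fun V t => exists u u', s V u /\ s' V u' /\ t = u + u')
  _ _ _ _).
- by move=> V t [u [u' [/shrep_sub]]].
- move=> V W WV t [u [u' [su [su' ->]]]]; exists (pres P WV u), (pres P WV u').
  by rewrite presD; do !split=> //; apply: shrep_res.
- move=> V t t' [u [u' [su [su' ->]]]] [v [v' [sv [sv' ->]]]] x Vx.
  have [W [WV [Wx E]]] := shrep_uniq su sv Vx.
  have [W' [WV' [Wx' E']]] := shrep_uniq su' sv' Vx.
  have IV : opI W W' `<=` V := subset_trans (@opIl _ W W') WV.
  exists (opI W W'), IV; split=> //; rewrite !presD.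
  rewrite -!(pres_comp WV (@opIl _ W W') IV) E; congr (_ + _).
  rewrite !(pres_comp WV (@opIl _ W W') IV).
  by rewrite -!(pres_comp WV' (@opIr _ W W') IV) E'.
- move=> x Ux; have [V [t [Vx st]]] := shrep_cover s Ux.
  have [V' [t' [Vx' st']]] := shrep_cover s' Ux.
  exists (opI V V'), (pres P (@opIl _ V V') t + pres P (@opIr _ V V') t').
  split=> //; exists (pres P (@opIl _ V V') t), (pres P (@opIr _ V V') t').
  by do !split; apply: shrep_res.
Defined.

Lemma shaddI s s' V u u' : s V u -> s' V u' -> shadd s s' V (u + u').
Proof.
move=> su su'; split; first exact: shrep_sub su.
move=> x Vx; exists V, (@subset_refl _ V); split=> //; rewrite pres_id.
by exists u, u'.
Qed.

Definition shzero : shsec U.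
Proof.
refine (@gensec U (fun V t => V `<=` U /\ t = 0) _ _ _ _).
- by move=> V t [].
- by move=> V W WV t [VU ->]; split; [exact: subset_trans VU|rewrite pres0].
- by move=> V t t' [_ ->] [_ ->]; apply: loc_eqxx.
- by move=> x Ux; exists U, 0; do !split.
Defined.

Lemma shzeroI V : V `<=` U -> shzero V 0.
Proof.
move=> VU; split=> // x Vx; exists V, (@subset_refl _ V); split=> //.
by rewrite pres_id.
Qed.

Definition shscale (f : sO U) s : shsec U.
Proof.
refine (@gensec U (fun V t => exists (VU : V `<=` U) u, s V u /\
  t = sres VU f *: u) _ _ _ _).
- by move=> V t [].
- move=> V W WV t [VU [u [su ->]]].
  exists (subset_trans WV VU), (pres P WV u).
  by rewrite presZ (sres_comp _ _ (subset_trans WV VU)); split=> //; apply: shrep_res.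
- move=> V t t' [VU [u [su ->]]] [VU' [u' [su' ->]]] x Vx.
  have [W [WV [Wx E]]] := shrep_uniq su su' Vx.
  exists W, WV; split=> //; rewrite !presZ E.
  by rewrite !(sres_comp _ _ (subset_trans WV VU)).
- move=> x Ux; have [V [t [Vx st]]] := shrep_cover s Ux.
  exists V, (sres (shrep_sub st) f *: t); split=> //.
  by exists (shrep_sub st), t.
Defined.

Lemma shscaleI f s V (VU : V `<=` U) u : s V u -> shscale f s V (sres VU f *: u).
Proof.
move=> su; split=> // x Vx; exists V, (@subset_refl _ V); split=> //.
by rewrite pres_id; exists VU, u.
Qed.

Lemma shaddE s s' V t : shadd s s' V t -> forall x, V x ->
  exists W (WV : W `<=` V), W x /\
  exists u u', [/\ s W u, s' W u' & pres P WV t = u + u'].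
Proof.
move=> [_ H] x /H [W [WV [Wx [u [u' [su [su' E]]]]]]].
by exists W, WV; split=> //; exists u, u'.
Qed.

Lemma shscaleE f s V t : shscale f s V t -> forall x, V x ->
  exists W (WV : W `<=` V), W x /\
  exists (WU : W `<=` U) u, s W u /\ pres P WV t = sres WU f *: u.
Proof. by move=> [_ H] x /H. Qed.

Lemma shaddC : commutative shadd.
Proof.
move=> s s'; apply: shsec_loc => V t st x Vx.
have [W [WV [Wx [u [u' [su su' E]]]]]] := shaddE st Vx.
by exists W, WV; split=> //; rewrite E addrC; apply: shaddI.
Qed.

Lemma shaddA : associative shadd.
Proof.
move=> a b c; apply: shsec_loc => V t st x Vx.
have [W [WV [Wx [u [v [su sv E]]]]]] := shaddE st Vx.
have [Z [ZW [Zx [v1 [v2 [sv1 sv2 E']]]]]] := shaddE sv Wx.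
exists Z, (subset_trans ZW WV); split=> //.
rewrite -(pres_comp WV ZW) E presD E' addrA.
by do !apply: shaddI => //; apply: shrep_res.
Qed.

Lemma shadd0 : left_id shzero shadd.
Proof.
move=> s; apply: shsec_loc => V t st x Vx.
have [W [WV [Wx [u [v [[_ su] sv E]]]]]] := shaddE st Vx.
have [Z [ZW [Zx [_ E']]]] := su x Wx.
exists Z, (subset_trans ZW WV); split=> //.
by rewrite -(pres_comp WV ZW) E presD E' add0r; apply: shrep_res.
Qed.

Definition shopp s := shscale (-1) s.

Lemma shoppK : left_inverse shzero shopp shadd.
Proof.
move=> s; apply: shsec_loc => V t st x Vx.
have [W [WV [Wx [u [v [su sv E]]]]]] := shaddE st Vx.
have [Z [ZW [Zx [ZU [w [sw E']]]]]] := shscaleE su Wx.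
have [Y [YZ [Yx E'']]] := shrep_uniq sw (shrep_res ZW sv) Zx.
exists Y, (subset_trans YZ (subset_trans ZW WV)); split=> //.
rewrite -(pres_comp (subset_trans ZW WV) YZ) -(pres_comp WV ZW).
rewrite E !presD E' -E'' presZ rmorphN1 rmorphN1 scaleN1r addNr.
apply: shzeroI; exact: subset_trans YZ ZU.
Qed.

Lemma shscaleA f g s : shscale f (shscale g s) = shscale (f * g) s.
Proof.
apply: shsec_loc => V t st x Vx.
have [W [WV [Wx [WU [u [su E]]]]]] := shscaleE st Vx.
have [Z [ZW [Zx [ZU [w [sw E']]]]]] := shscaleE su Wx.
exists Z, (subset_trans ZW WV); split=> //.
rewrite -(pres_comp WV ZW) E presZ E' scalerA (sres_comp _ _ ZU) -rmorphM.
exact: shscaleI.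
Qed.

Lemma shscale1 s : shscale 1 s = s.
Proof.
apply: shsec_loc => V t st x Vx.
have [W [WV [Wx [WU [u [su E]]]]]] := shscaleE st Vx.
by exists W, WV; split=> //; rewrite E rmorph1 scale1r.
Qed.

Lemma shscaleDr f : {morph shscale f : s s' / shadd s s'}.
Proof.
move=> s s'; apply: shsec_loc => V t st x Vx.
have [W [WV [Wx [WU [u [su E]]]]]] := shscaleE st Vx.
have [Z [ZW [Zx [u1 [u2 [sv1 sv2 E']]]]]] := shaddE su Wx.
exists Z, (subset_trans ZW WV); split=> //.
rewrite -(pres_comp WV ZW) E presZ E' scalerDr.
rewrite (sres_comp _ _ (subset_trans ZW WU)).
by apply: shaddI; apply: shscaleI.
Qed.

Lemma shscaleDl s : {morph shscale^~ s : f g / f + g >-> shadd f g}.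
Proof.
move=> f g; apply: shsec_loc => V t st x Vx.
have [W [WV [Wx [WU [u [su E]]]]]] := shscaleE st Vx.
exists W, WV; split=> //; rewrite E rmorphD scalerDl.
by apply: shaddI; apply: shscaleI.
Qed.

HB.instance Definition _ := gen_eqMixin (shsec U).
HB.instance Definition _ := gen_choiceMixin (shsec U).
HB.instance Definition _ :=
  GRing.isZmodule.Build (shsec U) shaddA shaddC shadd0 shoppK.
HB.instance Definition _ := GRing.Zmodule_isLmodule.Build (sO U) (shsec U)
  shscaleA shscale1 shscaleDr shscaleDl.

End Operations.

Definition shres U V (VU : V `<=` U) (s : shsec U) : shsec V.
Proof.
refine (@ShSec V (fun W t => W `<=` V /\ s W t) _ _ _ _ _).
- by move=> W t [].
- move=> W Z ZW t [WV st]; split; first exact: subset_trans ZW WV.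
  exact: shrep_res.
- by move=> W t t' [_ st] [_ st']; apply: shrep_uniq st st'.
- move=> W t WV H; split=> //; apply: shrep_local.
    exact: subset_trans WV VU.
  by move=> x /H [Z [ZW [Zx [_ sZ]]]]; exists Z, ZW.
- move=> x Vx; have [W [t [Wx st]]] := shrep_cover s (VU x Vx).
  exists (opI W V), (pres P (@opIl _ W V) t); split=> //.
  by split; [exact: opIr|exact: shrep_res].
Defined.

Lemma shresD U V (VU : V `<=` U) (s t : shsec U) :
  shres VU (s + t) = shres VU s + shres VU t.
Proof.
apply: shsec_loc => W u [WV su] x Wx.
have [Z [ZW [Zx [v [w [sv sw E]]]]]] := shaddE su Wx.
exists Z, ZW; split=> //; rewrite E.
by apply: shaddI; split=> //; apply: subset_trans ZW WV.
Qed.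

Lemma shresZ U V (VU : V `<=` U) (f : sO U) (s : shsec U) :
  shres VU (f *: s) = sres VU f *: shres VU s.
Proof.
apply: shsec_loc => W u [WV su] x Wx.
have [Z [ZW [Zx [ZU [v [sv E]]]]]] := shscaleE su Wx.
exists Z, ZW; split=> //; have ZV := subset_trans ZW WV.
by rewrite E -(sres_comp VU ZV); apply: shscaleI.
Qed.

Lemma shres_id U (UU : U `<=` U) (s : shsec U) : shres UU s = s.
Proof. by apply: shsec_le => W t []. Qed.

Lemma shres_comp U V W (VU : V `<=` U) (WV : W `<=` V) (WU : W `<=` U)
  (s : shsec U) : shres WV (shres VU s) = shres WU s.
Proof. by apply: shsec_le => Z t [ZW [_ sZ]]; split. Qed.

Definition sheafify_pre : omodPresheaf M :=
  @OModPresheaf R M (fun U => shsec U : lmodType (sO U))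
    shres shresD shresZ shres_id shres_comp.

Lemma sheafify_separated : sheaf_separated (@pres R M sheafify_pre).
Proof.
move=> U C CU cov s t st; apply: shsec_loc => V u su x Vx.
have [W CW Wx] := cov x (shrep_sub su Vx).
exists (opI V W), (@opIl _ V W); split=> //.
have E : shres (CU W CW) s = shres (CU W CW) t := st W (CU W CW) CW.
have : shres (CU W CW) s _ (pres P (@opIl _ V W) u).
  by split; [exact: opIr|exact: shrep_res].
by rewrite E => -[].
Qed.

Lemma sheafify_gluing : sheaf_gluing (@pres R M sheafify_pre).
Proof.
move=> U C CU cov s scomp.
pose Q V (t : psec P V) := exists W, C W /\ (s W : shsec W) V t.
have Qsub V t : Q V t -> V `<=` U.
  by move=> [W [CW /shrep_sub VW]]; apply: subset_trans VW (CU W CW).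
have Qres V W (WV : W `<=` V) t : Q V t -> Q W (pres P WV t).
  by move=> [Z [CZ sZ]]; exists Z; split=> //; apply: shrep_res.
have Quniq V (t t' : psec P V) : Q V t -> Q V t' -> loc_eq t t'.
  move=> [W [CW sW]] [W' [CW' sW']].
  have VW := shrep_sub sW; have VW' := shrep_sub sW'.
  have /= E := scomp W W' V VW VW' CW CW'.
  have h : shres VW (s W) V t by split.
  rewrite E in h; apply: shrep_uniq sW'; by case: h.
have Qcover x : U x -> exists V (t : psec P V), V x /\ Q V t.
  move=> /cov [W CW Wx]; have [V [t [Vx sV]]] := shrep_cover (s W) Wx.
  by exists V, t; split=> //; exists W.
exists (gensec Qsub Qres Quniq Qcover) => V VU CV; apply/esym/shsec_le => W t sW.
by split; [exact: shrep_sub sW|apply: gen_in => //; exists V].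
Qed.

Definition sheafify : omodSheaf M :=
  OModSheaf sheafify_separated sheafify_gluing.

End Sheafification.

(** Real supermanifolds *)

Section Smooth.
Context {R : realType} {p : nat}.
Implicit Types (V : set 'rV[R]_p) (f : 'rV[R]_p -> R).

Definition line f (i : 'I_p) (y : 'rV[R]_p) : R -> R :=
  fun h => f (y + h *: delta_mx 0 i).

Definition partial (i : 'I_p) f : 'rV[R]_p -> R :=
  fun y => derive1 (line f i y) 0.

Definition partials (r : seq 'I_p) f := foldr partial f r.

Definition smooth_on V f := forall r : seq 'I_p, forall y, V y ->
  {for y, continuous (partials r f)} /\
  forall i, derivable (line (partials r f) i y) 0 1.

Lemma smooth_partial V i f : smooth_on V f -> smooth_on V (partial i f).
Proof. by move=> sf r y Vy; have := sf (rcons r i) y Vy; rewrite /partials foldr_rcons. Qed.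

End Smooth.

(* theta_I theta_J = wedge_sign I J theta_(I :|: J) for disjoint I and J, where
   theta_I is the product of the theta_a, a in I, in increasing order. *)
Definition wedge_sign (q : nat) (I J : {set 'I_q}) : nat :=
  #|[pred ab in finset.setX I J | (ab.2 < ab.1)%N]|.

(* A local coordinate system with values in R^{p|q}: an open embedding cmap of
   cdom in R^p and an isomorphism between O_M on cdom and the sheaf
   C^oo[theta_1, .., theta_q] on the image, given by the components of
   superfunctions: ccomp f I is the coefficient f_I of f = sum_I f_I theta_I;
   its values outside of the image of U are irrelevant. *)
Record chart {R : realType} (M : superspace R) (p q : nat) := Chart {
  cdom : opens M;
  cmap : M -> 'rV[R]_p;
  cmap_inj : forall x y, cdom x -> cdom y -> cmap x = cmap y -> x = y;
  cmap_cont : forall x, cdom x -> {for x, continuous cmap};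
  cmap_open : forall V : opens M, V `<=` cdom -> open (cmap @` V);
  ccomp : forall U : opens M, U `<=` cdom ->
    sO U -> {set 'I_q} -> 'rV[R]_p -> R;
  ccomp_smooth : forall (U : opens M) (Uc : U `<=` cdom) f I,
    smooth_on (cmap @` U) (ccomp Uc f I);
  ccomp_inj : forall (U : opens M) (Uc : U `<=` cdom) f g,
    (forall I, {in cmap @` U, ccomp Uc f I =1 ccomp Uc g I}) -> f = g;
  ccomp_surj : forall (U : opens M) (Uc : U `<=` cdom)
      (g : {set 'I_q} -> 'rV[R]_p -> R),
    (forall I, smooth_on (cmap @` U) (g I)) ->
    exists f, forall I, {in cmap @` U, ccomp Uc f I =1 g I};
  ccomp_res : forall (U V : opens M) (Uc : U `<=` cdom) (Vc : V `<=` cdom)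
      (VU : V `<=` U) f I,
    {in cmap @` V, ccomp Vc (sres VU f) I =1 ccomp Uc f I};
  ccompD : forall (U : opens M) (Uc : U `<=` cdom) f g I,
    {in cmap @` U, forall y,
      ccomp Uc (f + g) I y = ccomp Uc f I y + ccomp Uc g I y};
  ccomp_scal : forall (U : opens M) (Uc : U `<=` cdom) (c : R) I,
    {in cmap @` U, forall y,
      ccomp Uc (scal c) I y = if I == finset.set0 then c else 0};
  ccompM : forall (U : opens M) (Uc : U `<=` cdom) f g I,
    {in cmap @` U, forall y, ccomp Uc (f * g) I y =
      \sum_(J : {set 'I_q} | J \subset I) (-1) ^+ wedge_sign J (I :\: J)%SET *
        (ccomp Uc f J y * ccomp Uc g (I :\: J)%SET y)};
  ccomp_ginv : forall (U : opens M) (Uc : U `<=` cdom) f I,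
    {in cmap @` U, forall y,
      ccomp Uc (ginv f) I y = (-1) ^+ #|I| * ccomp Uc f I y} }.

Record supermanifold (R : realType) (p q : nat) := Supermanifold {
  smspace :> superspace R;
  sm_hausdorff : hausdorff_space smspace;
  sm_second_countable : @second_countable smspace;
  sm_charts : forall x : smspace, exists c : chart smspace p q, cdom c x }.

Section Coordinates.
Context {R : realType} {p q : nat} {M : supermanifold R p q}.
Implicit Types (a b c : chart M p q) (U V : opens M).

Definition from_comp c U (Uc : U `<=` cdom c)
    (g : {set 'I_q} -> 'rV[R]_p -> R) : sO U :=
  xget 0 [set f | forall I, {in cmap c @` U, ccomp Uc f I =1 g I}].

Definition even_coord c (i : 'I_p) : sO (cdom c) :=
  from_comp (@subset_refl _ (cdom c))
    (fun I y => if I == finset.set0 then y 0 i else 0).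

Definition odd_coord c (al : 'I_q) : sO (cdom c) :=
  from_comp (@subset_refl _ (cdom c))
    (fun I _ => if I == finset.set1 al then 1 else 0).

Definition even_deriv c U (Uc : U `<=` cdom c) (i : 'I_p) (f : sO U) : sO U :=
  from_comp Uc (fun I => partial i (ccomp Uc f I)).

(* The right derivative: (theta_I theta_al) <-d/dtheta_al = theta_I. *)
Definition odd_deriv c U (Uc : U `<=` cdom c) (al : 'I_q) (f : sO U) : sO U :=
  from_comp Uc (fun I y => if al \in I then 0 else
    (-1) ^+ #|[pred be in I | (al < be)%N]| * ccomp Uc f (al |: I)%SET y).

(* The differentials are dx'_i = sum_j A_ij dx_j + sum_be B_i,be dtheta_be and
   dtheta'_al = sum_j C_al,j dx_j + sum_be D_al,be dtheta_be with the blocks of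
   the super Jacobian of the coordinates of the chart b
   (x', theta') with respect to those of a (x, theta), on the overlap. *)
Definition overlap a b := opI (cdom a) (cdom b).
Definition onl a b : overlap a b `<=` cdom a := @opIl _ _ _.
Definition onr a b : overlap a b `<=` cdom b := @opIr _ _ _.

Definition jacA a b : 'M[sO (overlap a b)]_(p, p) :=
  \matrix_(i, j) even_deriv (@onl a b) j (sres (@onr a b) (even_coord b i)).
Definition jacB a b : 'M[sO (overlap a b)]_(p, q) :=
  \matrix_(i, j) odd_deriv (@onl a b) j (sres (@onr a b) (even_coord b i)).
Definition jacC a b : 'M[sO (overlap a b)]_(q, p) :=
  \matrix_(i, j) even_deriv (@onl a b) j (sres (@onr a b) (odd_coord b i)).
Definition jacD a b : 'M[sO (overlap a b)]_(q, q) :=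
  \matrix_(i, j) odd_deriv (@onl a b) j (sres (@onr a b) (odd_coord b i)).

End Coordinates.

Section Inverses.
Context {A : pzRingType}.

(* The two-sided inverses, if they exist. *)
Definition ring_inv (u : A) : A := xget 0 [set v | u * v = 1 /\ v * u = 1].

Definition mx_inv n (D : 'M[A]_n) : 'M[A]_n :=
  xget 0 [set E | D *m E = 1%:M /\ E *m D = 1%:M].

Definition berezinian p q (a : 'M[A]_p) (b : 'M[A]_(p, q))
    (c : 'M[A]_(q, p)) (d : 'M[A]_q) : A :=
  \det (a - b *m mx_inv d *m c) * ring_inv (\det d).

End Inverses.

(** Sheaves given by local frames and their transition functions: the sections
    over U are the families of coefficient vectors, one for each coordinate
    system of M, which agree on the overlaps. *)

Section Glue.
Context {R : realType} {p q : nat} (M : supermanifold R p q) (I : finType).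
(* e^b_j = sum_i t a b j i e^a_i on the overlap of the charts a and b. *)
Variable t : forall a b : chart M p q, I -> I -> sO (overlap a b).
Implicit Types U V W : opens M.

Definition ov3 U (a b : chart M p q) := opI U (overlap a b).
Definition ov3a U a b : ov3 U a b `<=` opI U (cdom a) :=
  opIS (@subset_refl _ _) (@onl _ _ _ _ a b).
Definition ov3b U a b : ov3 U a b `<=` opI U (cdom b) :=
  opIS (@subset_refl _ _) (@onr _ _ _ _ a b).
Definition ov3o U a b : ov3 U a b `<=` overlap a b := @opIr _ _ _.

Definition compatible U (s : forall a : chart M p q, I -> sO (opI U (cdom a))) :=
  forall a b i, sres (@ov3a U a b) (s a i) =
    \sum_j sres (@ov3b U a b) (s b j) * sres (@ov3o U a b) (t a b j i).

Record gsec U := GSec {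
  gval :> forall a : chart M p q, I -> sO (opI U (cdom a));
  gvalP : compatible gval }.

Lemma gsecP U (s s' : gsec U) : (forall a i, s a i = s' a i) -> s = s'.
Proof.
case: s s' => [s sP] [s' s'P] /= ss'.
have E : s = s'.
  by apply: functional_extensionality_dep => a; apply/funext.
by subst s'; congr GSec.
Qed.

Lemma gadd_subproof U (s s' : gsec U) : compatible (fun a i => s a i + s' a i).
Proof.
move=> a b i; rewrite rmorphD !gvalP -big_split; apply: eq_bigr => j _ /=.
by rewrite rmorphD mulrDl.
Qed.
Definition gadd U (s s' : gsec U) := GSec (gadd_subproof s s').

Lemma gzero_subproof U : compatible (fun a i => 0 : sO (opI U (cdom a))).
Proof.
by move=> a b i; rewrite rmorph0 big1 // => j _; rewrite rmorph0 mul0r.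
Qed.
Definition gzero U := GSec (@gzero_subproof U).

Lemma gscale_subproof U (f : sO U) (s : gsec U) :
  compatible (fun a i => sres (@opIl _ U (cdom a)) f * s a i).
Proof.
move=> a b i; rewrite rmorphM gvalP big_distrr; apply: eq_bigr => j _ /=.
by rewrite rmorphM mulrA !(sres_comp _ _ (@opIl _ U (overlap a b))).
Qed.
Definition gscale U (f : sO U) (s : gsec U) := GSec (gscale_subproof f s).

Definition gopp U (s : gsec U) := gscale (-1) s.

Section Module.
Variable U : opens M.

Lemma gaddA : associative (@gadd U).
Proof. by move=> a b c; apply: gsecP => x i; rewrite /= addrA. Qed.
Lemma gaddC : commutative (@gadd U).
Proof. by move=> a b; apply: gsecP => x i; rewrite /= addrC. Qed.
Lemma gadd0 : left_id (@gzero U) (@gadd U).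
Proof. by move=> a; apply: gsecP => x i; rewrite /= add0r. Qed.
Lemma gaddN : left_inverse (@gzero U) (@gopp U) (@gadd U).
Proof. by move=> a; apply: gsecP => x i; rewrite /= rmorphN1 mulN1r addNr. Qed.

HB.instance Definition _ := gen_eqMixin (gsec U).
HB.instance Definition _ := gen_choiceMixin (gsec U).
HB.instance Definition _ :=
  GRing.isZmodule.Build (gsec U) gaddA gaddC gadd0 gaddN.

Lemma gscaleA f g (s : gsec U) : gscale f (gscale g s) = gscale (f * g) s.
Proof. by apply: gsecP => x i; rewrite /= rmorphM mulrA. Qed.
Lemma gscale1 (s : gsec U) : gscale 1 s = s.
Proof. by apply: gsecP => x i; rewrite /= rmorph1 mul1r. Qed.
Lemma gscaleDr f : {morph @gscale U f : s s' / s + s'}.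
Proof. by move=> s s'; apply: gsecP => x i; rewrite /= mulrDr. Qed.
Lemma gscaleDl (s : gsec U) : {morph (@gscale U)^~ s : f g / f + g}.
Proof. by move=> f g; apply: gsecP => x i; rewrite /= rmorphD mulrDl. Qed.

HB.instance Definition _ := GRing.Zmodule_isLmodule.Build (sO U) (gsec U)
  gscaleA gscale1 gscaleDr gscaleDl.

End Module.

Lemma gres_subproof U V (VU : V `<=` U) (s : gsec U) :
  compatible (fun a i => sres (opIS VU (@subset_refl _ (cdom a))) (s a i)).
Proof.
move=> a b i; pose VU' := opIS VU (@subset_refl _ (overlap a b)).
rewrite (sres_comp _ _ (subset_trans VU' (@ov3a U a b))).
rewrite -(sres_comp (@ov3a U a b) VU') gvalP rmorph_sum; apply: eq_bigr => j _.
rewrite rmorphM !(sres_comp _ _ (@ov3o V a b)); congr (_ * _).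
by rewrite !(sres_comp _ _ (subset_trans VU' (@ov3b U a b))).
Qed.
Definition gres U V (VU : V `<=` U) (s : gsec U) := GSec (gres_subproof VU s).

Lemma gresD U V (VU : V `<=` U) (s s' : gsec U) :
  gres VU (s + s') = gres VU s + gres VU s'.
Proof. by apply: gsecP => a i; rewrite /= rmorphD. Qed.

Lemma gresZ U V (VU : V `<=` U) f (s : gsec U) :
  gres VU (f *: s) = sres VU f *: gres VU s.
Proof.
apply: gsecP => a i; rewrite /= rmorphM; congr (_ * _).
by rewrite !(sres_comp _ _ (subset_trans (@opIl _ V (cdom a)) VU)).
Qed.

Lemma gres_id U (UU : U `<=` U) (s : gsec U) : gres UU s = s.
Proof. by apply: gsecP => a i; rewrite /= sres_id. Qed.

Lemma gres_comp U V W (VU : V `<=` U) (WV : W `<=` V) (WU : W `<=` U)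
  (s : gsec U) : gres WV (gres VU s) = gres WU s.
Proof. by apply: gsecP => a i; rewrite /=; exact: sres_comp. Qed.

Definition glue_pre : omodPresheaf M :=
  @OModPresheaf R M (fun U => gsec U : lmodType (sO U))
    gres gresD gresZ gres_id gres_comp.

Lemma glue_separated : sheaf_separated (@pres R M glue_pre).
Proof.
move=> U C CU cov s s' ss'; apply: gsecP => a i.
apply: (@sO_separated _ M (opI U (cdom a)) [set opI V (cdom a) | V in C]).
- by move=> _ [V CV <-]; apply: opIS => //; exact: (CU V CV).
- move=> x [Ux ax]; have [V CV Vx] := cov x Ux.
  by exists (opI V (cdom a)) => //; exists V.
- move=> W WU [V CV E]; move: WU; rewrite -{}E => WU.
  have VU := CU V CV.
  have -> : WU = opIS VU (@subset_refl _ (cdom a)) by [].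
  exact: (f_equal (fun r : gsec V => r a i) (ss' V VU CV)).
Qed.

Lemma glue_gluing : sheaf_gluing (@pres R M glue_pre).
Proof.
move=> U C CU cov s scomp.
have scompE (V W Y : opens M) (a : chart M p q) i
    (hV : Y `<=` opI V (cdom a)) (hW : Y `<=` opI W (cdom a)) :
    C V -> C W ->
    sres hV ((s V : gsec V) a i) = sres hW ((s W : gsec W) a i).
  move=> CV CW; pose Z := opI V W.
  have h : Y `<=` opI Z (cdom a).
    by move=> x Yx; have [? ?] := hV x Yx; have [? _] := hW x Yx.
  have /= E := f_equal (fun r : gsec Z => sres h (r a i))
    (scomp _ _ _ (@opIl _ V W) (@opIr _ V W) CV CW).
  by move: E; rewrite /= (sres_comp _ _ hV) (sres_comp _ _ hW).
pose good (a : chart M p q) (W V : opens M) := C V /\ W `<=` opI V (cdom a).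
pose fam (a : chart M p q) (i : I) (W : opens M) : sO W := if pselect (exists V, good a W V) is left e
  then sres (proj2 (projT2 (cid e))) ((s (projT1 (cid e)) : gsec _) a i) else 0.
have famE a i (W V : opens M) (h : W `<=` opI V (cdom a)) : C V ->
    fam a i W = sres h ((s V : gsec V) a i).
  move=> CV; rewrite /fam; case: pselect => [e|]; last by case; exists V.
  by apply: scompE => //; case: (cid e) => /= ? [].
have glue1 a i : {g : sO (opI U (cdom a)) |
    forall (V : opens M) (CV : C V), sres (opIS (CU V CV) (@subset_refl _ (cdom a))) g =
      (s V : gsec V) a i}.
  apply: cid.
  have [||V W Z ZV ZW [V' CV' EV] [W' CW' EW]|g gP] := @sO_gluing _ M
    (opI U (cdom a)) [set opI V (cdom a) | V in C] _ _ (fam a i).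
  - by move=> _ [V CV <-]; apply: opIS => //; exact: (CU V CV).
  - move=> x [Ux ax]; have [V CV Vx] := cov x Ux.
    by exists (opI V (cdom a)) => //; exists V.
  - move: ZV ZW; rewrite -{}EV -{}EW => ZV ZW.
    rewrite (famE _ _ _ V' (@subset_refl _ _) CV').
    by rewrite (famE _ _ _ W' (@subset_refl _ _) CW') !sres_id; apply: scompE.
  - exists g => V CV; rewrite gP; last by exists V.
    by rewrite (famE _ _ _ V (@subset_refl _ _) CV) sres_id.
pose g a i := projT1 (glue1 a i).
have gE (V : opens M) (VU : V `<=` U) (CV : C V) a i :
    sres (opIS VU (@subset_refl _ (cdom a))) (g a i) = (s V : gsec V) a i.
  by rewrite -(projT2 (glue1 a i) V CV); congr (sres _ _).
have gP : compatible g.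
  move=> a b i.
  apply: (@sO_separated _ M _ [set ov3 V a b | V in C]).
  - by move=> _ [V CV <-]; apply: opIS => //; exact: (CU V CV).
  - move=> x [Ux ax]; have [V CV Vx] := cov x Ux.
    by exists (ov3 V a b) => //; exists V.
  - move=> W WU [V CV E]; move: WU; rewrite -{}E => WU.
    have VU := CU V CV.
    have key c j (h : ov3 V a b `<=` opI V (cdom c))
        (h' : ov3 U a b `<=` opI U (cdom c)) :
        sres WU (sres h' (g c j)) = sres h ((s V : gsec V) c j).
      by rewrite -(gE V VU CV) !(sres_comp _ _ (subset_trans WU h')).
    rewrite (key _ _ (@ov3a V a b)) gvalP rmorph_sum; apply: eq_bigr => j _.
    rewrite rmorphM (key _ _ (@ov3b V a b)); congr (_ * _).
    by rewrite (sres_comp _ _ (@ov3o V a b)).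
exists (GSec gP) => V VU CV; apply: gsecP => a i; exact: gE.
Qed.

Definition glue : omodSheaf M := OModSheaf glue_separated glue_gluing.

End Glue.

(** Delta forms *)

Section DeltaOperators.
Context {R : realType} {A : superAlgType R} {p q : nat}.

(* w e l is the coefficient of (dx)^e delta^(l)(dtheta), where (dx)^e is the
   product of the dx_i, i in e, in increasing order and delta^(l)(dtheta) is
   delta^(l_1)(dtheta_1) ... delta^(l_q)(dtheta_q). *)
Definition dform := {set 'I_p} -> {ffun 'I_q -> nat} -> A.
Implicit Type w : dform.

Definition dx_mul (j : 'I_p) w : dform := fun e l =>
  if j \in e then
    (-1) ^+ #|[pred i in e | (i < j)%N]| * ginv (w (e :\ j)%SET l) else 0.

Definition incr (l : {ffun 'I_q -> nat}) (be : 'I_q) : {ffun 'I_q -> nat} :=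
  [ffun al => (l al + (al == be))%N].
Definition decr (l : {ffun 'I_q -> nat}) (be : 'I_q) : {ffun 'I_q -> nat} :=
  [ffun al => (l al - (al == be))%N].

(* dtheta delta^(n+1)(dtheta) = - (n+1) delta^(n)(dtheta) *)
Definition dtheta_mul (be : 'I_q) w : dform := fun e l =>
  - ((l be).+1%:R * w e (incr l be)).

Definition ddtheta (be : 'I_q) w : dform := fun e l =>
  if l be == 0%N then 0 else w e (decr l be).

Definition delta0 (c : A) : dform := fun e l =>
  if (e == finset.set0) && [forall al, l al == 0%N] then c else 0.

Section Substitution.
Variables (jA : 'M[A]_(p, p)) (jB : 'M[A]_(p, q))
  (jC : 'M[A]_(q, p)) (jD : 'M[A]_(q, q)).

Definition dx'_mul (i : 'I_p) w : dform := fun e l =>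
  \sum_j jA i j * dx_mul j w e l + \sum_be jB i be * dtheta_mul be w e l.

(* Multiplication by the nilpotent part sum_j C_al,j dx_j of
   dtheta'_al = sum_j C_al,j dx_j + y_al, where y = D dtheta. *)
Definition nil_mul (al : 'I_q) w : dform := fun e l =>
  \sum_j jC al j * dx_mul j w e l.

(* The derivative with respect to y_al, by the chain rule. *)
Definition ddy (al : 'I_q) w : dform := fun e l =>
  \sum_be mx_inv jD be al * ddtheta be w e l.

Definition iter_all n (op : 'I_n -> dform -> dform) (m : 'I_n -> nat) w : dform :=
  foldr (fun i => iter (m i) (op i)) w (enum 'I_n).

(* delta^(l_1)(y_1) ... delta^(l_q)(y_q) *)
Definition delta_y (l : 'I_q -> nat) : dform :=
  iter_all ddy l (delta0 (ring_inv (\det jD))).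

(* delta^(l_1)(dtheta'_1) ... delta^(l_q)(dtheta'_q) as a Taylor expansion at y
   in the nilpotent parts, whose (p+1)-th powers vanish. *)
Definition delta_theta' (l : 'I_q -> nat) : dform := fun e l' =>
  \sum_(m : {ffun 'I_q -> 'I_p.+1})
    scal ((\prod_al (m al)`!)%:R^-1) *
    iter_all nil_mul (fun al => m al : nat)
      (delta_y (fun al => l al + m al)%N) e l'.

Definition subst_monomial (e : {set 'I_p}) (l : 'I_q -> nat) : dform :=
  iter_all dx'_mul (fun i => i \in e : nat) (delta_theta' l).

End Substitution.
End DeltaOperators.

Section DeltaForms.
Context {R : realType} {p q : nat} (M : supermanifold R p q) (k : int).

(* The monomials (dx)^e delta^(l)(dtheta) of degree k; as #|e| <= p, the l_al
   are at most p - k. *)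
Definition dmon := {m : {set 'I_p} * {ffun 'I_q -> 'I_(absz (p%:Z - k)).+1} |
  #|m.1|%:Z - (\sum_al m.2 al)%N%:Z == k}.

Definition dmon_e (m : dmon) : {set 'I_p} := (val m).1.
Definition dmon_l (m : dmon) : {ffun 'I_q -> nat} :=
  [ffun al => (val m).2 al : nat].

(* The sheaf of delta forms of degree k: in each chart, combinations with
   coefficients in O_M of the monomials of degree k, which are identified on
   the overlaps by the substitution dx', dtheta' |-> J (dx, dtheta). *)
Definition deltaForms : omodSheaf M :=
  @glue R p q M dmon (fun a b m' m =>
    subst_monomial (jacA a b) (jacB a b) (jacC a b) (jacD a b)
      (dmon_e m') (dmon_l m') (dmon_e m) (dmon_l m)).

End DeltaForms.

(** Integral forms *)

Section GinvMorphism.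
Context {R : realType} {A : superAlgType R}.

Lemma ginvB : {morph (@ginv R A) : f g / f - g}.
Proof. by move=> f g; rewrite ginvD ginvN. Qed.
Lemma ginv_monoid : monoid_morphism (@ginv R A).
Proof. by split; [exact: ginv1 | exact: ginvM]. Qed.
HB.instance Definition _ := GRing.isZmodMorphism.Build A A (@ginv R A) ginvB.
HB.instance Definition _ := GRing.isMonoidMorphism.Build A A (@ginv R A) ginv_monoid.

Lemma ring_inv_even (u : A) : ginv u = u -> ginv (ring_inv u) = ring_inv u.
Proof.
move=> u0; rewrite /ring_inv; case: xgetP => [v _ [uv vu]|_]; last exact: ginv0.
have uv' : u * ginv v = 1 by rewrite -{1}u0 -ginvM uv ginv1.
by rewrite -[ginv v]mul1r -vu -mulrA uv' mulr1.
Qed.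

Lemma mx_inv_even n (D : 'M[A]_n) :
  map_mx (@ginv R A) D = D -> map_mx (@ginv R A) (mx_inv D) = mx_inv D.
Proof.
move=> D0; rewrite /mx_inv; case: xgetP => [E _ [DE ED]|_]; last first.
  by apply/matrixP => i j; rewrite !mxE ginv0.
have DE' : D *m map_mx (@ginv R A) E = 1%:M.
  by rewrite -{1}D0 -map_mxM DE map_mx1.
by rewrite -[map_mx _ E]mul1mx -ED -mulmxA DE' mulmx1.
Qed.

Lemma berezinian_even p q (a : 'M[A]_p) (b : 'M[A]_(p, q))
    (c : 'M[A]_(q, p)) (d : 'M[A]_q) :
  map_mx (@ginv R A) a = a -> map_mx (@ginv R A) b = - b ->
  map_mx (@ginv R A) c = - c -> map_mx (@ginv R A) d = d ->
  ginv (berezinian a b c d) = berezinian a b c d.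
Proof.
move=> a0 b1 c1 d0; rewrite /berezinian ginvM -det_map_mx ring_inv_even.
  by rewrite map_mxB !map_mxM a0 b1 c1 mx_inv_even // mulmxN !mulNmx opprK.
by rewrite -det_map_mx d0.
Qed.

End GinvMorphism.

Section Parity.
Context {R : realType} {p q : nat} {M : supermanifold R p q}.
Implicit Types (a b c : chart M p q) (U V : opens M).

Lemma ccompN c U (Uc : U `<=` cdom c) f I :
  {in cmap c @` U, forall y, ccomp Uc (- f) I y = - ccomp Uc f I y}.
Proof.
move=> y yU; have z0 : ccomp Uc 0 I y = 0.
  by apply: (addrI (ccomp Uc 0 I y)); rewrite -ccompD // !addr0.
by apply: (addrI (ccomp Uc f I y)); rewrite -ccompD // !subrr.
Qed.

Lemma from_comp_parity c U (Uc : U `<=` cdom c) (e : bool)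
    (g : {set 'I_q} -> 'rV[R]_p -> R) :
  (forall I : {set 'I_q}, {in cmap c @` U, forall y, odd #|I| != e -> g I y = 0}) ->
  ginv (from_comp Uc g) = (-1) ^+ e * from_comp Uc g.
Proof.
move=> ge; rewrite /from_comp; case: xgetP => [f _ fg|_]; last by rewrite ginv0 mulr0.
apply: (@ccomp_inj _ _ _ _ c U Uc) => I y yU.
have -> : ccomp Uc ((-1) ^+ e * f) I y = (-1) ^+ e * ccomp Uc f I y.
  by case: e {ge}; rewrite ?mul1r // ?mulN1r ccompN.
rewrite ccomp_ginv // -signr_odd; case: (odd #|I| =P e) => [->//|/eqP Ie].
by rewrite fg // ge // !mulr0.
Qed.

Lemma ccomp_parity c U (Uc : U `<=` cdom c) (e : bool) f (I : {set 'I_q}) :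
  ginv f = (-1) ^+ e * f ->
  {in cmap c @` U, forall y, odd #|I| != e -> ccomp Uc f I y = 0}.
Proof.
move=> fe y yU Ie; have E : ccomp Uc f I y = - ccomp Uc f I y.
  have := ccomp_ginv Uc f I yU; rewrite fe -[(-1) ^+ #|_|]signr_odd.
  by case: e Ie {fe}; case: odd => //= _; rewrite !(mul1r, mulN1r) ?ccompN.
have : ccomp Uc f I y *+ 2 = 0 by rewrite mulr2n {1}E addNr.
by move/eqP; rewrite mulrn_eq0 /= => /eqP.
Qed.

Lemma even_coord_even c i : ginv (even_coord c i) = even_coord c i.
Proof.
suff: ginv (even_coord c i) = (-1) ^+ false * even_coord c i by rewrite mul1r.
apply: from_comp_parity => I y _ /eqP oI.
by case: eqP => // I0; case: oI; rewrite I0 cards0.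
Qed.

Lemma odd_coord_odd c i : ginv (odd_coord c i) = - odd_coord c i.
Proof.
suff: ginv (odd_coord c i) = (-1) ^+ true * odd_coord c i by rewrite mulN1r.
apply: from_comp_parity => I y _ /eqP oI.
by case: eqP => // I0; case: oI; rewrite I0 cards1.
Qed.

Lemma even_deriv_parity c U (Uc : U `<=` cdom c) i (e : bool) f :
  ginv f = (-1) ^+ e * f ->
  ginv (even_deriv Uc i f) = (-1) ^+ e * even_deriv Uc i f.
Proof.
move=> fe; apply: from_comp_parity => I y yU Ie.
rewrite /partial derive1E (@near_eq_derive _ _ _ _ (cst 0)) ?derive_cst //.
have oU : open (cmap c @` U) := cmap_open Uc.
have lc : {for 0, continuous (fun h : R => y + h *: delta_mx 0 i)}.
  move=> B [P PB sPB].
  suff : \forall h \near (0 : R), forall k l,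
      P k l ((y + h *: delta_mx 0 i) k l) by apply: filterS => h /sPB.
  refine (@filter_forall R _
    (fun k h => forall l, P k l ((y + h *: delta_mx 0 i) k l))
    (nbhs (0 : R)) _ _) => k.
  refine (@filter_forall R _
    (fun l h => P k l ((y + h *: delta_mx 0 i) k l)) (nbhs (0 : R)) _ _) => l.
  have : (fun h : R => y k l + h * (delta_mx 0 i : 'rV[R]_p) k l) @ (0 : R) -->
      (y + 0 *: delta_mx 0 i) k l.
    rewrite !mxE; apply: cvgD; first exact: cvg_cst.
    by apply: cvgMl; exact: cvg_id.
  move=> H; have {}H : \forall h \near (0 : R),
    P k l (y k l + h * (delta_mx 0 i : 'rV[R]_p) k l) := H _ (PB k l).
  by apply: filterS H => h; rewrite !mxE.
have : \forall h \near (0 : R), (cmap c @` U) (y + h *: delta_mx 0 i).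
  have nU : nbhs (y + 0 *: (delta_mx 0 i : 'rV[R]_p)) (cmap c @` U).
    rewrite scale0r addr0; apply: open_nbhs_nbhs; split=> //; exact/set_mem.
  exact: (lc _ nU).
by apply: filterS => h hU; rewrite /line (ccomp_parity Uc fe) ?inE.
Qed.

Lemma odd_deriv_parity c U (Uc : U `<=` cdom c) al (e : bool) f :
  ginv f = (-1) ^+ e * f ->
  ginv (odd_deriv Uc al f) = (-1) ^+ (~~ e) * odd_deriv Uc al f.
Proof.
move=> fe; apply: from_comp_parity => I y yU Ie.
case: ifPn => // alI; rewrite (ccomp_parity Uc fe) ?mulr0 // cardsU1 alI /=.
by case: odd e Ie {fe} => -[].
Qed.

Lemma jacA_even a b : map_mx ginv (jacA a b) = jacA a b.
Proof.
apply/matrixP => i j; rewrite !mxE (@even_deriv_parity a _ (@onl _ _ _ _ a b) j false) ?mul1r //.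
by rewrite -sres_ginv even_coord_even.
Qed.

Lemma jacB_odd a b : map_mx ginv (jacB a b) = - jacB a b.
Proof.
apply/matrixP => i j; rewrite !mxE (@odd_deriv_parity a _ (@onl _ _ _ _ a b) j false) ?mulN1r //.
by rewrite mul1r -sres_ginv even_coord_even.
Qed.

Lemma jacC_odd a b : map_mx ginv (jacC a b) = - jacC a b.
Proof.
apply/matrixP => i j; rewrite !mxE (@even_deriv_parity a _ (@onl _ _ _ _ a b) j true) ?mulN1r //.
by rewrite -sres_ginv odd_coord_odd rmorphN.
Qed.

Lemma jacD_even a b : map_mx ginv (jacD a b) = jacD a b.
Proof.
apply/matrixP => i j; rewrite !mxE (@odd_deriv_parity a _ (@onl _ _ _ _ a b) j true) ?mul1r //.
by rewrite -sres_ginv odd_coord_odd rmorphN mulN1r.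
Qed.

End Parity.

Section Berezinian.
Context {R : realType} {p q : nat} (M : supermanifold R p q).
Implicit Types (a b c : chart M p q) (U V : opens M).

Definition jac_ber a b : sO (overlap a b) :=
  berezinian (jacA a b) (jacB a b) (jacC a b) (jacD a b).

Lemma jac_ber_even a b : ginv (jac_ber a b) = jac_ber a b.
Proof.
by rewrite berezinian_even ?jacA_even ?jacB_odd ?jacC_odd ?jacD_even.
Qed.

(* The generator D(x) attached to each chart, with D(x') = D(x) Ber(J). *)
Definition Ber : omodSheaf M :=
  @glue R p q M unit (fun a b _ _ => jac_ber a b).

Definition ber U : lmodType (sO U) := psec Ber U.

(* The grade involution of Ber(M); D(x) has the parity of p + q. *)
Lemma ber_ginv_subproof U (s : gsec (fun a b (_ _ : unit) => jac_ber a b) U) :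
  compatible (fun a b (_ _ : unit) => jac_ber a b)
    (fun a i => (-1) ^+ (p + q) * ginv (s a i)).
Proof.
move=> a b i; rewrite rmorphMsign sres_ginv gvalP ginv_sum big_distrr.
apply: eq_bigr => j _; rewrite ginvM -!sres_ginv jac_ber_even.
by rewrite /= rmorphMsign mulrA.
Qed.
Definition ber_ginv U (s : ber U) : ber U := GSec (ber_ginv_subproof s).

End Berezinian.

Section TangentSheaf.
Context {R : realType} {M : superspace R}.
Implicit Types U V W : opens M.

(* Sections over U of the tangent sheaf: the graded derivations of O_M over U.
   As a vector field X is the sum of its even and odd parts X_0 and X_1, with
   X_0 - X_1 = ginv \o X \o ginv, the last two terms of the Leibniz rule are
   f X_0(g) + (-1)^|f| f X_1(g) for homogeneous f. *)
Record vfield U := VField {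
  vapp :> forall V, V `<=` U -> sO V -> sO V;
  vappD : forall V (VU : V `<=` U) f g, vapp VU (f + g) = vapp VU f + vapp VU g;
  vapp_scal : forall V (VU : V `<=` U) (c : R) f,
    vapp VU (scal c * f) = scal c * vapp VU f;
  vapp_res : forall V W (VU : V `<=` U) (WU : W `<=` U) (WV : W `<=` V) f,
    vapp WU (sres WV f) = sres WV (vapp VU f);
  vapp_leibniz : forall V (VU : V `<=` U) f g,
    vapp VU (f * g) = vapp VU f * g + evenpart f * vapp VU g +
      oddpart f * ginv (vapp VU (ginv g)) }.

Lemma vfieldP U (X Y : vfield U) :
  (forall V (VU : V `<=` U) f, X V VU f = Y V VU f) -> X = Y.
Proof.
case: X Y => [X ? ? ? ?] [Y ? ? ? ?] /= XY.
have E : X = Y.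
  apply: functional_extensionality_dep => V.
  by apply: functional_extensionality_dep => VU; apply/funext.
by subst Y; congr VField.
Qed.

Definition vzero U : vfield U.
Proof.
refine (@VField U (fun V VU f => 0) _ _ _ _).
- by move=> *; rewrite addr0.
- by move=> *; rewrite mulr0.
- by move=> *; rewrite rmorph0.
- by move=> *; rewrite ginv0 !mulr0 mul0r !addr0.
Defined.

Definition vadd U (X Y : vfield U) : vfield U.
Proof.
refine (@VField U (fun V VU f => X V VU f + Y V VU f) _ _ _ _).
- by move=> V VU f g; rewrite !vappD addrACA.
- by move=> V VU c f; rewrite !vapp_scal mulrDr.
- by move=> V W VU WU WV f; rewrite !(vapp_res _ VU) rmorphD.
- move=> V VU f g; rewrite !vapp_leibniz ginvD !mulrDl !mulrDr.
  by rewrite addrACA; congr (_ + _); rewrite addrACA.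
Defined.

Definition vscale U (h : sO U) (X : vfield U) : vfield U.
Proof.
refine (@VField U (fun V VU f => sres VU h * X V VU f) _ _ _ _).
- by move=> V VU f g; rewrite vappD mulrDr.
- by move=> V VU c f; rewrite vapp_scal !mulrA (evenC _ (ginv_scal c)).
- move=> V W VU WU WV f.
  by rewrite (vapp_res _ VU) rmorphM (sres_comp _ _ WU).
- move=> V VU f g; rewrite /= vapp_leibniz !mulrDr ginvM.
  move: (evenpart f) (oddpart f) (ginv_even f) (ginv_odd f) => e o e0 o1.
  by rewrite !mulrA (evenC _ e0) (oddC _ o1) ginvK.
Defined.

Definition vopp U (X : vfield U) := vscale (-1) X.

Definition vginv U (X : vfield U) : vfield U.
Proof.
refine (@VField U (fun V VU f => ginv (X V VU (ginv f))) _ _ _ _).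
- by move=> V VU f g; rewrite ginvD vappD ginvD.
- by move=> V VU c f; rewrite ginvM ginv_scal vapp_scal ginvM ginv_scal.
- by move=> V W VU WU WV f; rewrite -sres_ginv (vapp_res _ VU) sres_ginv.
- move=> V VU f g; rewrite /= ginvM vapp_leibniz evenpart_ginv oddpart_ginv.
  move: (evenpart f) (oddpart f) (ginv_even f) (ginv_odd f) => e o e0 o1.
  by rewrite !ginvD !ginvM ginvN e0 o1 opprK !ginvK.
Defined.

Section Module.
Variable U : opens M.

Lemma vaddA : associative (@vadd U).
Proof. by move=> X Y Z; apply: vfieldP => V VU f /=; rewrite addrA. Qed.
Lemma vaddC : commutative (@vadd U).
Proof. by move=> X Y; apply: vfieldP => V VU f /=; rewrite addrC. Qed.
Lemma vadd0 : left_id (@vzero U) (@vadd U).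
Proof. by move=> X; apply: vfieldP => V VU f /=; rewrite add0r. Qed.
Lemma vaddN : left_inverse (@vzero U) (@vopp U) (@vadd U).
Proof.
by move=> X; apply: vfieldP => V VU f /=; rewrite rmorphN1 mulN1r addNr.
Qed.

HB.instance Definition _ := gen_eqMixin (vfield U).
HB.instance Definition _ := gen_choiceMixin (vfield U).
HB.instance Definition _ :=
  GRing.isZmodule.Build (vfield U) vaddA vaddC vadd0 vaddN.

Lemma vscaleA f g (X : vfield U) : vscale f (vscale g X) = vscale (f * g) X.
Proof. by apply: vfieldP => V VU h; rewrite /= rmorphM mulrA. Qed.
Lemma vscale1 (X : vfield U) : vscale 1 X = X.
Proof. by apply: vfieldP => V VU h; rewrite /= rmorph1 mul1r. Qed.
Lemma vscaleDr f : {morph @vscale U f : X Y / X + Y}.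
Proof. by move=> X Y; apply: vfieldP => V VU h; rewrite /= mulrDr. Qed.
Lemma vscaleDl (X : vfield U) : {morph (@vscale U)^~ X : f g / f + g}.
Proof. by move=> f g; apply: vfieldP => V VU h; rewrite /= rmorphD mulrDl. Qed.

HB.instance Definition _ := GRing.Zmodule_isLmodule.Build (sO U) (vfield U)
  vscaleA vscale1 vscaleDr vscaleDl.

End Module.

Definition vres U V (VU : V `<=` U) (X : vfield U) : vfield V.
Proof.
refine (@VField V (fun W WV => X W (subset_trans WV VU)) _ _ _ _).
- by move=> W WV f g; rewrite vappD.
- by move=> W WV c f; rewrite vapp_scal.
- by move=> W W' WV WV' WW' f; rewrite (vapp_res _ (subset_trans WV VU)).
- by move=> W WV f g; rewrite vapp_leibniz.
Defined.

(* The parity-shifted tangent sheaf, f (pi X) = (-1)^|f| pi (f X) and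
   |pi X| = |X| + 1. *)
Definition PiT U := vfield U.

Section PiModule.
Variable U : opens M.

HB.instance Definition _ := GRing.Zmodule.on (PiT U).

Definition pscale (f : sO U) (X : PiT U) : PiT U := vscale (ginv f) X.

Lemma pscaleA f g (X : PiT U) : pscale f (pscale g X) = pscale (f * g) X.
Proof. by rewrite /pscale vscaleA ginvM. Qed.
Lemma pscale1 (X : PiT U) : pscale 1 X = X.
Proof. by rewrite /pscale ginv1 vscale1. Qed.
Lemma pscaleDr f : {morph pscale f : X Y / X + Y}.
Proof. exact: vscaleDr. Qed.
Lemma pscaleDl (X : PiT U) : {morph pscale^~ X : f g / f + g}.
Proof. by move=> f g; rewrite /pscale ginvD; exact: vscaleDl. Qed.

HB.instance Definition _ := GRing.Zmodule_isLmodule.Build (sO U) (PiT U)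
  pscaleA pscale1 pscaleDr pscaleDl.

Definition pginv (X : PiT U) : PiT U := - vginv X.

End PiModule.

Definition pires U V (VU : V `<=` U) (X : PiT U) : PiT V := vres VU X.

End TangentSheaf.

(* The right action v f = (-1)^(|v||f|) f v on a supermodule whose grade
   involution is s. *)
Definition rscale {R : realType} {A : superAlgType R} {N : lmodType A}
  (s : N -> N) (v : N) (f : A) : N := evenpart f *: v + oddpart f *: s v.

Section IntegralForms.
Context {R : realType} {p q : nat} (M : supermanifold R p q) (n : nat).
Implicit Types U V W : opens M.

(* (b, v) stands for b (x) v_0 ... v_(n-1) in Ber(M) (x) S^n (Pi T_M). *)
Definition tgen U : Type := (ber U * {ffun 'I_n -> PiT U})%type.

Definition upd U (v : {ffun 'I_n -> PiT U}) (j : 'I_n) (x : PiT U) :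
    {ffun 'I_n -> PiT U} := [ffun i => if i == j then x else v i].

(* Equality of formal sums in the tensor product over O_M, quotiented by the
   supersymmetry of the factors v_j. *)
Inductive teq U : seq (tgen U) -> seq (tgen U) -> Prop :=
| teq_refl s : teq s s
| teq_sym s t : teq s t -> teq t s
| teq_trans s t u : teq s t -> teq t u -> teq s u
| teq_cat s s' t t' : teq s s' -> teq t t' -> teq (s ++ t) (s' ++ t')
| teq_comm s t : teq (s ++ t) (t ++ s)
| teq_zero v : teq [:: (0, v)] [::]
| teq_addl b b' v : teq [:: (b + b', v)] [:: (b, v); (b', v)]
| teq_addr b v j x y :
    teq [:: (b, upd v j (x + y))] [:: (b, upd v j x); (b, upd v j y)]
| teq_bal0 b (f : sO U) v (j : 'I_n) : j = 0%N :> nat ->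
    teq [:: (rscale (@ber_ginv _ _ _ M U) b f, v)] [:: (b, upd v j (f *: v j))]
| teq_bal b (f : sO U) v (j j' : 'I_n) : j' = j.+1 :> nat ->
    teq [:: (b, upd v j (rscale (@pginv _ _ U) (v j) f))]
        [:: (b, upd v j' (f *: v j'))]
| teq_swap (b : ber U) (v : {ffun 'I_n -> PiT U}) (j j' : 'I_n) (e e' : bool) : j' = j.+1 :> nat ->
    pginv (v j) = (-1) ^+ e *: v j -> pginv (v j') = (-1) ^+ e' *: v j' ->
    teq [:: (b, upd (upd v j (v j')) j' (v j))] [:: ((-1) ^+ (e && e') *: b, v)].

Section Quotient.
Variable U : opens M.

Definition teqb (s t : seq (tgen U)) : bool := `[< teq s t >].

Lemma teqb_refl : reflexive teqb. Proof. by move=> s; apply/asboolP/teq_refl. Qed.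
Lemma teqb_sym : symmetric teqb.
Proof. by move=> s t; apply/asboolP/asboolP => /teq_sym. Qed.
Lemma teqb_trans : transitive teqb.
Proof. by move=> t s u /asboolP st /asboolP /(teq_trans st) ?; apply/asboolP. Qed.

Canonical teqb_equiv := EquivRel teqb teqb_refl teqb_sym teqb_trans.

(* Ber(U) (x)_O(U) S^n (Pi T(U)) *)
Definition tens := {eq_quot teqb}%qT.
HB.instance Definition _ := Choice.on tens.
HB.instance Definition _ := EqQuotient.on tens.

Definition tclass (s : seq (tgen U)) : tens := (\pi_tens s)%qT.

Lemma tclassP s t : teq s t <-> tclass s = tclass t.
Proof.
by split=> [st|/eqmodP /asboolP //]; apply/eqmodP/asboolP.
Qed.

Lemma trepr (x : tens) : teq (repr x) (repr x) /\ tclass (repr x) = x.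
Proof. by split; [exact: teq_refl | exact: reprK]. Qed.

Lemma tclassE s : teq (repr (tclass s)) s.
Proof. by apply/tclassP; rewrite {1}/tclass reprK. Qed.

Definition tadd (x y : tens) : tens := tclass (repr x ++ repr y).
Definition tscale (f : sO U) (x : tens) : tens :=
  tclass [seq (f *: g.1, g.2) | g <- repr x].
Definition topp (x : tens) := tscale (-1) x.

Lemma taddE s t : tadd (tclass s) (tclass t) = tclass (s ++ t).
Proof. by apply/tclassP; apply: teq_cat; exact: tclassE. Qed.

Lemma ber_ginvZ (f : sO U) (b : ber U) :
  ber_ginv (f *: b) = ginv f *: ber_ginv b.
Proof.
apply: gsecP => a i /=; rewrite ginvM -sres_ginv !mulrA; congr (_ * _).
exact/esym/commr_sign.
Qed.

Lemma rscaleA (f : sO U) (b : ber U) (g : sO U) :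
  f *: rscale (@ber_ginv _ _ _ M U) b g =
  rscale (@ber_ginv _ _ _ M U) (f *: b) g.
Proof.
rewrite /rscale ber_ginvZ.
move: (evenpart g) (oddpart g) (ginv_even g) (ginv_odd g) => e o e0 o1.
by rewrite scalerDr !scalerA (evenC f e0) (oddC _ o1) ginvK.
Qed.

Lemma teq_scale (f : sO U) s t : teq s t ->
  teq [seq (f *: g.1, g.2) | g <- s] [seq (f *: g.1, g.2) | g <- t].
Proof.
elim=> {s t} /=.
- by move=> *; apply: teq_refl.
- by move=> *; apply: teq_sym.
- by move=> s t u _ st _ tu; apply: teq_trans st tu.
- by move=> s s' t t' _ ss' _ tt'; rewrite !map_cat; apply: teq_cat.
- by move=> s t; rewrite !map_cat; apply: teq_comm.
- by move=> v; rewrite scaler0; apply: teq_zero.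
- by move=> b b' v; rewrite scalerDr; apply: teq_addl.
- by move=> b v j x y; apply: teq_addr.
- by move=> b g v j j0; rewrite rscaleA; apply: teq_bal0.
- by move=> b g v j j' jj'; apply: teq_bal.
- move=> b v j j' e e' jj' ej ej'; rewrite scalerA commr_sign -scalerA.
  exact: teq_swap.
Qed.

Lemma tscaleE f s : tscale f (tclass s) = tclass [seq (f *: g.1, g.2) | g <- s].
Proof. by apply/tclassP; apply: teq_scale; exact: tclassE. Qed.

Lemma tensP (P : tens -> Prop) : (forall s, P (tclass s)) -> forall x, P x.
Proof. by move=> H x; rewrite -(trepr x).2. Qed.

Lemma taddA : associative tadd.
Proof.
by do 3!elim/tensP => ?; rewrite !taddE catA.
Qed.
Lemma taddC : commutative tadd.
Proof.
by do 2!elim/tensP => ?; rewrite !taddE; apply/tclassP; apply: teq_comm.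
Qed.
Lemma tadd0 : left_id (tclass [::]) tadd.
Proof. by elim/tensP => ?; rewrite !taddE. Qed.
Lemma tscaleDl x : {morph tscale^~ x : f g / f + g >-> tadd f g}.
Proof.
elim/tensP: x => s f g; rewrite !tscaleE taddE; apply/tclassP.
elim: s => [|[b v] s IHs] /=; first exact: teq_refl.
rewrite scalerDl; apply: (@teq_trans _ _ ([:: (f *: b, v); (g *: b, v)] ++
  ([seq (f *: g0.1, g0.2) | g0 <- s] ++ [seq (g *: g0.1, g0.2) | g0 <- s]))).
  by rewrite -cat1s; apply: teq_cat => //; apply: teq_addl.
rewrite -[X in teq _ X]/([:: (f *: b, v)] ++ _) -[X in teq X _]/([:: (f *: b, v)] ++ _).
apply: teq_cat; first exact: teq_refl.
rewrite -cat1s -[in X in teq _ X]cat1s !catA; apply: teq_cat; last exact: teq_refl.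
exact: teq_comm.
Qed.
Lemma tscale0 x : tscale 0 x = tclass [::].
Proof.
elim/tensP: x => s; rewrite tscaleE; apply/tclassP.
elim: s => [|[b v] s IHs] /=; first exact: teq_refl.
rewrite -cat1s -[X in teq _ X]cat0s; apply: teq_cat => //.
by rewrite scale0r; apply: teq_zero.
Qed.
Lemma tscale1 : left_id 1 tscale.
Proof.
elim/tensP => s; rewrite tscaleE; congr tclass.
by rewrite -[RHS]map_id; apply: eq_map => -[b v]; rewrite /= scale1r.
Qed.
Lemma taddN : left_inverse (tclass [::]) topp tadd.
Proof.
by move=> x; rewrite /topp -{2}(tscale1 x) -tscaleDl addNr tscale0.
Qed.

HB.instance Definition _ :=
  GRing.isZmodule.Build tens taddA taddC tadd0 taddN.

Lemma tscaleA f g x : tscale f (tscale g x) = tscale (f * g) x.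
Proof.
elim/tensP: x => s; rewrite !tscaleE -map_comp; congr tclass.
by apply: eq_map => -[b v]; rewrite /= scalerA.
Qed.
Lemma tscaleDr f : {morph tscale f : x y / x + y}.
Proof.
elim/tensP => s; elim/tensP => t.
change (tscale f (tadd (tclass s) (tclass t)) =
  tadd (tscale f (tclass s)) (tscale f (tclass t))).
by rewrite taddE !tscaleE taddE map_cat.
Qed.
Lemma tscaleDl' x : {morph tscale^~ x : f g / f + g}.
Proof. exact: tscaleDl. Qed.

HB.instance Definition _ := GRing.Zmodule_isLmodule.Build (sO U) tens
  tscaleA tscale1 tscaleDr tscaleDl'.

End Quotient.

Definition tgen_res U V (VU : V `<=` U) (g : tgen U) : tgen V :=
  (gres VU g.1, [ffun j => pires VU (g.2 j)]).

Lemma pires_scale U V (VU : V `<=` U) (f : sO U) (X : PiT U) :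
  pires VU (f *: X) = sres VU f *: pires VU X.
Proof.
apply: vfieldP => W WV g /=; rewrite -sres_ginv.
by rewrite (sres_comp _ _ (subset_trans WV VU)).
Qed.

Lemma piresD U V (VU : V `<=` U) (X Y : PiT U) :
  pires VU (X + Y) = pires VU X + pires VU Y.
Proof. exact: vfieldP. Qed.

Lemma pires_ginv U V (VU : V `<=` U) (X : PiT U) :
  pires VU (pginv X) = pginv (pires VU X).
Proof. by apply: vfieldP => W WV g /=; rewrite !rmorphN1. Qed.

Lemma ber_res_ginv U V (VU : V `<=` U) (b : ber U) :
  gres VU (ber_ginv b) = ber_ginv (gres VU b).
Proof. by apply: gsecP => a i /=; rewrite rmorphMsign sres_ginv. Qed.

Lemma sres_even U V (VU : V `<=` U) (f : sO U) :
  sres VU (evenpart f) = evenpart (sres VU f).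
Proof. by rewrite rmorphM sres_scal rmorphD sres_ginv. Qed.

Lemma sres_odd U V (VU : V `<=` U) (f : sO U) :
  sres VU (oddpart f) = oddpart (sres VU f).
Proof. by rewrite rmorphM sres_scal rmorphB sres_ginv. Qed.

Lemma ber_rscale_res U V (VU : V `<=` U) (b : ber U) (f : sO U) :
  gres VU (rscale (@ber_ginv _ _ _ M U) b f) =
  rscale (@ber_ginv _ _ _ M V) (gres VU b : ber V) (sres VU f).
Proof.
rewrite /rscale; etransitivity; first exact: gresD.
by rewrite !gresZ ber_res_ginv sres_even sres_odd.
Qed.

Lemma pi_rscale_res U V (VU : V `<=` U) (X : PiT U) (f : sO U) :
  pires VU (rscale (@pginv _ _ U) X f) =
  rscale (@pginv _ _ V) (pires VU X) (sres VU f).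
Proof.
by rewrite /rscale piresD !pires_scale pires_ginv sres_even sres_odd.
Qed.

Lemma upd_res U V (VU : V `<=` U) (v : {ffun 'I_n -> PiT U}) j x :
  [ffun i => pires VU (upd v j x i)] =
  upd [ffun i => pires VU (v i)] j (pires VU x).
Proof. by apply/ffunP => i; rewrite !ffunE; case: eqP. Qed.

Lemma teq_res U V (VU : V `<=` U) (s t : seq (tgen U)) : teq s t ->
  teq (map (tgen_res VU) s) (map (tgen_res VU) t).
Proof.
have resZ1 (e : bool) (X : PiT U) : pginv X = (-1) ^+ e *: X ->
    pginv (pires VU X) = (-1) ^+ e *: pires VU X.
  by move=> E; rewrite -pires_ginv E pires_scale rmorph_sign.
elim=> {s t} /=; rewrite /tgen_res /=.
- by move=> *; apply: teq_refl.
- by move=> *; apply: teq_sym.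
- by move=> s t u _ st _ tu; apply: teq_trans st tu.
- by move=> s s' t t' _ ss' _ tt'; rewrite !map_cat; apply: teq_cat.
- by move=> s t; rewrite !map_cat; apply: teq_comm.
- move=> v; have -> : gres VU (0 : ber U) = 0 by exact: (@pres0 _ _ (Ber M) _ _ VU).
  exact: teq_zero.
- move=> b b' v; have -> : gres VU (b + b') = (gres VU b : ber V) + gres VU b'.
    exact: gresD.
  exact: teq_addl.
- by move=> b v j x y; rewrite !upd_res piresD; apply: teq_addr.
- move=> b f v j j0; rewrite ber_rscale_res upd_res pires_scale.
  have -> : pires VU (v j) = [ffun i => pires VU (v i)] j by rewrite ffunE.
  exact: teq_bal0.
- move=> b f v j j' jj'; rewrite !upd_res pires_scale pi_rscale_res.
  have E i : pires VU (v i) = [ffun i => pires VU (v i)] i by rewrite ffunE.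
  by rewrite !E; apply: teq_bal.
- move=> b v j j' e e' jj' /resZ1 ej /resZ1 ej'; rewrite !upd_res gresZ.
  have E i : pires VU (v i) = [ffun i => pires VU (v i)] i by rewrite ffunE.
  rewrite rmorph_sign; move: ej ej'; rewrite !E; exact: teq_swap.
Qed.

Definition tres U V (VU : V `<=` U) (x : tens U) : tens V :=
  tclass (map (tgen_res VU) (repr x)).

Lemma tresE U V (VU : V `<=` U) s :
  tres VU (tclass s) = tclass (map (tgen_res VU) s).
Proof. by apply/tclassP; apply: teq_res; exact: tclassE. Qed.

Lemma tresD U V (VU : V `<=` U) (x y : tens U) :
  tres VU (x + y) = tres VU x + tres VU y.
Proof.
elim/tensP: x => s; elim/tensP: y => t.
change (tres VU (tadd (tclass s) (tclass t)) =
  tadd (tres VU (tclass s)) (tres VU (tclass t))).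
by rewrite taddE !tresE taddE map_cat.
Qed.

Lemma tresZ U V (VU : V `<=` U) (f : sO U) (x : tens U) :
  tres VU (f *: x) = sres VU f *: tres VU x.
Proof.
elim/tensP: x => s.
change (tres VU (tscale f (tclass s)) = tscale (sres VU f) (tres VU (tclass s))).
rewrite tscaleE !tresE tscaleE -!map_comp; congr tclass; apply: eq_map => g /=.
by rewrite /tgen_res /= gresZ.
Qed.

Lemma tres_id U (UU : U `<=` U) (x : tens U) : tres UU x = x.
Proof.
elim/tensP: x => s; rewrite tresE; congr tclass.
rewrite -[RHS]map_id; apply: eq_map => -[b v].
rewrite /tgen_res gres_id /=; congr (_, _); apply/ffunP => j; rewrite ffunE.
by apply: vfieldP => V VU f /=; congr (vapp _ _ _).
Qed.

Lemma tres_comp U V W (VU : V `<=` U) (WV : W `<=` V) (WU : W `<=` U)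
  (x : tens U) : tres WV (tres VU x) = tres WU x.
Proof.
elim/tensP: x => s; rewrite !tresE -map_comp; congr tclass.
apply: eq_map => -[b v]; rewrite /= /tgen_res /= (gres_comp _ _ WU).
congr (_, _); apply/ffunP => j; rewrite !ffunE.
by apply: vfieldP => Z ZW f /=; congr (vapp _ _ _).
Qed.

Definition tens_presheaf : omodPresheaf M :=
  @OModPresheaf R M (fun U => tens U : lmodType (sO U))
    tres tresD tresZ tres_id tres_comp.

(* Ber(M) (x)_{O_M} S^n (Pi T_M) *)
Definition Ber_tensor_Sym : omodSheaf M := sheafify tens_presheaf.

End IntegralForms.

(* Only meaningful for k <= p, where p - k is the power of Pi T_M. *)
Definition integralForms (R : realType) (p q : nat) (M : supermanifold R p q)
  (k : int) : omodSheaf M := Ber_tensor_Sym M (absz (p%:Z - k)).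

(* Main.v *)
(* A vector field X contracts delta forms from the right: in coordinates, w <| X
   is the sum of the contractions of w along the dx_i with coefficients X(x_i)
   and of the derivatives of w in the dtheta_al with coefficients X(theta_al),
   up to signs. Let b (x) X_1 ... X_n, with b = f D(x), go to
     f dx_1 ... dx_p delta(dtheta_1) ... delta(dtheta_q) <| X_1 ... <| X_n.
   This does not depend on the coordinates, because the substitution of the
   differentials intertwines the contractions and multiplies the top delta form
   by the Berezinian; and it respects the relations of Ber(M) (x) S^n Pi T_M,
   because the contractions supercommute. Over a coordinate domain the words in
   the d/dx_i (odd, so each occurs at most once) and the d/dtheta_al (even) span
   the tensor product, and they go up to sign to the distinct monomials of degree
   p - n: the map is bijective there, hence is an isomorphism of sheaves. *)

From HB Require Import structures.
Require Import Defs.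
From mathcomp Require Import all_boot all_order all_algebra generic_quotient.
From mathcomp Require Import all_classical all_reals all_analysis.
From mathcomp Require Import ring.

Set Implicit Arguments.
Unset Strict Implicit.
Unset Printing Implicit Defensive.

Import Order.TTheory GRing.Theory Num.Theory.
Import numFieldNormedType.Exports.

Local Open Scope classical_set_scope.
Local Open Scope ring_scope.

(** * Hadamard's lemma *)

(** Sections of Pi T_M are abstract derivations of the structure sheaf, so they have to be expanded
    in coordinate fields before they can be contracted; this is what Hadamard's lemma is for. The
    contraction acts from the right because coefficients stand on the left: the map is then left
    linear without signs. Among the substituted monomials only the top one is computed. For the
    others it is enough to know how contractions and the grade involution act on them. The delicate
    point is the substitution in the delta symbols: the Taylor series is cut at order p in each
    variable, and its boundary terms vanish after a division by p + 1. The rule dtheta'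
    delta(dtheta') = 0 then eliminates dtheta from dx', which produces the Schur complement A - B
    D^-1 C of the Berezinian. Invertibility of D comes from the chain rule in both directions.
    Multiplicativity of the Berezinian provides the local generator of Ber(M); on the side of delta
    forms, words of contractions already give compatible families with arbitrary coefficients in a
    chart. *)

Section SmoothFunctions.
Context {R : realType} {p : nat}.
Implicit Types (V : set 'rV[R]_p) (f g : 'rV[R]_p -> R) (y : 'rV[R]_p).

Lemma line_continuous y (d : 'rV[R]_p) : continuous (fun h : R => y + h *: d).
Proof.
move=> h; apply: cvgD; first exact: cvg_cst.
by apply: cvgZ; [exact: cvg_id|exact: cvg_cst].
Qed.

Lemma near_line V y (d : 'rV[R]_p) (h : R) : open V -> V (y + h *: d) ->
  \forall k \near h, V (y + k *: d).
Proof.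
move=> oV Vy; apply: (@line_continuous y d h); exact: open_nbhs_nbhs.
Qed.

Lemma smooth_is_derive V f i y : smooth_on V f -> V y ->
  is_derive (0 : R) 1 (line f i y) (partial i f y).
Proof.
move=> sf Vy; have [_ /(_ i) df] := sf [::] y Vy.
by apply: DeriveDef => //; rewrite -derive1E.
Qed.

Lemma line_shift f i y (h : R) :
  line f i y = line f i (y + h *: delta_mx 0 i) \o (fun k => k - h).
Proof.
by apply/funext => k; rewrite /line /= -addrA -scalerDl [h + _]addrC subrK.
Qed.

Lemma smooth_is_derive_line V f i y (h : R) : smooth_on V f ->
  V (y + h *: delta_mx 0 i) ->
  is_derive h 1 (line f i y) (partial i f (y + h *: delta_mx 0 i)).
Proof.
move=> sf Vy; rewrite (line_shift f i y h).
have d1 : is_derive h 1 (fun k : R => k - h) 1.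
  by apply: is_derive_eq; rewrite subr0.
have := @smooth_is_derive _ _ i _ sf Vy; rewrite -{1}(subrr h) => d2.
have := @is_derive1_comp _ _ (fun k : R => k - h) h _ _ d2 d1; by rewrite mulr1.
Qed.

Section Local.
Variables (V : set 'rV[R]_p) (f g : 'rV[R]_p -> R).
Hypotheses (oV : open V) (fg : forall y, V y -> f y = g y).

Lemma near_line_eq i y : V y -> {near (0 : R), line f i y =1 line g i y}.
Proof.
move=> Vy; have : \forall h \near (0 : R), V (y + h *: delta_mx 0 i).
  by apply: near_line => //; rewrite scale0r addr0.
by apply: filterS => h; apply: fg.
Qed.

Lemma partial_local i y : V y -> partial i f y = partial i g y.
Proof.
move=> Vy; rewrite /partial !derive1E; apply: near_eq_derive.
exact: near_line_eq.
Qed.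

Lemma derivable_line_local i y : V y ->
  derivable (line g i y) 0 1 -> derivable (line f i y) 0 1.
Proof.
move=> Vy; apply: near_eq_derivable.
by have := near_line_eq i Vy; apply: filterS => h ->.
Qed.

Lemma continuous_local y : V y ->
  {for y, continuous g} -> {for y, continuous f}.
Proof.
move=> Vy cg; rewrite /prop_for /continuous_at (fg Vy).
have E : {near nbhs y, g =1 f}.
  have : nbhs y V by exact: open_nbhs_nbhs.
  by apply: filterS => z Vz; rewrite /= fg.
exact: cvg_trans (near_eq_cvg E) cg.
Qed.

End Local.

(** Every iterated partial derivative of a member agrees on [V] with a member, so first-order
    information about the class is enough. Equality is asked on [V] only, since nothing is known
    about the functions elsewhere. *)
Lemma smooth_coind V (C : ('rV[R]_p -> R) -> Prop) : open V ->
  (forall f, C f -> forall y, V y ->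
     {for y, continuous f} /\ forall i, derivable (line f i y) 0 1) ->
  (forall f i, C f -> exists2 g, C g & forall y, V y -> partial i f y = g y) ->
  forall f, C f -> smooth_on V f.
Proof.
move=> oV C1 C2 f Cf r.
have [g Cg fg] : exists2 g, C g & forall y, V y -> partials r f y = g y.
  elim: r => [|i r [g Cg fg]]; first by exists f.
  have [h Ch gh] := C2 g i Cg; exists h => // y Vy.
  by rewrite /= (partial_local oV fg) // gh.
move=> y Vy; have [cg dg] := C1 g Cg y Vy; split.
  exact (@continuous_local V _ g oV fg y Vy cg).
by move=> i; apply: (derivable_line_local oV fg) (dg i).
Qed.

Lemma smooth_local V f g : open V -> (forall y, V y -> f y = g y) ->
  smooth_on V g -> smooth_on V f.
Proof.
move=> oV fg sg.
apply: (@smooth_coind V (fun h => exists2 k, smooth_on V k &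
  forall y, V y -> h y = k y)) => //; last by exists g.
- move=> h [k sk hk] y Vy; have [ck dk] := sk [::] y Vy; split.
    exact (@continuous_local V _ k oV hk y Vy ck).
  by move=> i; apply: (derivable_line_local oV hk) (dk i).
- move=> h i [k sk hk]; exists (partial i k); last by move=> y; apply: partial_local.
  by exists (partial i k) => //; apply: smooth_partial.
Qed.

Lemma partial_cst i (c : R) : partial i (fun _ => c) = fun _ : 'rV[R]_p => 0 : R.
Proof. by apply/funext => y; rewrite /partial derive1E derive_cst. Qed.

Lemma smooth_cst V (c : R) : open V -> smooth_on V (fun _ => c).
Proof.
move=> oV; apply: (@smooth_coind V (fun f => exists c, f = fun _ => c)) => //.
- by move=> _ [d ->] y _; split=> [|i]; [exact: cst_continuous|exact: derivable_cst].
- by move=> _ i [d ->]; rewrite partial_cst; exists (fun _ => 0) => //; exists 0.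
- by exists c.
Qed.

Lemma is_derive_coord (i j : 'I_p) y (h : R) :
  is_derive h 1 (line (fun z : 'rV[R]_p => z 0 j) i y) (i == j)%:R.
Proof.
rewrite /line (_ : (fun k => _) = fun k => y 0 j + k * (i == j)%:R); last first.
  by apply/funext => k; rewrite !mxE eqxx eq_sym.
by apply: is_derive_eq; rewrite /GRing.scale /= !(mulr1, mulr0, mul1r, add0r).
Qed.

Lemma partial_coord i j : partial i (fun z : 'rV[R]_p => z 0 j) = fun _ => (i == j)%:R.
Proof.
by apply/funext => y; rewrite /partial derive1E; have [_ ->] := is_derive_coord i j y 0.
Qed.

Lemma smooth_coord V j : open V -> smooth_on V (fun y => y 0 j).
Proof.
move=> oV; apply: (@smooth_coind V (fun f => f = (fun y => y 0 j) \/ smooth_on V f)) => //.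
- move=> f [->|sf] y Vy; last exact: (sf [::] y Vy).
  by split=> [|i]; [exact: coord_continuous|have [] := is_derive_coord i j y 0].
- move=> f i [->|sf]; last by exists (partial i f) => //; right; apply: smooth_partial.
  exists (fun _ => (i == j)%:R); last by rewrite partial_coord.
  by right; apply: smooth_cst.
- by left.
Qed.

Lemma partialD V f g i y : smooth_on V f -> smooth_on V g -> V y ->
  partial i (fun z => f z + g z) y = partial i f y + partial i g y.
Proof.
move=> sf sg Vy; have df := smooth_is_derive i sf Vy; have dg := smooth_is_derive i sg Vy.
by have [_ <-] := is_deriveD df dg; rewrite -derive1E.
Qed.

Lemma partialM V f g i y : smooth_on V f -> smooth_on V g -> V y ->
  partial i (fun z => f z * g z) y = partial i f y * g y + f y * partial i g y.
Proof.
move=> sf sg Vy; have df := smooth_is_derive i sf Vy; have dg := smooth_is_derive i sg Vy.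
have L0 h : line h i y 0 = h y by rewrite /line scale0r addr0.
have [_] := is_deriveM df dg; rewrite -derive1E !L0 => E.
by rewrite [LHS]E addrC; congr (_ + _); exact: mulrC.
Qed.

(** By Leibniz' rule products alone are not stable under partial derivatives; closing under sums as
    well makes [smooth_coind] applicable. *)
Inductive smooth_gen V : ('rV[R]_p -> R) -> Prop :=
| Gen_smooth f : smooth_on V f -> smooth_gen V f
| Gen_add f g : smooth_gen V f -> smooth_gen V g -> smooth_gen V (fun y => f y + g y)
| Gen_mul f g : smooth_gen V f -> smooth_gen V g -> smooth_gen V (fun y => f y * g y).

Lemma smooth_genE V : open V -> forall f, smooth_gen V f -> smooth_on V f.
Proof.
move=> oV.
have C1 f : smooth_gen V f -> forall y, V y ->
    {for y, continuous f} /\ forall i, derivable (line f i y) 0 1.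
  elim=> {f} [f sf y Vy|f g _ IHf _ IHg y Vy|f g _ IHf _ IHg y Vy].
  - exact: (sf [::] y Vy).
  - have [cf df] := IHf y Vy; have [cg dg] := IHg y Vy; split; first exact: (cvgD cf cg).
    by move=> i; exact: (derivableD (df i) (dg i)).
  - have [cf df] := IHf y Vy; have [cg dg] := IHg y Vy; split; first exact: (cvgM cf cg).
    by move=> i; exact: (derivableM (df i) (dg i)).
apply: smooth_coind => // f i; elim=> {f} [f sf|f g Cf [f' Cf' E] Cg [g' Cg' E']
  |f g Cf [f' Cf' E] Cg [g' Cg' E']].
- by exists (partial i f) => //; apply/Gen_smooth/smooth_partial.
- exists (fun y => f' y + g' y); first exact: Gen_add.
  move=> y Vy; rewrite -E // -E' //.
  have [[_ df] [_ dg]] := (C1 _ Cf y Vy, C1 _ Cg y Vy).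
  by rewrite /partial !derive1E -deriveD.
- exists (fun y => f' y * g y + f y * g' y).
    by apply: Gen_add; apply: Gen_mul.
  move=> y Vy; rewrite -E // -E' //.
  have [[_ df] [_ dg]] := (C1 _ Cf y Vy, C1 _ Cg y Vy).
  have L0 h : line h i y 0 = h y by rewrite /line scale0r addr0.
  rewrite /partial !derive1E; have := deriveM (df i) (dg i); rewrite !L0 => E1.
  by rewrite [LHS]E1 addrC; congr (_ + _); exact: mulrC.
Qed.

Lemma smoothD V f g : open V -> smooth_on V f -> smooth_on V g ->
  smooth_on V (fun y => f y + g y).
Proof. by move=> oV sf sg; apply: smooth_genE => //; apply: Gen_add; apply: Gen_smooth. Qed.

Lemma smoothM V f g : open V -> smooth_on V f -> smooth_on V g ->
  smooth_on V (fun y => f y * g y).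
Proof. by move=> oV sf sg; apply: smooth_genE => //; apply: Gen_mul; apply: Gen_smooth. Qed.

Lemma smooth_sum V (J : Type) (r : seq J) (P : pred J) (F : J -> 'rV[R]_p -> R) :
  open V -> (forall j, P j -> smooth_on V (F j)) ->
  smooth_on V (fun y => \sum_(j <- r | P j) F j y).
Proof.
move=> oV sF; elim: r => [|j r IHr].
  by apply: smooth_local (smooth_cst 0 oV) => // y _; rewrite big_nil.
case Pj: (P j); last first.
  by apply: smooth_local IHr => // y _; rewrite big_cons Pj.
by apply: smooth_local (smoothD oV (sF j Pj) IHr) => // y _; rewrite big_cons Pj.
Qed.

Lemma partial_sum V (J : Type) (r : seq J) (P : pred J) (F : J -> 'rV[R]_p -> R) i y :
  open V -> (forall j, P j -> smooth_on V (F j)) -> V y ->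
  partial i (fun y => \sum_(j <- r | P j) F j y) y =
  \sum_(j <- r | P j) partial i (F j) y.
Proof.
move=> oV sF Vy; elim: r => [|j r IHr].
  rewrite big_nil (_ : (fun _ => _) = fun _ => 0) ?partial_cst //.
  by apply/funext => z; rewrite big_nil.
rewrite big_cons -IHr; case Pj: (P j); last first.
  by congr (partial i _ y); apply/funext => z; rewrite big_cons Pj.
rewrite -(@partialD V) //; last exact: smooth_sum; last exact: sF.
by congr (partial i _ y); apply/funext => z; rewrite big_cons Pj.
Qed.

End SmoothFunctions.

(** * Averages along a coordinate axis *)

Section Hadamard.
Context {R : realType} {p : nat}.
Variables (m : 'rV[R]_p) (e : R) (i : 'I_p).
Implicit Types (f : 'rV[R]_p -> R) (y : 'rV[R]_p) (t : R).

Let B : set 'rV[R]_p := ball m e.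

(** Only the [i]-th coordinate is contracted towards that of [m], by the factor [t]: Hadamard's
    lemma is proved one coordinate at a time. Written as a translation along the axis, it turns each
    [line] into a reparametrized [line]. *)
Definition squeeze t y : 'rV[R]_p :=
  y + ((t - 1) * (y 0 i - m 0 i)) *: delta_mx 0 i.

Lemma squeezeE t y j : squeeze t y 0 j =
  if j == i then m 0 i + t * (y 0 i - m 0 i) else y 0 j.
Proof.
rewrite !mxE eqxx eq_sym; case: eqP => [->|_] /=; last by rewrite mulr0 addr0.
by rewrite mulr1; ring.
Qed.

Lemma squeeze1 y : squeeze 1 y = y.
Proof. by rewrite /squeeze subrr mul0r scale0r addr0. Qed.

(** Balls of row vectors are cubes, so their coordinates may be contracted separately. *)
Lemma squeeze_ball t y : 0 <= t <= 1 -> B y -> B (squeeze t y).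
Proof.
move=> t01 [e0 By]; split=> // k j; rewrite (ord1 k) squeezeE.
case: eqP => [->|_]; last by rewrite -(ord1 k).
have := By 0 i; rewrite /ball /= => h.
rewrite opprD addNKr normrN normrM; apply: le_lt_trans h.
by rewrite distrC ger0_norm ?ler_piMl //; case/andP: t01.
Qed.

Lemma squeeze_continuous : continuous (fun z : R * 'rV[R]_p => squeeze z.1 z.2).
Proof.
move=> z; apply: cvgD; first exact: cvg_snd.
apply: cvgZ; last exact: cvg_cst.
apply: cvgM; apply: cvgB; [exact: cvg_fst|exact: cvg_cst| |exact: cvg_cst].
by apply: (@continuous_comp _ _ _ snd (fun y : 'rV[R]_p => y 0 i));
  [exact: cvg_snd|exact: coord_continuous].
Qed.

Definition sqcoef t (j : 'I_p) : R := if j == i then t else 1.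

Lemma squeeze_line t y j (h : R) : squeeze t (y + h *: delta_mx 0 j) =
  squeeze t y + (h * sqcoef t j) *: delta_mx 0 j.
Proof.
rewrite /squeeze /sqcoef !mxE eqxx eq_sym; case: eqP => [->|_] /=.
  rewrite -!addrA -!scalerDl; congr (_ + _ *: _); ring.
by rewrite mulr0 addr0 mulr1 addrAC.
Qed.

Lemma line_squeeze f t y j :
  line (fun z => f (squeeze t z)) j y =
  line f j (squeeze t y) \o (fun h => h * sqcoef t j).
Proof. by apply/funext => h; rewrite /line /= squeeze_line. Qed.

Lemma squeeze_is_derive f t y j (h : R) : smooth_on B f -> 0 <= t <= 1 ->
  B (y + h *: delta_mx 0 j) ->
  is_derive h 1 (line (fun z => f (squeeze t z)) j y)
    (sqcoef t j * partial j f (squeeze t (y + h *: delta_mx 0 j))).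
Proof.
move=> sf t01 By; rewrite line_squeeze mulrC squeeze_line.
have d1 : is_derive h 1 (fun h => h * sqcoef t j) (sqcoef t j).
  by apply: is_derive_eq; rewrite /GRing.scale /= mulr1 mulr0 add0r.
apply: (@is_derive1_comp _ (line f j (squeeze t y)) (fun h => h * sqcoef t j)) => //.
by apply: smooth_is_derive_line sf _; rewrite -squeeze_line; apply: squeeze_ball.
Qed.

Lemma squeeze_is_derive_t f t y : smooth_on B f -> 0 <= t <= 1 -> B y ->
  is_derive t 1 (fun t => f (squeeze t y))
    (partial i f (squeeze t y) * (y 0 i - m 0 i)).
Proof.
move=> sf t01 By; pose c := y 0 i - m 0 i.
have d1 : is_derive t 1 (fun t => (t - 1) * c) c.
  by apply: is_derive_eq; rewrite /GRing.scale /= subr0 mulr1 mulr0 add0r.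
apply: (@is_derive1_comp _ (line f i y) (fun t => (t - 1) * c)) => //.
by apply: smooth_is_derive_line sf _; apply: squeeze_ball.
Qed.

Section Continuous.
Variable f : 'rV[R]_p -> R.
Hypothesis cf : forall y, B y -> {for y, continuous f}.

Lemma squeeze_comp_continuous t y : 0 <= t <= 1 -> B y ->
  {for (t, y), continuous (fun z : R * 'rV[R]_p => f (squeeze z.1 z.2))}.
Proof.
move=> t01 By; apply: (continuous_comp (@squeeze_continuous (t, y))).
exact/cf/squeeze_ball.
Qed.

Lemma squeeze_t_continuous t y : 0 <= t <= 1 -> B y ->
  {for t, continuous (fun t => f (squeeze t y))}.
Proof.
move=> t01 By; apply: (@continuous_comp _ _ _ (squeeze^~ y) f); last exact/cf/squeeze_ball.
apply: cvgD; first exact: cvg_cst.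
apply: cvgZ; last exact: cvg_cst.
apply: cvgM; last exact: cvg_cst.
by apply: cvgB; [exact: cvg_id|exact: cvg_cst].
Qed.

(** By compactness of [0, 1] the continuity in [z] is uniform in [t], which is what limits and
    derivatives under the integral sign require. *)
Lemma squeeze_near y (eps : R) : 0 < eps -> B y ->
  \forall z \near y, forall t, 0 <= t <= 1 ->
    `|f (squeeze t z) - f (squeeze t y)| < eps.
Proof.
move=> eps0 By.
have /compact_near_coveringP nc := @segment_compact R 0 1.
have := nc _ (nbhs y) (fun z t => `|f (squeeze t z) - f (squeeze t y)| < eps).
have H x : (`[0, 1]%classic : set R) x ->
    \forall x' \near x & z \near y, `|f (squeeze x' z) - f (squeeze x' y)| < eps.
  rewrite /= in_itv /= => x01.
  have c1 := squeeze_comp_continuous x01 By.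
  have c2 : {for (x, y), continuous (fun z : R * 'rV[R]_p => f (squeeze z.1 y))}.
    apply: (@continuous_comp _ _ _ fst (fun t => f (squeeze t y))); first exact: cvg_fst.
    exact: squeeze_t_continuous.
  have := cvgB c1 c2; rewrite subrr => /(_ (nbhs_filter _)) /cvgr0_norm_lt H.
  exact: (H _ eps0).
move=> /(_ (nbhs_filter y) H) H'; near=> z => t t01.
have Hz : `[0, 1]%classic `<=` fun t => `|f (squeeze t z) - f (squeeze t y)| < eps by near: z.
apply: Hz.
by rewrite /= in_itv.
Unshelve. all: by end_near.
Qed.

Lemma squeeze_within k y : B y ->
  {within `[0, 1], continuous (fun t => t ^+ k * f (squeeze t y))}.
Proof.
move=> By; apply: continuous_subspace_itv => t; rewrite inE /= => t01.
by apply: cvgM; [exact: exprn_continuous|exact: squeeze_t_continuous].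
Qed.

Lemma squeeze_integrable k y : B y ->
  lebesgue_measure.-integrable `[0, 1] (EFin \o (fun t : R => t ^+ k * f (squeeze t y))).
Proof.
move=> By; apply: continuous_compact_integrable; first exact: segment_compact.
exact: squeeze_within.
Qed.

Lemma squeeze_bounded y : B y ->
  exists M, forall t, 0 <= t <= 1 -> `|f (squeeze t y)| <= M.
Proof.
move=> By.
have cn : {within `[0, 1], continuous (fun t => `|f (squeeze t y)|)}.
  apply: continuous_subspace_itv => t; rewrite inE /= => t01.
  by apply: cvg_norm; exact: squeeze_t_continuous.
have [c _ H] := EVT_max (@ler01 R) cn.
by exists `|f (squeeze c y)| => t t01; apply: H; rewrite in_itv.
Qed.

End Continuous.

(** A derivative along the [i]-th axis brings out a factor [t]; with all the weights [t ^+ k] the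
    class of averages is stable under partial derivatives, as [smooth_coind] demands. *)
Definition average (k : nat) f y : R :=
  \int[lebesgue_measure]_(t in `[0, 1]) (t ^+ k * f (squeeze t y)).

Lemma measure01 : fine (lebesgue_measure (`[0%R, 1%R]%classic : set R)) = 1.
Proof. by rewrite lebesgue_measure_itv /= lte01 oppr0 adde0. Qed.

Lemma average_continuous k f y : open B ->
  (forall y, B y -> {for y, continuous f}) -> B y -> {for y, continuous (average k f)}.
Proof.
move=> oB cf By; apply/(@cvgrPdist_le _ _ _ (nbhs y) (nbhs_filter y)) => eps eps0.
have nB : \forall z \near y, B z by exact: open_nbhs_nbhs.
near=> z; have Bz : B z by near: z.
have Hz : forall t, 0 <= t <= 1 -> `|f (squeeze t z) - f (squeeze t y)| < eps.
  near: z; exact: (squeeze_near cf eps0 By).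
rewrite distrC /average -RintegralB //; try exact: squeeze_integrable.
have iD : lebesgue_measure.-integrable `[0, 1] (EFin \o (fun t : R =>
    t ^+ k * f (squeeze t z) - t ^+ k * f (squeeze t y))).
  rewrite (_ : _ \o _ = (fun t => (t ^+ k * f (squeeze t z))%:E - (t ^+ k * f (squeeze t y))%:E)%E) //.
  by apply: integrableB => //; exact: squeeze_integrable.
apply: le_trans (le_normr_Rintegral _ iD) _ => //.
have -> : eps = \int[lebesgue_measure]_(t in `[0 : R, 1]) eps.
  by rewrite Rintegral_cst // measure01 mulr1.
apply: le_Rintegral => //.
- exact: (integrable_norm iD).
- apply: continuous_compact_integrable; first exact: segment_compact.
  by apply: continuous_subspaceT => ?; exact: cst_continuous.
- move=> t; rewrite /= in_itv /= => t01; rewrite -mulrBr normrM.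
  rewrite -[eps]mul1r ler_pM //; last exact/ltW/Hz.
  case/andP: t01 => t0 t1.
  by rewrite normrX ger0_norm // exprn_ile1.
Unshelve. all: by end_near.
Qed.

Lemma average_derive k f j y : open B -> smooth_on B f -> B y ->
  derivable (line (average k f) j y) 0 1 /\
  partial j (average k f) y = average (k + (j == i)) (partial j f) y.
Proof.
move=> oB sf By; have sf' := smooth_partial j sf.
have cf z : B z -> {for z, continuous f} by case/(sf [::]).
have cf' z : B z -> {for z, continuous (partial j f)} by case/(sf' [::]).
have [M HM] := squeeze_bounded cf' By.
pose F (h t : R) := t ^+ k * f (squeeze t (y + h *: delta_mx 0 j)).
(* [M] bounds the derivative over the segment at [y]; close to [y] the uniform continuity costs at
   most 1, so the constant [M + 1] dominates. *)
have [r r0 Hr] : exists2 r, 0 < r & forall h, `]- r, r[%classic h ->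
    B (y + h *: delta_mx 0 j) /\
    forall t, 0 <= t <= 1 -> `|partial j f (squeeze t (y + h *: delta_mx 0 j))| <= M + 1.
  have n1 : \forall h \near (0 : R), B (y + h *: delta_mx 0 j).
    by apply: near_line => //; rewrite scale0r addr0.
  have n2 : \forall h \near (0 : R), forall t, 0 <= t <= 1 ->
      `|partial j f (squeeze t (y + h *: delta_mx 0 j)) - partial j f (squeeze t y)| < 1.
    have := squeeze_near cf' ltr01 By.
    by rewrite -{1}[y]addr0 -(scale0r (delta_mx 0 j)) => /line_continuous.
  have [r /= r0 Hr] : nbhs (0 : R) [set h | B (y + h *: delta_mx 0 j) /\
      forall t, 0 <= t <= 1 ->
      `|partial j f (squeeze t (y + h *: delta_mx 0 j)) - partial j f (squeeze t y)| < 1].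
    by apply: filterS2 n1 n2.
  exists r => // h; rewrite /= in_itv /= => hr.
  have [|Bh Hh] := Hr h; first by rewrite /ball_ /= sub0r normrN ltr_norml.
  split=> // t t01; rewrite -[X in `|X|](subrK (partial j f (squeeze t y))).
  apply: le_trans (ler_normD _ _) _; rewrite addrC lerD ?HM //.
  exact/ltW/Hh.
have dF h t : `]- r, r[%classic h -> 0 <= t <= 1 -> is_derive h 1 (F^~ t)
    (t ^+ (k + (j == i)) * partial j f (squeeze t (y + h *: delta_mx 0 j))).
  move=> /Hr [Bh _] t01; have dl := squeeze_is_derive sf t01 Bh.
  rewrite (_ : F^~ t = fun h => t ^+ k *: line (fun z => f (squeeze t z)) j y h) //.
  apply: is_derive_eq; rewrite /GRing.scale /= mulrA; congr (_ * _).
  by rewrite /sqcoef; case: eqP => _; rewrite ?addn1 ?exprSr // addn0 mulr1.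
have r1 : (`]- r, r[%classic : set R) 0 by rewrite /= in_itv /= oppr_lt0 r0.
have intF h : `]- r, r[%classic h -> lebesgue_measure.-integrable `[0, 1] (EFin \o F h).
  by move=> /Hr [Bh _]; apply: squeeze_integrable.
have derF h t : `]- r, r[%classic h -> `[0, 1]%classic t -> derivable (F^~ t) h 1.
  by move=> hr; rewrite /= in_itv /= => t01; have [] := dF h t hr t01.
have M0 : 0 <= M + 1.
  have z01 : 0 <= (0 : R) <= 1 by apply/andP; split; [exact: lexx|exact: ler01].
  by apply: addr_ge0 => //; exact: le_trans (normr_ge0 _) (HM 0 z01).
have iM : lebesgue_measure.-integrable `[0 : R, 1] (EFin \o cst (M + 1)).
  apply: continuous_compact_integrable; first exact: segment_compact.
  by apply: continuous_subspaceT => ?; exact: cst_continuous.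
have ubF h t : `]- r, r[%classic h -> `[0, 1]%classic t ->
    `|partial1of2 F h t| <= cst (M + 1) t.
  move=> hr; rewrite /= in_itv /= => t01; rewrite partial1of2E.
  have [_ ->] := dF h t hr t01; rewrite normrM -[M + 1]mul1r ler_pM //.
    by case/andP: t01 => t0 t1; rewrite normrX ger0_norm // exprn_ile1.
  by have [_] := Hr h hr; apply.
have mI : measurable (`[0, 1]%classic : set (measurableTypeR R)) by [].
have := @derivable_under_integral _ _ _ lebesgue_measure F _ mI 0 _ _ r1 intF derF
  (cst (M + 1)) (fun=> M0) iM ubF.
have := @differentiation_under_integral _ _ _ lebesgue_measure F _ mI 0 _ _ r1 intF derF
  (cst (M + 1)) (fun=> M0) iM ubF.
move=> D1 D2; split; first exact: D2.
rewrite /partial [LHS]D1 /average; apply: eq_Rintegral => t; rewrite inE /= in_itv /= => t01.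
by rewrite partial1of2E; have [_ ->] := dF 0 t r1 t01; rewrite scale0r addr0.
Qed.

Lemma average_smooth k f : open B -> smooth_on B f -> smooth_on B (average k f).
Proof.
move=> oB sf.
apply: (@smooth_coind _ _ _ (fun g => exists k f, smooth_on B f /\ g = average k f)) => //.
- move=> _ [l [g [sg ->]]] y By; split.
    by apply: average_continuous => // z /(sg [::]) [].
  by move=> j; have [] := average_derive l j oB sg By.
- move=> _ j [l [g [sg ->]]]; exists (average (l + (j == i)) (partial j g)).
    by exists (l + (j == i))%N, (partial j g); split=> //; apply: smooth_partial.
  by move=> y By; have [] := average_derive l j oB sg By.
- by exists k, f.
Qed.

Lemma squeeze0_smooth f : open B -> smooth_on B f ->
  smooth_on B (fun y => f (squeeze 0 y)).
Proof.
move=> oB sf; have t01 : 0 <= (0 : R) <= 1 by apply/andP; split; [exact: lexx|exact: ler01].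
apply: (@smooth_coind _ _ _ (fun g => exists2 f, smooth_on B f &
   g = fun y => f (squeeze 0 y))) => //; last by exists f.
- move=> _ [g sg ->] y By; split.
    apply: (@continuous_comp _ _ _ (squeeze 0) g); last first.
      by have [] := sg [::] (squeeze 0 y) (squeeze_ball t01 By).
    suff cs : {for y, continuous (fun y : 'rV[R]_p =>
        ((0 - 1) * (y 0 i - m 0 i)) *: (delta_mx 0 i : 'rV[R]_p))}.
      exact: (cvgD cvg_id cs).
    have cc : {for y, continuous (fun y : 'rV[R]_p => y 0 i)} by exact: coord_continuous.
    exact: (cvgZ (cvgM (cvg_cst _) (cvgB cc (cvg_cst _))) (cvg_cst _)).
  move=> j; have := @squeeze_is_derive g 0 y j 0 sg t01.
  by rewrite scale0r addr0 => /(_ By) [].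
- move=> _ j [g sg ->].
  exists (fun y => sqcoef 0 j * partial j g (squeeze 0 y)).
    exists (fun y => sqcoef 0 j * partial j g y) => //.
    apply: smoothM => //; first exact: smooth_cst.
    exact: smooth_partial.
  move=> y By; have := @squeeze_is_derive g 0 y j 0 sg t01.
  by rewrite scale0r addr0 => /(_ By) [_ <-]; rewrite -derive1E.
Qed.

(** The fundamental theorem of calculus for [t |-> f (squeeze t y)] on [0, 1], whose derivative
    contains the factor [y 0 i - m 0 i]. *)
Lemma squeeze_average f y : smooth_on B f -> B y ->
  f y = f (squeeze 0 y) + (y 0 i - m 0 i) * average 0 (partial i f) y.
Proof.
move=> sf By; have sf' := smooth_partial i sf.
have cf z : B z -> {for z, continuous f} by case/(sf [::]).
have cf' z : B z -> {for z, continuous (partial i f)} by case/(sf' [::]).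
have dF t : 0 <= t <= 1 -> _ := fun t01 => squeeze_is_derive_t sf t01 By.
have w01 := @squeeze_within _ cf' 0 y By.
have iG := @squeeze_integrable _ cf' 0 y By.
have : (\int[lebesgue_measure]_(t in `[0%R, 1%R])
   ((y 0 i - m 0 i) * (t ^+ 0 * partial i f (squeeze t y)))%:E)%E =
   ((f (squeeze 1 y))%:E - (f (squeeze 0 y))%:E)%E.
  apply: (@continuous_FTC2 R _ (fun t => f (squeeze t y)) 0 1) => //.
  - by move=> t; apply: cvgM; [exact: cvg_cst|exact: w01].
  - have c t : 0 <= t <= 1 -> {for t, continuous (fun t => f (squeeze t y))}.
      by move=> t01; apply: squeeze_t_continuous.
    split.
    + move=> t; rewrite in_itv /= => /andP [t0 t1].
      by have [] := dF t; rewrite // !ltW.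
    + by apply: cvg_at_right_filter; apply: c; rewrite lexx ler01.
    + by apply: cvg_at_left_filter; apply: c; rewrite lexx ler01.
  - move=> t; rewrite in_itv /= => /andP [t0 t1].
    have [|_ E] := dF t; first by rewrite !ltW.
    by rewrite derive1E E expr0 mul1r mulrC.
rewrite squeeze1 => E; apply/eqP; rewrite addrC -subr_eq eq_sym; apply/eqP.
by rewrite /average -RintegralZl // /Rintegral E.
Qed.

End Hadamard.

(** The coordinates are set to those of [m] one after the other. Each contributes one average, and
    the function that remains is again smooth on the whole ball, so the induction applies to it. *)
Lemma hadamard (R : realType) (p : nat) (m : 'rV[R]_p) (e : R) (f : 'rV[R]_p -> R) :
  0 < e -> smooth_on (ball m e) f ->
  exists2 g : 'I_p -> 'rV[R]_p -> R, (forall i, smooth_on (ball m e) (g i)) &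
    forall y, ball m e y -> f y = f m + \sum_i (y 0 i - m 0 i) * g i y.
Proof.
move=> e0 sf; have oB : open (ball m e) by exact: ball_open.
pose sq := foldr (fun i (z : 'rV[R]_p) => squeeze m i 0 z).
have t01 : 0 <= (0 : R) <= 1 by apply/andP; split; [exact: lexx|exact: ler01].
have H r : uniq r -> exists g : 'I_p -> 'rV[R]_p -> R, (forall i, smooth_on (ball m e) (g i)) /\
    forall y, ball m e y -> f y = f (sq y r) + \sum_(i <- r) (y 0 i - m 0 i) * g i y.
  elim: r f sf => [|i r IHr] h sh /=.
    move=> _; exists (fun _ _ => 0); split; first by move=> i; apply: smooth_cst.
    by move=> y By; rewrite big_nil addr0.
  move=> /andP [ir ur].
  have [g [sg gE]] := IHr _ (squeeze0_smooth i oB sh) ur.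
  exists (fun j => if j == i then average m i 0 (partial i h) else g j); split.
    move=> j; case: eqP => // _; apply: average_smooth => //; exact: smooth_partial.
  move=> y By; rewrite (squeeze_average i sh By) gE // big_cons eqxx.
  rewrite -addrA; congr (_ + _); rewrite addrC; congr (_ + _).
  by apply: eq_big_seq => j jr; case: eqP jr ir => // -> ->.
have [g [sg gE]] := H _ (enum_uniq 'I_p); exists g => // y By.
rewrite gE // big_enum; congr (f _ + _); apply/rowP => j.
have sqE r : sq y r 0 j = if j \in r then m 0 j else y 0 j.
  elim: r => //= i r IHr; rewrite squeezeE inE mul0r addr0 IHr.
  by case: eqP => [->|].
by rewrite sqE mem_enum.
Qed.

(** * Coordinates and vector fields *)

Section Components.
Context {R : realType} {p q : nat} {M : supermanifold R p q}.
Variables (c : chart M p q) (U : opens M) (Uc : U `<=` cdom c).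
Implicit Types (f g : sO U) (I J : {set 'I_q}) (al be : 'I_q).

Lemma open_image : open (cmap c @` U). Proof. exact: cmap_open. Qed.
Hint Resolve open_image : core.

Lemma image_mem x : U x -> cmap c x \in cmap c @` U.
Proof. by move=> Ux; apply/mem_set; exists x. Qed.

Lemma ccomp0 I y : y \in cmap c @` U -> ccomp Uc 0 I y = 0.
Proof. by move=> yU; apply: (addrI (ccomp Uc 0 I y)); rewrite -ccompD // !addr0. Qed.

Lemma ccompB f g I y : y \in cmap c @` U ->
  ccomp Uc (f - g) I y = ccomp Uc f I y - ccomp Uc g I y.
Proof. by move=> yU; rewrite ccompD // ccompN. Qed.

Lemma ccomp_sum (J : Type) (r : seq J) (P : pred J) (F : J -> sO U) I y :
  y \in cmap c @` U ->
  ccomp Uc (\sum_(j <- r | P j) F j) I y = \sum_(j <- r | P j) ccomp Uc (F j) I y.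
Proof.
move=> yU; elim: r => [|j r IHr]; first by rewrite !big_nil ccomp0.
by rewrite !big_cons; case: ifP => // _; rewrite ccompD // IHr.
Qed.

Lemma from_compE (g : {set 'I_q} -> 'rV[R]_p -> R) I y :
  (forall I, smooth_on (cmap c @` U) (g I)) -> y \in cmap c @` U ->
  ccomp Uc (from_comp Uc g) I y = g I y.
Proof.
move=> sg yU; rewrite /from_comp; case: xgetP => [f _ fg|nf]; first exact: fg.
by have [f fg] := ccomp_surj Uc sg; case: (nf f).
Qed.

Definition pure f := forall I y, y \in cmap c @` U -> I != finset.set0 ->
  ccomp Uc f I y = 0.

Lemma wedge_sign0l I : wedge_sign finset.set0 I = 0%N.
Proof. by apply: eq_card0 => -[a b]; rewrite !inE. Qed.

Lemma ccomp_pureM f g I y : pure f -> y \in cmap c @` U ->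
  ccomp Uc (f * g) I y = ccomp Uc f finset.set0 y * ccomp Uc g I y.
Proof.
move=> pf yU; rewrite ccompM // (bigD1 finset.set0) ?finset.sub0set //= finset.setD0.
rewrite wedge_sign0l expr0 mul1r big1 ?addr0 // => J /andP [_ J0].
by rewrite pf // mul0r mulr0.
Qed.

Lemma ccomp_scal0 (r : R) y : y \in cmap c @` U ->
  ccomp Uc (scal r) finset.set0 y = r.
Proof. by move=> yU; rewrite ccomp_scal // eqxx. Qed.

Lemma pure_scal (r : R) : pure (scal r).
Proof. by move=> I y yU I0; rewrite ccomp_scal // (negbTE I0). Qed.

Definition xcoord (i : 'I_p) : sO U := sres Uc (even_coord c i).
Definition tcoord (al : 'I_q) : sO U := sres Uc (odd_coord c al).

Lemma image_sub y : y \in cmap c @` U -> y \in cmap c @` cdom c.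
Proof. by rewrite !inE => -[x Ux <-]; exists x => //; apply: Uc. Qed.

Lemma ccomp_xcoord i I y : y \in cmap c @` U ->
  ccomp Uc (xcoord i) I y = if I == finset.set0 then y 0 i else 0.
Proof.
move=> yU; rewrite (ccomp_res (@subset_refl _ (cdom c))) // /even_coord.
rewrite /from_comp; case: xgetP => [f _ -> //|nf]; first exact: image_sub.
have oc : open (cmap c @` cdom c) by apply: cmap_open.
have [I'|f fg] := ccomp_surj (@subset_refl _ (cdom c))
    (g := fun I y => if I == finset.set0 then y 0 i else 0).
  by case: eqP => _; [exact: smooth_coord|exact: smooth_cst].
by case: (nf f).
Qed.

Lemma ccomp_tcoord al I y : y \in cmap c @` U ->
  ccomp Uc (tcoord al) I y = if I == finset.set1 al then 1 else 0.
Proof.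
move=> yU; rewrite (ccomp_res (@subset_refl _ (cdom c))) // /odd_coord.
rewrite /from_comp; case: xgetP => [f _ -> //|nf]; first exact: image_sub.
have oc : open (cmap c @` cdom c) by apply: cmap_open.
have [I'|f fg] := ccomp_surj (@subset_refl _ (cdom c))
    (g := fun I (_ : 'rV[R]_p) => if I == finset.set1 al then 1 else 0).
  by case: eqP => _; exact: smooth_cst.
by case: (nf f).
Qed.

Lemma pure_xcoord i : pure (xcoord i).
Proof. by move=> I y yU I0; rewrite ccomp_xcoord // (negbTE I0). Qed.

Lemma ginv_xcoord i : ginv (xcoord i) = xcoord i.
Proof. by rewrite -sres_ginv even_coord_even. Qed.

Lemma ginv_tcoord al : ginv (tcoord al) = - tcoord al.
Proof. by rewrite -sres_ginv odd_coord_odd rmorphN. Qed.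

Lemma ccomp_even_deriv i f I y : y \in cmap c @` U ->
  ccomp Uc (even_deriv Uc i f) I y = partial i (ccomp Uc f I) y.
Proof.
by move=> yU; rewrite from_compE // => J; apply: smooth_partial; exact: ccomp_smooth.
Qed.

Lemma ccomp_odd_deriv al f I y : y \in cmap c @` U ->
  ccomp Uc (odd_deriv Uc al f) I y = if al \in I then 0 else
    (-1) ^+ #|[pred be in I | (al < be)%N]| * ccomp Uc f (al |: I)%SET y.
Proof.
move=> yU; rewrite from_compE // => J; case: (al \in J); first exact: smooth_cst.
by apply: smoothM => //; [exact: smooth_cst|exact: ccomp_smooth].
Qed.

Lemma even_derivD i : {morph even_deriv Uc i : f g / f + g}.
Proof.
move=> f g; apply: (@ccomp_inj _ _ _ _ c U Uc) => I y yU.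
rewrite ccompD // !ccomp_even_deriv // -(@partialD _ _ (cmap c @` U)) //; try exact: ccomp_smooth.
  apply: (@partial_local _ _ (cmap c @` U)) => //; last exact/set_mem.
  by move=> z /mem_set zU; rewrite ccompD.
exact/set_mem.
Qed.

Lemma even_derivM i f g :
  even_deriv Uc i (f * g) = even_deriv Uc i f * g + f * even_deriv Uc i g.
Proof.
apply: (@ccomp_inj _ _ _ _ c U Uc) => I y yU.
rewrite ccompD // ccomp_even_deriv //.
transitivity (partial i (fun y => \sum_(J : {set 'I_q} | J \subset I)
    (-1) ^+ wedge_sign J (I :\: J)%SET * (ccomp Uc f J y * ccomp Uc g (I :\: J)%SET y)) y).
  apply: (@partial_local _ _ (cmap c @` U)) => //; last exact/set_mem.
  by move=> z /mem_set zU; rewrite ccompM.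
have yU' := set_mem yU.
rewrite (@partial_sum _ _ (cmap c @` U)) //; last first.
  move=> J _; apply: smoothM; rewrite //; first exact: smooth_cst.
  by apply: smoothM => //; exact: ccomp_smooth.
rewrite !ccompM // -big_split; apply: eq_bigr => J _ /=.
rewrite (@partialM _ _ (cmap c @` U)) //; last 2 first.
- exact: smooth_cst.
- by apply: smoothM => //; exact: ccomp_smooth.
rewrite partial_cst mul0r add0r (@partialM _ _ (cmap c @` U)) //; try exact: ccomp_smooth.
by rewrite !ccomp_even_deriv // mulrDr.
Qed.

Lemma even_deriv_ginv i f : even_deriv Uc i (ginv f) = ginv (even_deriv Uc i f).
Proof.
apply: (@ccomp_inj _ _ _ _ c U Uc) => I y yU.
rewrite ccomp_ginv // !ccomp_even_deriv //.
transitivity (partial i (fun y => (-1) ^+ #|I| * ccomp Uc f I y) y).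
  apply: (@partial_local _ _ (cmap c @` U)) => //; last exact/set_mem.
  by move=> z /mem_set zU; rewrite ccomp_ginv.
rewrite (@partialM _ _ (cmap c @` U)) //; last exact/set_mem.
- by rewrite partial_cst mul0r add0r.
- exact: smooth_cst.
- exact: ccomp_smooth.
Qed.

Lemma even_deriv_scal i (r : R) : even_deriv Uc i (scal r) = 0.
Proof.
apply: (@ccomp_inj _ _ _ _ c U Uc) => I y yU.
rewrite ccomp_even_deriv // ccomp0 //.
transitivity (partial i (fun _ : 'rV[R]_p => if I == finset.set0 then r else 0) y).
  apply: (@partial_local _ _ (cmap c @` U)) => //; last exact/set_mem.
  by move=> z /mem_set zU; rewrite ccomp_scal.
by rewrite partial_cst.
Qed.

Lemma even_deriv_xcoord i j : even_deriv Uc i (xcoord j) = (i == j)%:R.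
Proof.
apply: (@ccomp_inj _ _ _ _ c U Uc) => I y yU; rewrite ccomp_even_deriv //.
transitivity (partial i (fun y => if I == finset.set0 then y 0 j else 0) y).
  apply: (@partial_local _ _ (cmap c @` U)) => //; last exact/set_mem.
  by move=> z /mem_set zU; rewrite ccomp_xcoord.
have -> : ((i == j)%:R : sO U) = scal (i == j)%:R.
  case: (i == j); first by rewrite scal1.
  by apply: (addrI (scal 0)); rewrite -scalD !addr0.
rewrite ccomp_scal //; case: (I == finset.set0); last by rewrite partial_cst.
by rewrite partial_coord.
Qed.

Lemma even_deriv_tcoord i al : even_deriv Uc i (tcoord al) = 0.
Proof.
apply: (@ccomp_inj _ _ _ _ c U Uc) => I y yU; rewrite ccomp_even_deriv // ccomp0 //.
transitivity (partial i (fun _ : 'rV[R]_p => if I == finset.set1 al then 1 else 0) y).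
  apply: (@partial_local _ _ (cmap c @` U)) => //; last exact/set_mem.
  by move=> z /mem_set zU; rewrite ccomp_tcoord.
by rewrite partial_cst.
Qed.

Lemma odd_derivD al : {morph odd_deriv Uc al : f g / f + g}.
Proof.
move=> f g; apply: (@ccomp_inj _ _ _ _ c U Uc) => I y yU.
rewrite ccompD // !ccomp_odd_deriv //; case: ifP => _; first by rewrite addr0.
by rewrite ccompD // mulrDr.
Qed.

Lemma odd_deriv_ginv al f : odd_deriv Uc al (ginv f) = - ginv (odd_deriv Uc al f).
Proof.
apply: (@ccomp_inj _ _ _ _ c U Uc) => I y yU.
rewrite ccompN // ccomp_ginv // !ccomp_odd_deriv //; case: ifPn => alI.
  by rewrite mulr0 oppr0.
by rewrite ccomp_ginv // cardsU1 alI exprS mulN1r mulNr mulrN mulrCA.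
Qed.

Definition free al f := forall I y, y \in cmap c @` U -> al \in I ->
  ccomp Uc f I y = 0.

Lemma freeM al f g : free al f -> free al g -> free al (f * g).
Proof.
move=> ff fg I y yU alI; rewrite ccompM // big1 // => J JI.
case: (boolP (al \in J)) => alJ; first by rewrite ff // mul0r mulr0.
by rewrite fg ?mulr0 // inE alJ.
Qed.

Lemma freeD al f g : free al f -> free al g -> free al (f + g).
Proof. by move=> ff fg I y yU alI; rewrite ccompD // ff // fg // addr0. Qed.

Lemma free_ginv al f : free al f -> free al (ginv f).
Proof. by move=> ff I y yU alI; rewrite ccomp_ginv // ff // mulr0. Qed.

Lemma odd_deriv_free al f : free al (odd_deriv Uc al f).
Proof. by move=> I y yU alI; rewrite ccomp_odd_deriv // alI. Qed.

Lemma free_odd_deriv al f : free al f -> odd_deriv Uc al f = 0.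
Proof.
move=> ff; apply: (@ccomp_inj _ _ _ _ c U Uc) => I y yU.
rewrite ccomp_odd_deriv // ccomp0 //; case: ifP => // _.
by rewrite ff ?mulr0 // !inE eqxx.
Qed.

(** Only the splitting of [I] into [I :\ al] and the singleton of [al] contributes; the sign moves
    theta_al left past the larger indices. *)
Lemma ccompM_tcoord al f I y : y \in cmap c @` U ->
  ccomp Uc (f * tcoord al) I y = if al \in I then
    (-1) ^+ #|[pred be in I | (al < be)%N]| * ccomp Uc f (I :\ al)%SET y else 0.
Proof.
move=> yU; rewrite ccompM //; case: ifPn => alI; last first.
  apply: big1 => J JI; rewrite ccomp_tcoord // ifN ?mulr0 //.
  apply: contra alI => /eqP E; have : al \in finset.set1 al by rewrite inE.
  by rewrite -E inE => /andP [].
have DD : (I :\: (I :\ al) = finset.set1 al)%SET.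
  by apply/setP => x; rewrite !inE; case: (x =P al) => [->|]; rewrite ?alI //= andNb.
rewrite (bigD1 (I :\ al)%SET) ?finset.subD1set //= big1 => [|J /andP [JI JN]].
  rewrite addr0 ccomp_tcoord // DD eqxx mulr1; congr (_ ^+ _ * _).
  rewrite /wedge_sign.
  have inj : injective (fun be : 'I_q => (be, al)) by move=> a b [].
  rewrite -(fintype.card_image inj [pred be in I | (al < be)%N]).
  apply: eq_card => -[a b]; rewrite [LHS]inE; apply/andP/fintype.imageP => /=.
    move=> [/finset.setXP [/finset.setD1P [_ aI] /finset.set1P ->] lt].
    by exists a; rewrite ?inE ?aI.
  move=> [be]; rewrite inE => /andP [bI lt] [-> ->]; split=> //.
  by apply/finset.setXP; rewrite !inE bI andbT; split=> //; apply: contraTneq lt => ->; rewrite ltnn.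
rewrite ccomp_tcoord // ifN ?mulr0 //; apply: contra JN => /eqP E.
apply/eqP/setP => x; have := f_equal (fun S : {set 'I_q} => x \in S) E.
rewrite !inE; have := fintype.subsetP JI x; case: (x \in J) => /=.
  by move=> -> // <-.
by move=> _; case: (x == al) => //= ->.
Qed.

Lemma odd_deriv_mul_tcoord al f : free al f -> odd_deriv Uc al (f * tcoord al) = f.
Proof.
move=> ff; apply: (@ccomp_inj _ _ _ _ c U Uc) => I y yU.
rewrite ccomp_odd_deriv //; case: ifPn => alI; first by rewrite ff.
rewrite ccompM_tcoord // !inE eqxx /=.
have -> : ((al |: I) :\ al = I)%SET by rewrite finset.setU1K.
rewrite mulrA -exprD (_ : #|[pred be in (al |: I)%SET | _]| = #|[pred be in I | (al < be)%N]|).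
  by rewrite -signr_odd oddD addbb mul1r.
apply: eq_card => be; rewrite !inE; case: (be =P al) => //= ->.
by rewrite ltnn andbF.
Qed.

Lemma free_decomp al f : exists2 f0, free al f0 & f = f0 + odd_deriv Uc al f * tcoord al.
Proof.
pose f0 := from_comp Uc (fun I y => if al \in I then 0 else ccomp Uc f I y).
have f0E I y : y \in cmap c @` U ->
    ccomp Uc f0 I y = if al \in I then 0 else ccomp Uc f I y.
  move=> yU; rewrite from_compE // => J.
  by case: (al \in J); [exact: smooth_cst|exact: ccomp_smooth].
exists f0; first by move=> I y yU alI; rewrite f0E // alI.
apply: (@ccomp_inj _ _ _ _ c U Uc) => I y yU.
rewrite ccompD // f0E // ccompM_tcoord //; case: ifPn => alI; last by rewrite addr0.
rewrite ccomp_odd_deriv // !inE eqxx /= finset.setD1K // add0r mulrA -exprD.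
rewrite (_ : #|[pred be in (I :\ al)%SET | _]| = #|[pred be in I | (al < be)%N]|).
  by rewrite -signr_odd oddD addbb mul1r.
apply: eq_card => be; rewrite !inE; case: (be =P al) => //= ->.
by rewrite ltnn andbF.
Qed.

Lemma tcoord_sqr al : tcoord al * tcoord al = 0.
Proof.
apply: (@ccomp_inj _ _ _ _ c U Uc) => I y yU; rewrite ccompM_tcoord // ccomp0 //.
case: ifPn => // alI; rewrite ccomp_tcoord // ifN ?mulr0 //.
apply/eqP => /setP /(_ al); by rewrite !inE eqxx.
Qed.

(** The derivative acts from the right and meets [g] first, hence [ginv g] in the other term.
    Writing both factors as f0 + f1 theta_al and using theta_al^2 = 0 avoids the signs of the
    component formula. *)
Lemma odd_derivM al f g : odd_deriv Uc al (f * g) =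
  f * odd_deriv Uc al g + odd_deriv Uc al f * ginv g.
Proof.
have [f0 ff0] := free_decomp al f; have ff1 := @odd_deriv_free al f.
have [g0 fg0] := free_decomp al g; have fg1 := @odd_deriv_free al g.
move: (odd_deriv Uc al f) (odd_deriv Uc al g) ff1 fg1 => f1 g1 ff1 fg1 -> ->.
have tt h : tcoord al * h = ginv h * tcoord al by rewrite oddC // ginv_tcoord.
have E : (f0 + f1 * tcoord al) * (g0 + g1 * tcoord al) =
    f0 * g0 + (f0 * g1 + f1 * ginv g0) * tcoord al.
  rewrite !mulrDl !mulrDr -!addrA; congr (_ + _).
  rewrite -!mulrA (tt (g1 * _)) ginvM ginv_tcoord mulrN mulNr -mulrA tcoord_sqr.
  by rewrite mulr0 oppr0 mulr0 addr0 tt !mulrA.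
rewrite E odd_derivD free_odd_deriv ?add0r ?odd_deriv_mul_tcoord; last exact: freeM.
  rewrite ginvD ginvM ginv_tcoord mulrN [in RHS]mulrDr mulrN mulrDl -(mulrA f1) tt.
  by rewrite -addrA; congr (_ + _); rewrite [RHS]addrC subrK.
by apply: freeD; apply: freeM => //; apply: free_ginv.
Qed.

Lemma odd_deriv_scal al (r : R) : odd_deriv Uc al (scal r) = 0.
Proof.
apply: free_odd_deriv => I y yU alI; apply: pure_scal => //.
by apply: contraTneq alI => ->; rewrite inE.
Qed.

Lemma odd_deriv_xcoord al i : odd_deriv Uc al (xcoord i) = 0.
Proof.
apply: free_odd_deriv => I y yU alI; apply: pure_xcoord => //.
by apply: contraTneq alI => ->; rewrite inE.
Qed.

Lemma odd_deriv_tcoord al be : odd_deriv Uc al (tcoord be) = (al == be)%:R.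
Proof.
case: (al =P be) => [<-|ab].
  have := @odd_deriv_mul_tcoord al 1; rewrite mul1r; apply.
  by move=> I y yU alI; rewrite -scal1; apply: pure_scal => //;
    apply: contraTneq alI => ->; rewrite inE.
apply: free_odd_deriv => I y yU alI; rewrite ccomp_tcoord // ifN //.
by apply: contraTneq alI => ->; rewrite inE; apply/eqP.
Qed.

End Components.

(** * Vector fields over a coordinate domain *)

Section CoordinateFields.
Context {R : realType} {p q : nat} {M : supermanifold R p q}.
Variables (c : chart M p q).
Implicit Types (U V W : opens M).

Lemma sres_xcoord U V (Uc : U `<=` cdom c) (Vc : V `<=` cdom c) (VU : V `<=` U) i :
  sres VU (xcoord Uc i) = xcoord Vc i.
Proof. by rewrite /xcoord (sres_comp _ _ Vc). Qed.

Lemma sres_tcoord U V (Uc : U `<=` cdom c) (Vc : V `<=` cdom c) (VU : V `<=` U) al :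
  sres VU (tcoord Uc al) = tcoord Vc al.
Proof. by rewrite /tcoord (sres_comp _ _ Vc). Qed.

Lemma image_mono U V y : V `<=` U -> y \in cmap c @` V -> y \in cmap c @` U.
Proof. by move=> VU; rewrite !inE => -[x Vx <-]; exists x => //; apply: VU. Qed.

Lemma sres_even_deriv U V (Uc : U `<=` cdom c) (Vc : V `<=` cdom c) (VU : V `<=` U) i f :
  even_deriv Vc i (sres VU f) = sres VU (even_deriv Uc i f).
Proof.
apply: (@ccomp_inj _ _ _ _ c V Vc) => I y yV; have yU := image_mono VU yV.
rewrite (ccomp_res Uc) // !ccomp_even_deriv //.
apply: (@partial_local _ _ (cmap c @` V)); last exact/set_mem.
  exact: cmap_open.
by move=> z /mem_set zV; rewrite (ccomp_res Uc).
Qed.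

Lemma sres_odd_deriv U V (Uc : U `<=` cdom c) (Vc : V `<=` cdom c) (VU : V `<=` U) al f :
  odd_deriv Vc al (sres VU f) = sres VU (odd_deriv Uc al f).
Proof.
apply: (@ccomp_inj _ _ _ _ c V Vc) => I y yV; have yU := image_mono VU yV.
rewrite (ccomp_res Uc) // !ccomp_odd_deriv //; case: ifP => // _.
by rewrite (ccomp_res Uc).
Qed.

Section Fields.
Variables (U : opens M) (Uc : U `<=` cdom c).

Definition dx_field (i : 'I_p) : vfield U.
Proof.
refine (@VField _ _ U (fun V VU => even_deriv (subset_trans VU Uc) i) _ _ _ _).
- by move=> V VU f g; rewrite even_derivD.
- by move=> V VU r f; rewrite even_derivM even_deriv_scal mul0r add0r.
- by move=> V W VU WU WV f; rewrite (sres_even_deriv (subset_trans VU Uc)).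
- move=> V VU f g; rewrite even_derivM -addrA; congr (_ + _).
  by rewrite even_deriv_ginv ginvK -mulrDl evenpart_odd.
Defined.

(* The left derivative: f <-d/dtheta = (-1)^(|f|+1) d/dtheta f. *)
Definition dtheta_field (al : 'I_q) : vfield U.
Proof.
refine (@VField _ _ U (fun V VU f => ginv (odd_deriv (subset_trans VU Uc) al f)) _ _ _ _).
- by move=> V VU f g; rewrite odd_derivD ginvD.
- by move=> V VU r f; rewrite odd_derivM odd_deriv_scal mul0r addr0 ginvM ginv_scal.
- by move=> V W VU WU WV f; rewrite (sres_odd_deriv (subset_trans VU Uc)) sres_ginv.
- move=> V VU f g; rewrite odd_derivM ginvD !ginvM !ginvK addrC -addrA; congr (_ + _).
  by rewrite odd_deriv_ginv mulrN -mulrBl even_odd_ginv.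
Defined.

End Fields.

Section Expansion.
Variables (U : opens M) (Uc : U `<=` cdom c).

Lemma vapp0 (X : vfield U) V (VU : V `<=` U) : X V VU 0 = 0.
Proof. by apply: (addrI (X V VU 0)); rewrite -vappD !addr0. Qed.

Lemma vappN (X : vfield U) V (VU : V `<=` U) f : X V VU (- f) = - X V VU f.
Proof. by apply: (addrI (X V VU f)); rewrite -vappD !subrr vapp0. Qed.

Lemma vapp1 (X : vfield U) V (VU : V `<=` U) : X V VU 1 = 0.
Proof.
have := vapp_leibniz X VU 1 1; rewrite !mulr1 /evenpart /oddpart ginv1 subrr mulr0 mul0r addr0.
rewrite scal_half2 mul1r => E.
by apply: (addrI (X V VU 1)); rewrite addr0 -E.
Qed.

Lemma vapp_const (X : vfield U) V (VU : V `<=` U) (r : R) : X V VU (scal r) = 0.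
Proof. by rewrite -[scal r]mulr1 vapp_scal vapp1 mulr0. Qed.

Lemma vapp_sum (X : vfield U) V (VU : V `<=` U) (J : Type) (r : seq J) (P : pred J) F :
  X V VU (\sum_(j <- r | P j) F j) = \sum_(j <- r | P j) X V VU (F j).
Proof. exact: (big_morph _ (vappD X VU) (vapp0 X VU)). Qed.

Lemma vapp_even_coef (X : vfield U) V (VU : V `<=` U) f g : ginv f = f ->
  X V VU f = 0 -> X V VU (f * g) = f * X V VU g.
Proof.
move=> f0 Xf; rewrite vapp_leibniz Xf mul0r add0r /evenpart /oddpart f0 subrr.
by rewrite mulr0 mul0r addr0 scal_half2.
Qed.

(** Hadamard's lemma works on balls, so each point needs a neighbourhood whose image is exactly a
    ball. *)
Lemma coord_ball V x : V `<=` cdom c -> V x -> exists (W : opens M) (e : R),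
  [/\ 0 < e, W `<=` V, W x & cmap c @` W = ball (cmap c x) e].
Proof.
move=> Vc Vx; have oV : open (cmap c @` V) by exact: cmap_open.
have /nbhs_ballP [e /= e0 eV] : nbhs (cmap c x) (cmap c @` V).
  by apply: open_nbhs_nbhs; split=> //; exists x.
have oW : open ((V : set M) `&` [set z | ball (cmap c x) e (cmap c z)]).
  rewrite openE => z [Vz Bz].
  have nV : nbhs z V by apply: open_nbhs_nbhs; split=> //; exact: osetP.
  have nB : nbhs (cmap c z) (ball (cmap c x) e).
    by apply: open_nbhs_nbhs; split=> //; exact: ball_open.
  exact: filterI nV (cmap_cont (Vc z Vz) nB).
exists (Opens oW), e; split=> //.
- by move=> z [].
- by split=> //; exact: ballxx.
- apply/seteqP; split=> [y [z [_ Bz] <-] //|y By].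
  by have [z Vz zy] := eV y By; exists z; rewrite // /opens_mem /= zy.
Qed.

(* Hadamard's lemma writes f - f(x) as a combination of the x_i - x_i(x), and
   all the components of (x_i - x_i(x)) g vanish at x. *)
Lemma vfield_pure (Y : vfield U) V (VU : V `<=` U) f :
  (forall i, Y U (@subset_refl _ U) (xcoord Uc i) = 0) ->
  pure (subset_trans VU Uc) f -> Y V VU f = 0.
Proof.
move=> Yx pf; set Vc := subset_trans VU Uc in pf *.
apply: (@ccomp_inj _ _ _ _ c V Vc) => I y; rewrite inE => -[x Vx <-].
have [W [e [e0 WV Wx Wb]]] := coord_ball Vc Vx.
pose Wc := subset_trans WV Vc; pose WU := subset_trans WV VU.
have xW := image_mem c Wx.
rewrite -(ccomp_res Vc Wc WV) // -(vapp_res Y VU WU) ccomp0 ?image_mem //.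
have sf : smooth_on (ball (cmap c x) e) (ccomp Wc (sres WV f) finset.set0).
  by rewrite -Wb; exact: ccomp_smooth.
have [g sg fg] := hadamard e0 sf.
have cg i : exists h : sO W, forall I, {in cmap c @` W, ccomp Wc h I =1
    (fun I y => if I == finset.set0 then g i y else 0) I}.
  apply: ccomp_surj => J; case: eqP => _; last by apply: smooth_cst; exact: cmap_open.
  by rewrite Wb.
have [h hE] := choice cg.
pose dx i : sO W := xcoord Wc i - scal (cmap c x 0 i).
have pdx i : pure Wc (dx i).
  by move=> J z zW J0; rewrite ccompB // pure_xcoord // pure_scal // subr0.
have -> : sres WV f = scal (ccomp Wc (sres WV f) finset.set0 (cmap c x)) + \sum_i dx i * h i.
  apply: (@ccomp_inj _ _ _ _ c W Wc) => J z zW.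
  rewrite ccompD // ccomp_sum // ccomp_scal //.
  have E i : ccomp Wc (dx i * h i) J z =
      if J == finset.set0 then (z 0 i - cmap c x 0 i) * g i z else 0.
    rewrite ccomp_pureM // hE // ccompB // ccomp_xcoord // ccomp_scal0 // eqxx.
    by case: eqP; rewrite ?mulr0.
  under eq_bigr do rewrite E.
  case: eqP => [->|/eqP J0]; last by rewrite big1 // addr0 (ccomp_res Vc) // pf // (image_mono WV).
  by apply: fg; rewrite -Wb; exact/set_mem.
rewrite vappD vapp_const add0r vapp_sum ccomp_sum // big1 // => i _.
rewrite vapp_even_coef //.
- rewrite ccomp_pureM // ccompB // ccomp_xcoord // ccomp_scal0 // eqxx.
  by rewrite subrr mul0r.
- by rewrite ginvD ginvN ginv_xcoord ginv_scal.
- rewrite vappD vappN vapp_const subr0.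
  rewrite -(sres_xcoord Uc Wc WU) (vapp_res Y (@subset_refl _ U)).
  by rewrite Yx rmorph0.
Qed.

Definition supported (K : {set 'I_q}) V (Vc : V `<=` cdom c) (f : sO V) :=
  forall (I : {set 'I_q}) y, y \in cmap c @` V -> ~~ (I \subset K) -> ccomp Vc f I y = 0.

(** Induction on the number of odd coordinates that may occur in a function: the decomposition g0 +
    g1 theta_al removes one of them, and functions of the even coordinates alone are handled by
    [vfield_pure]. *)
Lemma vfield_eq0 (Y : vfield U) :
  (forall i, Y U (@subset_refl _ U) (xcoord Uc i) = 0) ->
  (forall al, Y U (@subset_refl _ U) (tcoord Uc al) = 0) -> Y = 0.
Proof.
move=> Yx Yt; apply: vfieldP => V VU f; set Vc := subset_trans VU Uc.
suff H n (K : {set 'I_q}) : #|K| = n -> forall g : sO V, supported K Vc g -> Y V VU g = 0.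
  apply: (H q finset.setT) => [|I y yV]; first by rewrite cardsT card_ord.
  by rewrite finset.subsetT.
elim: n K => [|n IHn] K.
  move=> /cards0_eq -> g sg; apply: vfield_pure => // I y yV I0.
  by apply: sg; rewrite // finset.subset0.
move=> cK g sg; have [al alK] : exists al, al \in K by apply/card_gt0P; rewrite cK.
have cK' : #|(K :\ al)%SET| = n by move: cK; rewrite (cardsD1 al) alK => -[].
have sub1 (I : {set 'I_q}) : ~~ (I \subset (K :\ al)%SET) -> al \notin I -> ~~ (I \subset K).
  move=> IK alI; apply: contra IK => IK; apply/fintype.subsetP => x xI.
  by rewrite !inE (fintype.subsetP IK) // andbT; apply: contraNneq alI => <-.
have [g0 fg0 gE] := free_decomp Vc al g.
set g1 := odd_deriv Vc al g in gE.
have sg1 : supported (K :\ al)%SET Vc g1.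
  move=> I y yV IK; rewrite ccomp_odd_deriv //; case: ifPn => // alI.
  rewrite sg ?mulr0 //; apply: contra (sub1 _ IK alI) => /fintype.subsetP H.
  by apply/fintype.subsetP => x xI; apply: H; rewrite !inE xI orbT.
have sg0 : supported (K :\ al)%SET Vc g0.
  move=> I y yV IK; case: (boolP (al \in I)) => alI; first exact: fg0.
  have := sg I y yV (sub1 _ IK alI); rewrite gE ccompD // ccompM_tcoord // (negbTE alI).
  by rewrite addr0.
have Yt' : Y V VU (tcoord Vc al) = 0.
  rewrite -(sres_tcoord Uc Vc VU) (vapp_res Y (@subset_refl _ U)).
  by rewrite Yt rmorph0.
rewrite gE vappD (IHn _ cK' _ sg0) add0r vapp_leibniz (IHn _ cK' _ sg1) mul0r add0r.
by rewrite ginv_tcoord vappN Yt' oppr0 ginv0 !mulr0 addr0.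
Qed.

Lemma vsum_app (J : finType) (F : J -> vfield U) V (VU : V `<=` U) f :
  (\sum_j F j) V VU f = \sum_j F j V VU f.
Proof. exact: (big_morph (fun X : vfield U => X V VU f)). Qed.

(** Both sides agree on the coordinates, and a derivation that kills these is zero. *)
Lemma vfield_expand (X : vfield U) :
  X = \sum_i X U (@subset_refl _ U) (xcoord Uc i) *: dx_field Uc i +
      \sum_al X U (@subset_refl _ U) (tcoord Uc al) *: dtheta_field Uc al.
Proof.
apply/eqP; rewrite -subr_eq0; apply/eqP; apply: vfield_eq0 => [j|be].
all: rewrite -[LHS]/(X U _ _ + sres _ (-1) * (vapp (_ + _) _ _)) rmorphN1 mulN1r.
all: rewrite -[vapp (_ + _) _ _]/(vapp _ _ _ + vapp _ _ _) !vsum_app /=.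
all: rewrite (_ : subset_trans _ Uc = Uc); last exact: Prop_irrelevance.
- rewrite [X in _ - (_ + X)]big1 => [|al _]; last first.
    by rewrite odd_deriv_xcoord ginv0 mulr0.
  rewrite (bigD1 j) //= big1 => [|i ij]; last first.
    by rewrite even_deriv_xcoord (negbTE ij) mulr0.
  by rewrite even_deriv_xcoord eqxx mulr1 !addr0 sres_id subrr.
- rewrite [X in _ - (X + _)]big1 => [|i _]; last first.
    by rewrite even_deriv_tcoord mulr0.
  rewrite (bigD1 be) //= big1 => [|i ij]; last first.
    by rewrite odd_deriv_tcoord (negbTE ij) ginv0 mulr0.
  by rewrite odd_deriv_tcoord eqxx ginv1 mulr1 addr0 add0r sres_id subrr.
Qed.

(** Applied to a coordinate field of another chart, this is the chain rule. *)
Lemma vapp_expand (X : vfield U) V (VU : V `<=` U) (Vc : V `<=` cdom c) f :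
  X V VU f = \sum_i X V VU (xcoord Vc i) * even_deriv Vc i f +
    \sum_al X V VU (tcoord Vc al) * ginv (odd_deriv Vc al f).
Proof.
rewrite {1}[X]vfield_expand -[LHS]/(vapp _ _ _ + vapp _ _ _) !vsum_app /=.
rewrite (_ : subset_trans _ Uc = Vc); last exact: Prop_irrelevance.
congr (_ + _); apply: eq_bigr => i _; congr (_ * _).
- by rewrite -(vapp_res X _ VU) (sres_xcoord Uc Vc).
- by rewrite -(vapp_res X _ VU) (sres_tcoord Uc Vc).
Qed.

End Expansion.
End CoordinateFields.

(** * The Berezinian *)

Section EvenSubring.
Context {R : realType} {A : superAlgType R}.

Definition even_pred : {pred A} := fun x => ginv x == x.

Lemma even_predP x : reflect (ginv x = x) (x \in even_pred).
Proof. exact: eqP. Qed.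

Lemma even_subring : subring_closed even_pred.
Proof.
split=> [|x y|x y]; first by apply/even_predP; rewrite ginv1.
- by move=> /even_predP x0 /even_predP y0; apply/even_predP; rewrite ginvB x0 y0.
- by move=> /even_predP x0 /even_predP y0; apply/even_predP; rewrite ginvM x0 y0.
Qed.

(** The even elements form a commutative ring; even matrices are lifted to it because
    multiplicativity of the determinant needs commutativity. *)
Record evenA := EvenA { ev :> A; evP : even_pred ev }.
HB.instance Definition _ := [isSub for ev].
HB.instance Definition _ := [Choice of evenA by <:].
HB.instance Definition _ := GRing.SubChoice_isSubPzRing.Build A even_pred evenA even_subring.

Lemma evenA_mulC : commutative (@GRing.mul evenA).
Proof.
move=> x y; apply: val_inj; rewrite !rmorphM; apply: evenC; exact/even_predP/valP.
Qed.
HB.instance Definition _ := GRing.PzRing_hasCommutativeMul.Build evenA evenA_mulC.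

Definition evm m n (D : 'M[A]_(m, n)) := map_mx ginv D = D.
Definition odm m n (D : 'M[A]_(m, n)) := map_mx ginv D = - D.

Lemma evm_lift m n (D : 'M[A]_(m, n)) : evm D -> exists D0 : 'M[evenA]_(m, n), map_mx val D0 = D.
Proof.
move=> D0; have H i j : D i j \in even_pred.
  by apply/even_predP; rewrite -[in RHS]D0 mxE.
exists (\matrix_(i, j) EvenA (H i j)); by apply/matrixP => i j; rewrite !mxE.
Qed.

Lemma det_mulmx_even n (D E : 'M[A]_n) : evm D -> evm E -> \det (D *m E) = \det D * \det E.
Proof.
move=> /evm_lift [D0 <-] /evm_lift [E0 <-].
by rewrite -map_mxM !det_map_mx det_mulmx rmorphM.
Qed.

Lemma det_even n (D : 'M[A]_n) : evm D -> ginv (\det D) = \det D.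
Proof. by move=> D0; rewrite -det_map_mx D0. Qed.

End EvenSubring.

(** The products [B *m T] and [T *m B] are block lower triangular and have the same determinant,
    which gives the two sides. *)
Lemma det1D_col_row (K : comPzRingType) n (u : 'cV[K]_n) (r : 'rV[K]_n) :
  \det (1%:M + u *m r) = 1 + (r *m u) 0 0.
Proof.
pose B := block_mx 1%:M (- u) r (1%:M : 'M[K]_1).
pose T := block_mx 1%:M u 0 (1%:M : 'M[K]_1).
have dT : \det T = 1 by rewrite det_ublock !det1 mulr1.
have : \det (B *m T) = \det (T *m B) by rewrite !det_mulmx mulrC.
rewrite !mulmx_block !mul1mx !mulmx1 !mulmx0 !mul0mx !addr0 !add0r addNr subrr.
rewrite !det_lblock !det1 !mul1r mulr1 => <-.
by rewrite det_mx11 !mxE eqxx addrC.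
Qed.

Section EvenOddMatrices.
Context {R : realType} {A : superAlgType R}.

Lemma evm1 n : evm (1%:M : 'M[A]_n).
Proof. exact: map_mx1. Qed.

Lemma evmD m n (D E : 'M[A]_(m, n)) : evm D -> evm E -> evm (D + E).
Proof. by rewrite /evm map_mxD => -> ->. Qed.

Lemma odmD m n (D E : 'M[A]_(m, n)) : odm D -> odm E -> odm (D + E).
Proof. by rewrite /odm map_mxD => -> ->; rewrite opprD. Qed.

Lemma evmN m n (D : 'M[A]_(m, n)) : evm D -> evm (- D).
Proof. by rewrite /evm map_mxN => ->. Qed.

Lemma odmN m n (D : 'M[A]_(m, n)) : odm D -> odm (- D).
Proof. by rewrite /odm map_mxN => ->. Qed.

Lemma odm0 m n : odm (0 : 'M[A]_(m, n)).
Proof. by rewrite /odm map_mx0 oppr0. Qed.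

Lemma evmM m n k (D : 'M[A]_(m, n)) (E : 'M[A]_(n, k)) : evm D -> evm E -> evm (D *m E).
Proof. by rewrite /evm map_mxM => -> ->. Qed.

Lemma evm_odM m n k (D : 'M[A]_(m, n)) (E : 'M[A]_(n, k)) : odm D -> odm E -> evm (D *m E).
Proof. by rewrite /odm /evm map_mxM => -> ->; rewrite mulmxN mulNmx opprK. Qed.

Lemma odmMl m n k (D : 'M[A]_(m, n)) (E : 'M[A]_(n, k)) : odm D -> evm E -> odm (D *m E).
Proof. by rewrite /odm /evm map_mxM => -> ->; rewrite mulNmx. Qed.

Lemma odmMr m n k (D : 'M[A]_(m, n)) (E : 'M[A]_(n, k)) : evm D -> odm E -> odm (D *m E).
Proof. by rewrite /odm /evm map_mxM => -> ->; rewrite mulmxN. Qed.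

Lemma odm_entry m n (D : 'M[A]_(m, n)) i j : odm D -> ginv (D i j) = - D i j.
Proof. by move=> /matrixP /(_ i j); rewrite !mxE. Qed.

Lemma evm_entry m n (D : 'M[A]_(m, n)) i j : evm D -> ginv (D i j) = D i j.
Proof. by move=> /matrixP /(_ i j); rewrite !mxE. Qed.

Lemma odd_anti (x y : A) : ginv x = - x -> ginv y = - y -> x * y = - (y * x).
Proof. by move=> x1 y1; rewrite oddC // y1 mulNr. Qed.

Lemma odd_sqr (x : A) : ginv x = - x -> x * x = 0.
Proof.
move=> x1; rewrite -(scal_half2 (x * x)) {2}(odd_anti x1 x1).
by rewrite subrr mulr0.
Qed.

Lemma det1_pz n : \det (1%:M : 'M[A]_n) = 1.
Proof. by rewrite -(map_mx1 (val : @evenA R A -> A)) det_map_mx det1 rmorph1. Qed.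

Definition inverses n (D E : 'M[A]_n) := D *m E = 1%:M /\ E *m D = 1%:M.

Lemma inverses_uniq n (D E E' : 'M[A]_n) : inverses D E -> inverses D E' -> E = E'.
Proof. by move=> [_ ED] [DE' _]; rewrite -[E]mulmx1 -DE' mulmxA ED mul1mx. Qed.

Lemma mx_invP n (D E : 'M[A]_n) : inverses D E -> mx_inv D = E.
Proof.
move=> DE; rewrite /mx_inv; case: xgetP => [E' _ DE'|/(_ E)]; last by case.
exact: inverses_uniq DE' DE.
Qed.

Lemma inverses_even n (D E : 'M[A]_n) : evm D -> inverses D E -> evm E.
Proof. by move=> D0 /mx_invP <-; exact: mx_inv_even. Qed.

Lemma inverses1 n : inverses (1%:M : 'M[A]_n) 1%:M.
Proof. by split; rewrite mulmx1. Qed.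

Lemma inversesM n (D E D' E' : 'M[A]_n) : inverses D E -> inverses D' E' ->
  inverses (D *m D') (E' *m E).
Proof.
move=> [DE ED] [DE' ED']; split.
  by rewrite mulmxA -(mulmxA D) DE' mulmx1.
by rewrite mulmxA -(mulmxA E') ED mulmx1.
Qed.

Lemma ring_invP (u v : A) : u * v = 1 -> v * u = 1 -> ring_inv u = v.
Proof.
move=> uv vu; rewrite /ring_inv; case: xgetP => [w _ [uw wu]|/(_ v)]; last by case.
by rewrite -[w]mulr1 -uv mulrA wu mul1r.
Qed.

Lemma ring_inv_det n (D E : 'M[A]_n) : evm D -> inverses D E ->
  ring_inv (\det D) = \det E.
Proof.
move=> D0 DE; have E0 := inverses_even D0 DE; case: DE => DE ED.
apply: ring_invP; rewrite -det_mulmx_even //.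
  by rewrite DE det1_pz.
by rewrite ED det1_pz.
Qed.

Lemma det1D_col_row_even n (u : 'cV[A]_n) (r : 'rV[A]_n) : evm u -> evm r ->
  \det (1%:M + u *m r) = 1 + (r *m u) 0 0.
Proof.
move=> /evm_lift [u0 <-] /evm_lift [r0 <-].
rewrite -!map_mxM -(map_mx1 (val : @evenA R A -> A)) -map_mxD det_map_mx det1D_col_row.
by rewrite rmorphD rmorph1 [in RHS]mxE.
Qed.

End EvenOddMatrices.

Section Berezinian.
Context {R : realType} {A : superAlgType R} {p q : nat}.

Record supermx := SuperMx {
  sA : 'M[A]_p; sB : 'M[A]_(p, q); sC : 'M[A]_(q, p); sD : 'M[A]_q;
  sA_even : evm sA; sB_odd : odm sB; sC_odd : odm sC; sD_even : evm sD }.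

Definition sber (J : supermx) : A := berezinian (sA J) (sB J) (sC J) (sD J).

Lemma sberE (J : supermx) E : inverses (sD J) E ->
  sber J = \det (sA J - sB J *m E *m sC J) * \det E.
Proof.
by move=> DE; rewrite /sber /berezinian (mx_invP DE) (ring_inv_det (sD_even J) DE).
Qed.

Lemma supermx_mul_even (J K : supermx) : evm (sA J *m sA K + sB J *m sC K).
Proof.
apply: evmD; first exact: evmM (sA_even J) (sA_even K).
exact: evm_odM (sB_odd J) (sC_odd K).
Qed.
Lemma supermx_mulB (J K : supermx) : odm (sA J *m sB K + sB J *m sD K).
Proof.
apply: odmD; first exact: odmMr (sA_even J) (sB_odd K).
exact: odmMl (sB_odd J) (sD_even K).
Qed.
Lemma supermx_mulC (J K : supermx) : odm (sC J *m sA K + sD J *m sC K).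
Proof.
apply: odmD; first exact: odmMl (sC_odd J) (sA_even K).
exact: odmMr (sD_even J) (sC_odd K).
Qed.
Lemma supermx_mulD (J K : supermx) : evm (sC J *m sB K + sD J *m sD K).
Proof.
apply: evmD; first exact: evm_odM (sC_odd J) (sB_odd K).
exact: evmM (sD_even J) (sD_even K).
Qed.
Definition smul (J K : supermx) : supermx := SuperMx (supermx_mul_even J K)
  (supermx_mulB J K) (supermx_mulC J K) (supermx_mulD J K).

Lemma supermxP (J K : supermx) : sA J = sA K -> sB J = sB K -> sC J = sC K ->
  sD J = sD K -> J = K.
Proof.
case: J K => [a b c d ? ? ? ?] [a' b' c' d' ? ? ? ?] /= *; subst.
by congr SuperMx; exact: Prop_irrelevance.
Qed.

Lemma smulA : associative smul.
Proof.
move=> J K L; apply: supermxP; rewrite /= !mulmxDr !mulmxDl !mulmxA addrACA //.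
Qed.

Definition supper (X : 'M[A]_(p, q)) (oX : odm X) : supermx :=
  SuperMx (evm1 p) oX (odm0 q p) (evm1 q).
Definition slower (Y : 'M[A]_(q, p)) (oY : odm Y) : supermx :=
  SuperMx (evm1 p) (odm0 p q) oY (evm1 q).
Definition sdiag (E : 'M[A]_p) (D : 'M[A]_q) (E0 : evm E) (D0 : evm D) : supermx :=
  SuperMx E0 (odm0 p q) (odm0 q p) D0.

(** The Schur complement does not change: the terms X C and X D D^-1 C cancel. *)
Lemma sber_upper (X : 'M[A]_(p, q)) (oX : odm X) (J : supermx) E : inverses (sD J) E ->
  sber (smul (supper oX) J) = sber J.
Proof.
move=> DE; rewrite (sberE DE).
have DE' : inverses (sD (smul (supper oX) J)) E by rewrite /= mul0mx add0r mul1mx.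
rewrite (sberE DE') /= !mul0mx !add0r !mul1mx; congr (\det _ * _).
rewrite !mulmxDl -(mulmxA X (sD J)) DE.1 mulmx1.
by rewrite opprD addrACA subrr addr0.
Qed.

Lemma sber_diag (E : 'M[A]_p) (D D' : 'M[A]_q) (E0 : evm E) (D0 : evm D) (J : supermx) F :
  inverses D D' -> inverses (sD J) F ->
  sber (smul (sdiag E0 D0) J) = \det E * \det D' * sber J.
Proof.
move=> DD' JF; have D'0 := inverses_even D0 DD'; have F0 := inverses_even (sD_even J) JF.
have I : inverses (sD (smul (sdiag E0 D0) J)) (F *m D').
  by rewrite /= mul0mx add0r; exact: inversesM.
rewrite (sberE I) (sberE JF) /= !mul0mx !add0r !addr0.
have S0 : evm (sA J - sB J *m F *m sC J).
  apply: evmD; first exact: sA_even.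
  apply/evmN/evm_odM; last exact: sC_odd.
  exact: odmMl (sB_odd J) F0.
have -> : E *m sA J - E *m sB J *m (F *m D') *m (D *m sC J) =
    E *m (sA J - sB J *m F *m sC J).
  rewrite mulmxBr !mulmxA -(mulmxA _ D' D) DD'.2 mulmx1.
  by rewrite -!mulmxA.
rewrite !det_mulmx_even // mulrA -!mulrA; congr (_ * _).
by rewrite mulrA; apply/esym/evenC; exact: det_even.
Qed.

(* As y y = 0, both determinants are of rank one perturbations of the identity. *)
Lemma sber_elementary (y : A) (al : 'I_q) (j : 'I_p) (oy : ginv y = - y)
    (oY : odm (y *: delta_mx al j : 'M[A]_(q, p))) (J : supermx) E :
  inverses (sD J) E ->
  (exists E', inverses (sD (smul (slower oY) J)) E') /\
  sber (smul (slower oY) J) = sber J.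
Proof.
move=> DE; set Z : 'M[A]_(q, p) := y *: delta_mx al j in oY *.
have E0 := inverses_even (sD_even J) DE.
pose X := sB J *m E; have oX : odm X by exact: odmMl (sB_odd J) E0.
have ZE : Z = (delta_mx al 0 : 'cV[A]_q) *m (y *: (delta_mx 0 j : 'rV[A]_p)).
  by apply/matrixP => k l; rewrite !mxE big_ord1 !mxE; case: (k == al); case: (l == j);
    rewrite ?(mul1r, mul0r, mulr0, mulr1).
have yXy : (y *: (delta_mx 0 j : 'rV[A]_p)) *m X *m Z = 0.
  apply/matrixP => k l; rewrite !mxE (bigD1 al) //= big1 => [|i ial]; last first.
    by rewrite [Z _ _]mxE [delta_mx _ _ _ _]mxE (negbTE ial) /= !mulr0.
  rewrite addr0 mxE (bigD1 j) //= big1 => [|i ij]; last first.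
    by rewrite [X in X * _]mxE [delta_mx _ _ _ _]mxE (negbTE ij) andbF mulr0 mul0r.
  rewrite addr0 [X in X * _ * _]mxE [Z _ _]mxE ![delta_mx _ _ _ _]mxE !eqxx (ord1 k) eqxx mulr1.
  rewrite mulrA (odd_anti oy (odm_entry _ _ oX)) -!mulrA mulNr.
  by rewrite -mulrA [y * (y * _)]mulrA odd_sqr // mul0r mulr0 oppr0.
have ZXZ : Z *m X *m Z = 0.
  by rewrite {1}ZE -(mulmxA (delta_mx al 0)) -mulmxA yXy mulmx0.
have DF : inverses (1%:M + Z *m X) (1%:M - Z *m X).
  have N : Z *m X *m (Z *m X) = 0 by rewrite mulmxA ZXZ mul0mx.
  split; rewrite !mulmxDl !mulmxDr !mulmx1 !mul1mx ?mulmxN ?mulNmx N oppr0 addr0.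
    by rewrite -addrA addNr addr0.
  by rewrite -addrA subrr addr0.
have sDE : sD (smul (slower oY) J) = (1%:M + Z *m X) *m sD J.
  by rewrite /= mulmxDl mul1mx addrC -!mulmxA DE.2 mulmx1.
have DE' := inversesM DF DE; rewrite -sDE in DE'; split; first by exists (E *m (1%:M - Z *m X)).
rewrite (sberE DE') (sberE DE) /= !mul0mx !mul1mx !addr0.
have -> : sA J - sB J *m (E *m (1%:M - Z *m X)) *m (Z *m sA J + sC J) =
    (1%:M - X *m Z) *m (sA J - X *m sC J).
  have z : X *m (Z *m X) *m (Z *m sA J) = 0.
    transitivity (X *m (Z *m X *m Z) *m sA J); first by rewrite !mulmxA.
    by rewrite ZXZ mulmx0 mul0mx.
  rewrite [sB J *m _]mulmxA -/X mulmxBr mulmx1 mulmxDr !mulmxBl z subr0 mul1mx.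
  rewrite !mulmxBr !mulmxA !opprD !opprK -!addrA; congr (_ + _); exact: addrCA.
rewrite -[sB J *m E]/X.
have S0 : evm (sA J - X *m sC J).
  by apply: evmD; [exact: sA_even|exact/evmN/(evm_odM oX)/sC_odd].
clearbody X; have Xo := odm_entry j al oX; set x := X j al in Xo.
have eX k : ginv (X k al * y) = X k al * y by rewrite ginvM (odm_entry _ _ oX) oy mulrNN.
pose u : 'cV[A]_p := \col_k (- (X k al * y)).
pose r : 'rV[A]_q := - (y *: row j X).
have u0 : evm u by apply/matrixP => k l; rewrite !mxE ginvN eX.
have r0 : evm r.
  by apply/matrixP => k l; rewrite !mxE ginvN ginvM oy (odm_entry _ _ oX) mulrNN.
have d0 m n a b : evm (delta_mx a b : 'M[A]_(m, n)).
  by apply/matrixP => k l; rewrite !mxE; case: (_ && _); rewrite ?ginv1 ?ginv0.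
have -> : 1%:M - X *m Z = 1%:M + u *m delta_mx 0 j.
  congr (_ + _); apply/matrixP => k l; rewrite mxE mxE [RHS]mxE big_ord1 (bigD1 al) //=.
  rewrite big1 => [|i ial]; last by rewrite [Z _ _]mxE [delta_mx _ _ _ _]mxE (negbTE ial) !mulr0.
  rewrite addr0 [Z _ _]mxE [u _ _]mxE ![delta_mx _ _ _ _]mxE !eqxx /=.
  by rewrite mulNr mulrA.
have -> : 1%:M - Z *m X = 1%:M + delta_mx al 0 *m r.
  by rewrite ZE -mulmxA -scalemxAl -rowE -mulmxN.
have e1 : evm (1%:M + u *m delta_mx 0 j) by apply: evmD; [exact: evm1|exact: evmM].
have e2 : evm (1%:M + delta_mx al 0 *m r) by apply: evmD; [exact: evm1|exact: evmM].
rewrite !det_mulmx_even // !det1D_col_row_even // -rowE -colE !mxE -/x.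
set d := \det _; set d' := \det _.
have xy : x * y * (x * y) = 0.
  by rewrite mulrA -(mulrA x y x) (odd_anti oy Xo) mulrN mulrA odd_sqr // mul0r oppr0 mul0r.
rewrite (odd_anti oy Xo) opprK mulrA; set Q := 1 + x * y.
have Q0 : ginv Q = Q by rewrite ginvD ginv1 ginvM Xo oy mulrNN.
have QP : Q * (1 - x * y) = 1.
  by rewrite /Q mulrDl mul1r mulrBr mulr1 xy subr0 subrK.
by rewrite -(evenC _ Q0) -!mulrA [Q * _]mulrA QP mul1r.
Qed.

(** A predicate on all matrices, so that it can be propagated along the decomposition of [Y] into
    elementary ones. Invertibility of the lower right block is carried along because the next factor
    needs it. *)
Definition lower_good (Y : 'M[A]_(q, p)) := exists oY : odm Y, forall J E,
  inverses (sD J) E ->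
  (exists E', inverses (sD (smul (slower oY) J)) E') /\
  sber (smul (slower oY) J) = sber J.

Lemma lower_good0 : lower_good 0.
Proof.
exists (odm0 q p) => J E DE; have -> : smul (slower (odm0 q p)) J = J.
  by apply: supermxP; rewrite /= !(mul1mx, mul0mx, addr0, add0r).
by split=> //; exists E.
Qed.

Lemma lower_goodD Y Y' : lower_good Y -> lower_good Y' -> lower_good (Y + Y').
Proof.
move=> [oY gY] [oY' gY']; exists (odmD oY oY') => J E DE.
have [[E' DE'] b'] := gY' J E DE; have [DE'' b''] := gY _ _ DE'.
have -> : smul (slower (odmD oY oY')) J = smul (slower oY) (smul (slower oY') J).
  by apply: supermxP;
    rewrite /= !(mul1mx, mul0mx, addr0, add0r) // mulmxDl addrA.
by split=> //; rewrite b'' b'.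
Qed.

(** Lower unipotent matrices multiply by adding their lower left blocks, which reduces the claim to
    [sber_elementary]. *)
Lemma sber_lower (Y : 'M[A]_(q, p)) (oY : odm Y) (J : supermx) E : inverses (sD J) E ->
  (exists E', inverses (sD (smul (slower oY) J)) E') /\
  sber (smul (slower oY) J) = sber J.
Proof.
have [oY' H] : lower_good Y.
  rewrite [Y]matrix_sum_delta.
  apply: (big_ind lower_good lower_good0 lower_goodD) => al _.
  apply: (big_ind lower_good lower_good0 lower_goodD) => j _.
  have oy := odm_entry al j oY.
  have oYe : odm (Y al j *: delta_mx al j : 'M[A]_(q, p)).
    apply/matrixP => k l; rewrite !mxE ginvM oy; case: (_ && _).
      by rewrite ginv1 mulNr.
    by rewrite ginv0 !mulr0 oppr0.
  by exists oYe => K F; apply: sber_elementary.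
by rewrite (Prop_irrelevance oY oY'); apply: H.
Qed.

(** Gaussian elimination: as its lower right block is invertible, [J] is the product of an upper
    unipotent, a block diagonal and a lower unipotent matrix, and each of them can be split off on
    the left. *)
Lemma sberM (J K : supermx) E F : inverses (sD J) E -> inverses (sD K) F ->
  sber (smul J K) = sber J * sber K.
Proof.
move=> DE DF; have E0 := inverses_even (sD_even J) DE.
have oX : odm (sB J *m E) by exact: odmMl (sB_odd J) E0.
have oY : odm (E *m sC J) by exact: odmMr E0 (sC_odd J).
have S0 : evm (sA J - sB J *m E *m sC J).
  by apply: evmD; [exact: sA_even|exact/evmN/(evm_odM oX)/sC_odd].
have [[G DG] bG] := sber_lower oY DF.
have -> : smul J K = smul (supper oX) (smul (sdiag S0 (sD_even J)) (smul (slower oY) K)).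
  rewrite !smulA; congr (smul _ K).
  apply: supermxP; rewrite /= !(mul1mx, mul0mx, addr0, add0r, mulmx1, mulmx0) //.
  - by rewrite !mulmxA -(mulmxA (sB J) E (sD J)) DE.2 mulmx1 subrK.
  - by rewrite -mulmxA DE.2 mulmx1.
  - by rewrite mulmxA DE.1 mul1mx.
have DI : inverses (sD (smul (sdiag S0 (sD_even J)) (smul (slower oY) K))) (G *m E).
  by rewrite /= mul0mx add0r; apply: inversesM DE DG.
by rewrite (sber_upper oX DI) (sber_diag S0 (sD_even J) DE DG) bG (sberE DE).
Qed.

(** D_K D_J = 1 - C_K B_J is the lower right block of a lower unipotent times an upper unipotent
    matrix, hence invertible by [sber_lower]; so is D_J D_K. This gives D_J a left and a right
    inverse. *)
Lemma supermx_inverses (J K : supermx) : sC K *m sB J + sD K *m sD J = 1%:M ->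
  sC J *m sB K + sD J *m sD K = 1%:M -> exists E, inverses (sD J) E.
Proof.
have key (L L' : supermx) : sC L *m sB L' + sD L *m sD L' = 1%:M ->
    exists E, inverses (sD L *m sD L') E.
  move=> LL'; pose N := SuperMx (evm1 p) (sB_odd L') (odm0 q p) (evm1 q).
  have oY := odmN (sC_odd L).
  have [[E DE] _] := @sber_lower _ oY N _ (inverses1 q); exists E; move: DE => /=.
  by rewrite mul1mx mulNmx -LL' addKr.
move=> KJ JK; have [E [_ E1]] := key _ _ KJ; have [F [F1 _]] := key _ _ JK.
exists (sD K *m F); split; first by rewrite mulmxA.
have -> : sD K *m F = E *m sD K.
  rewrite -[E *m _]mulmx1 -F1 !mulmxA -(mulmxA E _ (sD J)).
  by rewrite E1 mul1mx.
by rewrite -mulmxA E1.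
Qed.

End Berezinian.

(** [mx_inv] and [ring_inv] are choices, and a morphism respects them once the inverses exist: hence
    the hypothesis on [sD J]. *)
Lemma sber_map (R : realType) (A A' : superAlgType R) (phi : {rmorphism A -> A'}) p q
    (J : @supermx R A p q) (J' : @supermx R A' p q) E :
  sA J' = map_mx phi (sA J) -> sB J' = map_mx phi (sB J) ->
  sC J' = map_mx phi (sC J) -> sD J' = map_mx phi (sD J) ->
  inverses (sD J) E -> sber J' = phi (sber J).
Proof.
move=> EA EB EC ED DE.
have DE' : inverses (sD J') (map_mx phi E).
  by rewrite ED; split; rewrite -map_mxM ?DE.1 ?DE.2 map_mx1.
rewrite (sberE DE) (sberE DE') EA EB EC rmorphM -!det_map_mx.
by rewrite map_mxB !map_mxM.
Qed.

(** * Substitution in delta forms *)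

Section DeltaFormOperators.
Context {R : realType} {A : superAlgType R} {p q : nat}.
Local Notation W := (@dform R A p q).
Implicit Types (w : W) (f g : A) (e : {set 'I_p}) (l : {ffun 'I_q -> nat}).

Lemma dformP w w' : (forall e l, w e l = w' e l) -> w = w'.
Proof.
by move=> ww'; apply/funext => e; apply/funext => l; exact: ww'.
Qed.

Lemma dformD w w' e l : (w + w') e l = w e l + w' e l. Proof. by []. Qed.
Lemma dformN w e l : (- w) e l = - w e l. Proof. by []. Qed.
Lemma dform0 e l : (0 : W) e l = 0. Proof. by []. Qed.

Lemma dform_sum (J : Type) (r : seq J) (P : pred J) (F : J -> W) e l :
  (\sum_(j <- r | P j) F j) e l = \sum_(j <- r | P j) F j e l.
Proof. by elim/big_rec2: _ => [|j x y _ <-]. Qed.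

Lemma dformMn w n e l : (w *+ n) e l = w e l *+ n.
Proof. by elim: n => [|n IHn]; rewrite ?mulr0n // !mulrS -IHn. Qed.

Definition lsc f w : W := fun e l => f * w e l.

Lemma lscA f g w : lsc f (lsc g w) = lsc (f * g) w.
Proof. by apply: dformP => e l; rewrite /lsc mulrA. Qed.
Lemma lsc1 w : lsc 1 w = w.
Proof. by apply: dformP => e l; rewrite /lsc mul1r. Qed.
Lemma lscN1 w : lsc (-1) w = - w.
Proof. by apply: dformP => e l; rewrite /lsc mulN1r. Qed.
Lemma lscNl f w : lsc (- f) w = - lsc f w.
Proof. by apply: dformP => e l; rewrite /lsc mulNr. Qed.
Lemma lscDr f : {morph lsc f : w w' / w + w'}.
Proof. by move=> w w'; apply: dformP => e l; rewrite /lsc mulrDr. Qed.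
Lemma lscDl f g w : lsc (f + g) w = lsc f w + lsc g w.
Proof. by apply: dformP => e l; rewrite /lsc mulrDl. Qed.
Lemma lsc_suml (J : Type) (r : seq J) (P : pred J) (F : J -> A) w :
  lsc (\sum_(j <- r | P j) F j) w = \sum_(j <- r | P j) lsc (F j) w.
Proof. by apply: dformP => e l; rewrite dform_sum /lsc big_distrl. Qed.
Lemma lsc0l w : lsc 0 w = 0.
Proof. by apply: dformP => e l; rewrite /lsc mul0r. Qed.

Definition addop (O : W -> W) := {morph O : w w' / w + w'}.

Section Additive.
Variable O : W -> W.
Hypothesis addO : addop O.
Lemma addop0 : O 0 = 0.
Proof. by apply: (addrI (O 0)); rewrite -addO !addr0. Qed.
Lemma addopN w : O (- w) = - O w.
Proof. by apply: (addrI (O w)); rewrite -addO !subrr addop0. Qed.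
Lemma addop_sum (J : Type) (r : seq J) (P : pred J) (F : J -> W) :
  O (\sum_(j <- r | P j) F j) = \sum_(j <- r | P j) O (F j).
Proof. exact: (big_morph _ addO addop0). Qed.
Lemma addopMn w n : O (w *+ n) = O w *+ n.
Proof. by elim: n => [|n IHn]; rewrite ?addop0 // !mulrS addO IHn. Qed.
End Additive.

Lemma lsc_add f : addop (lsc f). Proof. exact: lscDr. Qed.
Lemma lsc0r f : lsc f 0 = 0. Proof. exact: addop0 (lsc_add f). Qed.
Lemma lscNr f w : lsc f (- w) = - lsc f w. Proof. exact: addopN (lsc_add f) w. Qed.
Lemma lsc_sumr f (J : Type) (r : seq J) (P : pred J) (F : J -> W) :
  lsc f (\sum_(j <- r | P j) F j) = \sum_(j <- r | P j) lsc f (F j).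
Proof. by rewrite (addop_sum (lsc_add f)). Qed.

(** The left contraction d/d(dx_k): an odd operator, hence the [ginv] on the coefficient that it
    passes. *)
Definition dx_con (k : 'I_p) w : W := fun e l =>
  if k \in e then 0 else (-1) ^+ #|[pred i in e | (i < k)%N]| * ginv (w (k |: e)%SET l).

Lemma dx_mul_add j : addop (dx_mul j).
Proof.
by move=> w w'; apply: dformP => e l; rewrite [RHS]dformD /dx_mul; case: ifP => _;
  rewrite ?addr0 // dformD ginvD mulrDr.
Qed.
Lemma dtheta_mul_add be : addop (dtheta_mul be).
Proof.
by move=> w w'; apply: dformP => e l; rewrite /dtheta_mul !dformD mulrDr opprD.
Qed.
Lemma ddtheta_add be : addop (ddtheta be).
Proof.
by move=> w w'; apply: dformP => e l; rewrite [RHS]dformD /ddtheta; case: ifP;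
  rewrite ?addr0.
Qed.
Lemma dx_con_add k : addop (dx_con k).
Proof.
by move=> w w'; apply: dformP => e l; rewrite [RHS]dformD /dx_con; case: ifP => _;
  rewrite ?addr0 // dformD ginvD mulrDr.
Qed.

Lemma sign_comm n f : (-1) ^+ n * f = f * (-1) ^+ n.
Proof. exact/esym/commr_sign. Qed.

Lemma ginv_sign n f : ginv ((-1) ^+ n * f) = (-1) ^+ n * ginv f.
Proof. by rewrite rmorphMsign. Qed.

Lemma dx_mul_lsc j f w : dx_mul j (lsc f w) = lsc (ginv f) (dx_mul j w).
Proof.
apply: dformP => e l; rewrite /dx_mul /lsc; case: ifP => _; last by rewrite mulr0.
by rewrite ginvM !mulrA sign_comm.
Qed.
Lemma dx_con_lsc j f w : dx_con j (lsc f w) = lsc (ginv f) (dx_con j w).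
Proof.
apply: dformP => e l; rewrite /dx_con /lsc; case: ifP => _; first by rewrite mulr0.
by rewrite ginvM !mulrA sign_comm.
Qed.
Lemma natr_even n : ginv (n%:R : A) = n%:R.
Proof. by elim: n => [|n IHn]; rewrite ?ginv0 // -[n.+1]addn1 natrD ginvD IHn ginv1. Qed.

Lemma dtheta_mul_lsc be f w : dtheta_mul be (lsc f w) = lsc f (dtheta_mul be w).
Proof.
apply: dformP => e l; rewrite /dtheta_mul /lsc mulrN mulrA.
by rewrite (evenC f (natr_even _)) mulrA.
Qed.
Lemma ddtheta_lsc be f w : ddtheta be (lsc f w) = lsc f (ddtheta be w).
Proof. by apply: dformP => e l; rewrite /ddtheta /lsc; case: ifP => // _; rewrite mulr0. Qed.

Lemma card_below_D1 e (i j : 'I_p) : i \in e ->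
  #|[pred x in e | (x < j)%N]| = ((i < j) + #|[pred x in (e :\ i)%SET | (x < j)%N]|)%N.
Proof.
move=> ie; rewrite (cardD1 i) inE ie /=; congr (_ + _)%N; apply: eq_card => x.
by rewrite !inE andbA.
Qed.

Lemma card_below_U1 e (i j : 'I_p) : i \notin e ->
  #|[pred x in (i |: e)%SET | (x < j)%N]| = ((i < j) + #|[pred x in e | (x < j)%N]|)%N.
Proof.
move=> ie; rewrite (@card_below_D1 (i |: e)%SET i) ?finset.setU11 // finset.setU1K //.
Qed.

Lemma dx_mul_anti i j w : dx_mul i (dx_mul j w) = - dx_mul j (dx_mul i w).
Proof.
apply: dformP => e l; rewrite dformN /dx_mul !inE.
case: (i =P j) => [->|/eqP ij].
  by case: ifP; rewrite ?eqxx /= ?ginv0 ?mulr0 ?oppr0.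
rewrite (eq_sym j i) ij /=.
case: (boolP (i \in e)) => ie; case: (boolP (j \in e)) => je; rewrite /= ?ginv0 ?mulr0 ?oppr0 //.
rewrite !ginv_sign !ginvK !mulrA -!exprD.
rewrite (@card_below_D1 e j i) // (@card_below_D1 e i j) //.
have -> : (e :\ i :\ j = e :\ j :\ i)%SET by rewrite finset.setDDl finset.setUC -finset.setDDl.
rewrite -mulNr; congr (_ * _).
have : (i < j)%N = ~~ (j < i)%N by rewrite -leqNgt [RHS]leq_eqVlt (negbTE (ij : (i != j :> nat))).
move=> ->; rewrite -(signr_odd _ (_ + _)) -[in RHS](signr_odd _ (_ + _)).
rewrite !oddD !oddb; case: (j < i)%N => /=; case: (odd _); case: (odd _);
  rewrite //= ?expr0 ?expr1 ?opprK //.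
Qed.

Lemma dx_con_mul k j w : dx_con k (dx_mul j w) =
  (if k == j then w else 0) - dx_mul j (dx_con k w).
Proof.
apply: dformP => e l; rewrite dformD dformN /dx_con /dx_mul !inE.
case: (k =P j) => [->|/eqP kj].
  rewrite eqxx /=; case: (boolP (j \in e)) => je.
    rewrite finset.setD1K // ginv_sign ginvK mulrA -exprD.
    rewrite (_ : #|[pred i in (e :\ j)%SET | _]| = #|[pred i in e | (i < j)%N]|).
      by rewrite -signr_odd oddD addbb mul1r subrr.
    by rewrite (@card_below_D1 e j) // ltnn.
  rewrite finset.setU1K // ginv_sign ginvK mulrA -exprD.
  rewrite (_ : #|[pred i in (j |: e)%SET | _]| = #|[pred i in e | (i < j)%N]|).
    by rewrite -signr_odd oddD addbb mul1r subr0.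
  by rewrite (@card_below_U1 e j) // ltnn.
rewrite dform0 add0r (eq_sym j k) (negbTE kj) /=.
case: (boolP (k \in e)) => ke; case: (boolP (j \in e)) => je; rewrite /= ?ginv0 ?mulr0 ?oppr0 //.
rewrite !ginv_sign !ginvK !mulrA -!exprD.
rewrite (@card_below_D1 e j k) // (@card_below_U1 e k j) //.
have -> : ((k |: e) :\ j = k |: (e :\ j))%SET.
  apply/setP => x; rewrite !inE; case: (x =P k) => //= ->; by rewrite kj.
rewrite -mulNr; congr (_ * _).
have : (k < j)%N = ~~ (j < k)%N by rewrite -leqNgt [RHS]leq_eqVlt (negbTE (kj : (k != j :> nat))).
move=> ->; rewrite -(signr_odd _ (_ + _)) -[in RHS](signr_odd _ (_ + _)).
rewrite !oddD !oddb; case: (j < k)%N => /=; case: (odd _); case: (odd _);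
  rewrite //= ?expr0 ?expr1 ?opprK //.
Qed.

Lemma dx_mul_dtheta j be w : dx_mul j (dtheta_mul be w) = dtheta_mul be (dx_mul j w).
Proof.
apply: dformP => e l; rewrite /dx_mul /dtheta_mul; case: ifP => _; last by rewrite mulr0 oppr0.
by rewrite ginvN ginvM natr_even mulrN !mulrA sign_comm.
Qed.
Lemma dx_mul_ddtheta j be w : dx_mul j (ddtheta be w) = ddtheta be (dx_mul j w).
Proof.
apply: dformP => e l; rewrite /dx_mul /ddtheta; case: ifP => _; case: ifP => _ //.
by rewrite ginv0 mulr0.
Qed.
Lemma dx_con_dtheta j be w : dx_con j (dtheta_mul be w) = dtheta_mul be (dx_con j w).
Proof.
apply: dformP => e l; rewrite /dx_con /dtheta_mul; case: ifP => _; first by rewrite mulr0 oppr0.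
by rewrite ginvN ginvM natr_even mulrN !mulrA sign_comm.
Qed.
Lemma dx_con_ddtheta j be w : dx_con j (ddtheta be w) = ddtheta be (dx_con j w).
Proof.
apply: dformP => e l; rewrite /dx_con /ddtheta; case: ifP => _; case: ifP => _ //.
by rewrite ginv0 mulr0.
Qed.

Lemma decrC l al be : decr (decr l al) be = decr (decr l be) al.
Proof. by apply/ffunP => x; rewrite !ffunE subnAC. Qed.
Lemma incrK l al : decr (incr l al) al = l.
Proof. by apply/ffunP => x; rewrite !ffunE addnK. Qed.
Lemma decrK l al : l al != 0%N -> incr (decr l al) al = l.
Proof.
move=> l0; apply/ffunP => x; rewrite !ffunE; case: (x =P al) => [->|_].
  by rewrite subnK // lt0n.
by rewrite subn0 addn0.
Qed.

Lemma ddthetaC al be w : ddtheta al (ddtheta be w) = ddtheta be (ddtheta al w).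
Proof.
apply: dformP => e l; rewrite /ddtheta !ffunE decrC.
case: (al =P be) => [->|/eqP ab]; first by rewrite eqxx.
rewrite (eq_sym be) (negbTE ab) !subn0.
by case: (l al == 0%N); case: (l be == 0%N).
Qed.

Lemma ddtheta_mul al be w : ddtheta al (dtheta_mul be w) =
  dtheta_mul be (ddtheta al w) + (if al == be then w else 0).
Proof.
apply: dformP => e l; rewrite dformD /ddtheta /dtheta_mul.
case: (al =P be) => [->|/eqP ab]; last first.
  rewrite dform0 addr0 !ffunE (negbTE ab) addn0 (eq_sym be) (negbTE ab) subn0.
  case: ifP => // _; first by rewrite mulr0 oppr0.
  congr (- (_ * w e _)); apply/ffunP => x; rewrite !ffunE.
  case: (x =P al) => [->|_]; first by rewrite (negbTE ab) !addn0.
  by rewrite !subn0.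
rewrite !ffunE eqxx addn1 /= incrK.
case: eqP => [->|/eqP l0]; first by rewrite mul1r addNr.
by rewrite decrK // subn1 prednK ?lt0n // -addn1 natrD mulrDl mul1r opprD subrK.
Qed.

End DeltaFormOperators.

(** * Products of commuting and of anticommuting operators *)

Section IteratedOperators.
Context {R : realType} {A : superAlgType R} {p q : nat}.
Local Notation W := (@dform R A p q).
Implicit Types (w : W) (f g : A) (e : {set 'I_p}) (l : {ffun 'I_q -> nat}).

Section Iter.
Variables (n : nat) (op : 'I_n -> W -> W).
Implicit Types (m : 'I_n -> nat).

Lemma iter_all0 w : iter_all op (fun _ => 0%N) w = w.
Proof. by rewrite /iter_all; elim: (enum _). Qed.

Definition incr_at m i : 'I_n -> nat := fun k => (m k + (k == i))%N.
Definition decr_at m i : 'I_n -> nat := fun k => (m k - (k == i))%N.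

Lemma decr_atK m i : m i != 0%N -> incr_at (decr_at m i) i = m.
Proof.
move=> mi; apply/funext => k; rewrite /incr_at /decr_at.
by case: (k =P i) => [->|_]; rewrite ?subn0 ?addn0 // subnK // lt0n.
Qed.

Lemma incr_atK m i : decr_at (incr_at m i) i = m.
Proof. by apply/funext => k; rewrite /incr_at /decr_at addnK. Qed.

Hypothesis opC : forall i j w, op i (op j w) = op j (op i w).

Lemma iter_comm i j k w : op i (iter k (op j) w) = iter k (op j) (op i w).
Proof. by elim: k => //= k IHk; rewrite opC IHk. Qed.

Lemma iter_all_incr m i w : op i (iter_all op m w) = iter_all op (incr_at m i) w.
Proof.
rewrite /iter_all; have : i \in enum 'I_n by rewrite mem_enum.
elim: (enum 'I_n) (enum_uniq 'I_n) => //= j s IHs /andP [js us].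
rewrite inE => /orP [/eqP E|si].
  subst j; have -> : incr_at m i i = (m i).+1 by rewrite /incr_at eqxx addn1.
  rewrite /=; congr (op i (iter (m i) (op i) _)).
  elim: s js {IHs us} => //= k s IHs; rewrite inE negb_or => /andP [ik si].
  have -> : incr_at m i k = m k by rewrite /incr_at eq_sym (negbTE ik) addn0.
  by rewrite IHs.
rewrite iter_comm IHs // /incr_at; case: (j =P i) js => [->|_ _]; first by rewrite si.
by rewrite addn0.
Qed.

Lemma iter_all_ind (P : ('I_n -> nat) -> Prop) : P (fun _ => 0%N) ->
  (forall m i, P m -> P (incr_at m i)) -> forall m, P m.
Proof.
move=> P0 PS m; have [k] := ubnP (\sum_i m i); elim: k m => // k IHk m.
case: (pickP (fun i => m i != 0%N)) => [i mi|m0] mk.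
  rewrite -(decr_atK mi); apply/PS/IHk.
  rewrite -ltnS (leq_trans _ mk) // ltnS.
  rewrite [X in (_ < X)%N](bigD1 i) //= (bigD1 i) //= /decr_at eqxx subn1.
  rewrite -addSn prednK ?lt0n // leq_add2l; apply: leq_sum => j ji.
  by rewrite leq_subr.
rewrite (_ : m = fun _ => 0%N) //; apply/funext => i; apply/eqP.
by have /negbFE := m0 i.
Qed.

Lemma iter_all_comm (O : W -> W) m w : (forall i w, O (op i w) = op i (O w)) ->
  O (iter_all op m w) = iter_all op m (O w).
Proof.
move=> C; elim/iter_all_ind: m => [|m i IHm]; first by rewrite !iter_all0.
by rewrite -!iter_all_incr C IHm.
Qed.

Hypothesis op_add : forall i, addop (op i).

(** The commutator with [O] acts as a derivation on products of the [op i]: this is (x^m)' = m x^(m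
    - 1), with [K i] as the derivative of [op i]. *)
Lemma iter_all_leibniz (O : W -> W) (K : 'I_n -> W -> W) m w : addop O ->
  (forall i, addop (K i)) ->
  (forall i j w, K i (op j w) = op j (K i w)) ->
  (forall i w, O (op i w) = op i (O w) + K i w) ->
  O (iter_all op m w) = iter_all op m (O w) +
    \sum_i K i (iter_all op (decr_at m i) w) *+ m i.
Proof.
move=> Oadd Kadd KC OC; elim/iter_all_ind: m => [|m i IHm].
  by rewrite !iter_all0 big1 ?addr0 // => i _; rewrite mulr0n.
rewrite -!iter_all_incr OC IHm op_add -addrA; congr (_ + _).
rewrite (addop_sum (op_add i)) (bigD1 i) //= [in RHS](bigD1 i) //=.
have -> : incr_at m i i = (m i).+1 by rewrite /incr_at eqxx addn1.
rewrite incr_atK mulrS addrC addrA; congr (_ + _).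
  congr (_ + _); rewrite (addopMn (op_add i)).
  case: (posnP (m i)) => [->|mi]; first by rewrite !mulr0n.
  by rewrite -KC iter_all_incr decr_atK // -lt0n.
apply: eq_bigr => j ji; have -> : incr_at m i j = m j by rewrite /incr_at (negbTE ji) addn0.
rewrite (addopMn (op_add i)).
case: (posnP (m j)) => [->|mj]; first by rewrite !mulr0n.
rewrite -KC iter_all_incr; congr (K j (iter_all op _ _) *+ _).
apply/funext => k; rewrite /incr_at /decr_at; case: (k =P j) => [->|_].
  by rewrite (negbTE ji) !addn0.
by rewrite !subn0.
Qed.

End Iter.

Section Anti.
Variables (n : nat) (op : 'I_n -> W -> W) (e : {set 'I_n}).

Definition prod_set (e : {set 'I_n}) w := iter_all op (fun i => i \in e : nat) w.

(* O passes through op up to the sign (-1)^b, and the coefficient c up to -(-1)^b. *)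
Lemma prod_set_leibniz (O : W -> W) (b : bool) (c : 'I_n -> A) w :
  (forall i, addop (op i)) ->
  (forall i w, O (op i w) = lsc (c i) w + lsc ((-1) ^+ b) (op i (O w))) ->
  (forall i j w, op j (lsc (c i) w) = lsc (- (-1) ^+ b) (lsc (c i) (op j w))) ->
  O (prod_set e w) = \sum_(i in e) lsc ((-1) ^+ #|[pred j in e | (j < i)%N]| * c i)
      (prod_set (e :\ i)%SET w) + lsc ((-1) ^+ (b && odd #|e|)) (prod_set e (O w)).
Proof.
move=> oadd HO Hc.
have op_sgn (k : nat) i w' : op i (lsc ((-1) ^+ k) w') = lsc ((-1) ^+ k) (op i w').
  rewrite -signr_odd; case: (odd k); last by rewrite !lsc1.
  by rewrite !lscN1 (addopN (oadd i)).
have op_mov i j (w' : W) (k : nat) : lsc ((-1) ^+ b) (op j (lsc ((-1) ^+ k * c i) w')) =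
    lsc ((-1) ^+ k.+1 * c i) (op j w').
  rewrite -lscA op_sgn Hc !lscA; congr (lsc _ _).
  rewrite exprS -!mulrA; case: b {HO Hc} => /=.
    by rewrite expr1 opprK mul1r.
  by rewrite expr0 mul1r !mulN1r mulrN.
pose F (e : {set 'I_n}) w s := foldr (fun i => iter (i \in e : nat) (op i)) w s.
pose cnt (s : seq 'I_n) i := count (fun j : 'I_n => (j \in e) && (j < i)%N) s.
have H s : sorted (fun i j : 'I_n => (i < j)%N) s ->
    O (F e w s) = \sum_(i <- s | i \in e) lsc ((-1) ^+ cnt s i * c i) (F (e :\ i)%SET w s) +
      lsc ((-1) ^+ (b && odd (count (mem e) s))) (F e (O w) s).
  elim: s => [|a s IHs]; first by rewrite big_nil add0r andbF lsc1.
  move=> sas; have ss := path_sorted sas.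
  have as_ i : i \in s -> (a < i)%N.
    have tr : transitive (fun i j : 'I_n => (i < j)%N) by move=> x y z; apply: ltn_trans.
    by move: sas => /= /(order_path_min tr) /allP; apply.
  have aNs : a \notin s by apply/negP => /as_; rewrite ltnn.
  have Fext (e1 e2 : {set 'I_n}) w' : {in s, e1 =i e2} -> F e1 w' s = F e2 w' s.
    rewrite /F; elim: s {IHs sas ss as_ aNs} => //= i s IHs E.
    rewrite E ?inE ?eqxx // IHs // => x xs; apply: E; by rewrite inE xs orbT.
  have Fcons (e' : {set 'I_n}) w' : F e' w' (a :: s) = if a \in e' then op a (F e' w' s) else F e' w' s.
    by rewrite /F /=; case: (a \in e').
  have cnt_cons i : cnt (a :: s) i = ((a \in e) && (a < i) + cnt s i)%N by [].
  have count_cons : count (mem e) (a :: s) = ((a \in e) + count (mem e) s)%N by [].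
  rewrite big_cons count_cons Fcons; case: (boolP (a \in e)) => ae; last first.
    rewrite IHs // add0n Fcons (negbTE ae); congr (_ + _).
    apply: eq_bigr => i ie; rewrite cnt_cons (negbTE ae) add0n.
    by rewrite Fcons !inE (negbTE ae) andbF.
  have FD : F (e :\ a)%SET w s = F e w s.
    by apply: Fext => x xs; rewrite !inE; case: (x =P a) aNs => [<-|//]; rewrite xs.
  have ca : cnt s a = 0%N.
    apply/eqP; rewrite -leqn0 leqNgt -has_count; apply/hasPn => j js.
    by rewrite negb_and -leqNgt (ltnW (as_ j js)) orbT.
  rewrite HO IHs // (oadd a) (addop_sum (oadd a)) lscDr -!addrA; congr (_ + (_ + _)).
  - by rewrite cnt_cons ltnn andbF add0n ca mul1r Fcons !inE eqxx FD.
  - rewrite lsc_sumr big_seq_cond [RHS]big_seq_cond.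
    apply: eq_bigr => i /andP [is_ ie]; rewrite op_mov cnt_cons as_ // ae.
    rewrite Fcons !inE ae andbT (_ : a != i) //.
    by apply: contraNneq aNs => ->.
  rewrite Fcons ae op_sgn lscA; congr (lsc _ _); rewrite add1n /=.
  by case: b {HO Hc op_mov IHs}; case: (odd _); rewrite /= ?expr0 ?expr1 ?mulN1r ?mul1r ?opprK.
have srt : sorted (fun i j : 'I_n => (i < j)%N) (enum 'I_n).
  by have := iota_ltn_sorted 0 n; rewrite -val_enum_ord sorted_map; apply: sub_sorted => i j.
have cardE i : #|[pred j in e | (j < i)%N]| = cnt (enum 'I_n) i.
  by rewrite cardE size_filter /cnt enumT.
have cardE' : #|e| = count (mem e) (enum 'I_n).
  by rewrite fintype.cardE size_filter enumT.
have := H _ srt; rewrite big_enum_cond /= => E.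
rewrite [LHS]E cardE'; congr (_ + _).
by apply: eq_bigr => i _; rewrite cardE.
Qed.
End Anti.
End IteratedOperators.

Section LinearCombinations.
Context {R : realType} {A : superAlgType R} {p q : nat}.
Local Notation W := (@dform R A p q).
Implicit Types (w : W) (f g : A).

Definition lin n (a : 'I_n -> A) (X : 'I_n -> W -> W) w : W := \sum_j lsc (a j) (X j w).

Lemma lin_add n a (X : 'I_n -> W -> W) : (forall j, addop (X j)) -> addop (lin a X).
Proof.
move=> aX w w'; rewrite /lin -big_split; apply: eq_bigr => j _.
by rewrite aX lscDr.
Qed.

Lemma op_lin n a (X : 'I_n -> W -> W) (O : W -> W) (s : A -> A) w : addop O ->
  (forall f w, O (lsc f w) = lsc (s f) (O w)) ->
  O (lin a X w) = lin (s \o a) (fun j => O \o X j) w.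
Proof.
by move=> aO sO; rewrite /lin addop_sum //; apply: eq_bigr => j _; rewrite sO.
Qed.

Lemma lin_lsc n a (X : 'I_n -> W -> W) (s t : A -> A) f w :
  (forall j w, X j (lsc f w) = lsc (s f) (X j w)) ->
  (forall j, a j * s f = t f * a j) -> lin a X (lsc f w) = lsc (t f) (lin a X w).
Proof.
move=> sX C; rewrite /lin lsc_sumr; apply: eq_bigr => j _.
by rewrite sX !lscA C.
Qed.

Lemma lin_comm n n' (a : 'I_n -> A) (b : 'I_n' -> A) (X : 'I_n -> W -> W)
    (Y : 'I_n' -> W -> W) (gx gy : A -> A) (sigma tau : A) w :
  (forall j, addop (X j)) -> (forall k, addop (Y k)) ->
  (forall j f w, X j (lsc f w) = lsc (gx f) (X j w)) ->
  (forall k f w, Y k (lsc f w) = lsc (gy f) (Y k w)) ->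
  (forall j k w, X j (Y k w) = lsc sigma (Y k (X j w))) ->
  (forall j k, a j * gx (b k) * sigma = tau * (b k * gy (a j))) ->
  lin a X (lin b Y w) = lsc tau (lin b Y (lin a X w)).
Proof.
move=> aX aY gX gY XY C; rewrite /lin lsc_sumr.
under eq_bigr => j _.
  rewrite (addop_sum (aX j)) lsc_sumr.
  under eq_bigr => k _ do rewrite gX XY !lscA C.
  over.
rewrite exchange_big; apply: eq_bigr => k _; rewrite (addop_sum (aY k)).
rewrite !lsc_sumr; apply: eq_bigr => j _.
by rewrite gY !lscA -mulrA.
Qed.

End LinearCombinations.

(** * Truncated Taylor expansions *)

Section Taylor.
Context {R : realType} {A : superAlgType R} {p q : nat}.
Local Notation W := (@dform R A p q).

Definition tcoef (m : 'I_q -> nat) : A := scal ((\prod_al (m al)`!)%:R^-1).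

Lemma tcoef_incr m al : tcoef m = tcoef (incr_at m al) *+ (m al).+1.
Proof.
rewrite /tcoef (bigD1 al) //= [in RHS](bigD1 al) //= /incr_at eqxx addn1 factS.
have -> : \prod_(k | k != al) (m k + (k == al))`! = \prod_(k | k != al) (m k)`!.
  by apply: eq_bigr => k /negbTE ->; rewrite addn0.
set P := (\prod_(_ | _) _)%N; have P0 : (0 < P)%N by apply: prodn_gt0 => k; exact: fact_gt0.
have scalMn (c : R) n : scal c *+ n = scal (c *+ n) :> A.
  by elim: n => [|n IHn]; rewrite ?mulrS ?scalD -?IHn // !mulr0n;
    apply: (addrI (scal 0)); rewrite -scalD !addr0.
rewrite scalMn; congr (scal _); rewrite -[RHS]mulr_natr -mulnA [in RHS]natrM invfM.
by rewrite mulrAC mulVf ?mul1r // pnatr_eq0.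
Qed.

(** Raising [m al] by one maps the range [m al < N] bijectively onto [0 < m al]; what is left over
    is the boundary [m al = N], where [H] has to vanish. It serves the Taylor sums, with [N = p],
    and the sums over monomials in [tsum]. *)
Lemma shift_sum (N : nat) (V : nmodType) al (H : ('I_q -> nat) -> V) :
  (forall m, m al = N -> H m = 0) ->
  \sum_(m : {ffun 'I_q -> 'I_N.+1})
    (if m al == 0%N :> nat then 0 else H (decr_at (fun k => m k) al)) =
  \sum_(m : {ffun 'I_q -> 'I_N.+1}) H (fun k => m k).
Proof.
move=> Hp; pose F (m : {ffun 'I_q -> 'I_N.+1}) : 'I_q -> nat := fun k => m k.
rewrite (bigID (fun m : {ffun 'I_q -> 'I_N.+1} => m al == ord0)) /= big1 ?add0r; last first.
  by move=> m /eqP ->.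
rewrite [RHS](bigID (fun m : {ffun 'I_q -> 'I_N.+1} =>
  m al == ord_max)) /= [X in _ = X + _]big1 ?add0r; last first.
  by move=> m /eqP mE; rewrite Hp // mE.
pose up (m : {ffun 'I_q -> 'I_N.+1}) : {ffun 'I_q -> 'I_N.+1} := [ffun k => inord (m k + (k == al))].
pose dn (m : {ffun 'I_q -> 'I_N.+1}) : {ffun 'I_q -> 'I_N.+1} := [ffun k => inord (m k - (k == al))].
have upE (m : {ffun 'I_q -> 'I_N.+1}) : m al != ord_max -> F (up m) = incr_at (F m) al.
  move=> mal; apply/funext => k; rewrite /F /incr_at ffunE inordK //.
  case: (k =P al) => [->|_]; last by rewrite addn0.
  rewrite addn1 ltnS ltn_neqAle -ltnS ltn_ord andbT.
  by apply: contra mal => /eqP E; apply/eqP/val_inj.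
have dnE (m : {ffun 'I_q -> 'I_N.+1}) : F (dn m) = decr_at (F m) al.
  apply/funext => k; rewrite /F /decr_at ffunE inordK //.
  exact: leq_ltn_trans (leq_subr _ _) (ltn_ord _).
(* [inord] sends the out-of-range value [N.+1] to its default [ord0], so that the condition
   [up m al != ord0] excludes exactly the boundary. *)
have up_max (m : {ffun 'I_q -> 'I_N.+1}) : m al = ord_max -> up m al = ord0.
  move=> mal; apply/val_inj; rewrite ffunE mal eqxx addn1.
  by rewrite /inord /insubd insubF //= ltnn.
have F_inj (m m' : {ffun 'I_q -> 'I_N.+1}) : F m = F m' -> m = m'.
  by move=> E; apply/ffunP => k; apply/val_inj; exact: (f_equal (fun h => h k) E).
have F0 (m : {ffun 'I_q -> 'I_N.+1}) : (m al != ord0) = (F m al != 0%N) by [].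
rewrite (reindex_onto up dn) /= => [|m m0]; last first.
  apply: F_inj; rewrite upE ?dnE ?decr_atK //.
  apply: contraTneq (ltn_ord (m al)) => /(f_equal val) /=; rewrite ffunE eqxx => E.
  move: E; rewrite inordK; last exact: leq_ltn_trans (leq_subr _ _) (ltn_ord _).
  move: m0; rewrite F0 /F; case: (m al : nat) => // n _; rewrite subn1 /= => ->.
  by rewrite ltnn.
apply: eq_big => m.
  apply/andP/idP => [[m0 /eqP E]|mal].
    by apply/negP => /eqP /up_max mal; rewrite mal eqxx in m0.
  have E := upE m mal; split; first by rewrite F0 E /incr_at eqxx addn1.
  by apply/eqP/F_inj; rewrite dnE E incr_atK.
case/andP => m0 /eqP E; have mal : m al != ord_max.
  by apply: contraNneq m0 => /up_max ->.
rewrite -/(F (up m)) upE // incr_atK ifN //.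
Qed.

(* The boundary terms m al = p of the truncated Taylor expansion vanish. *)
Lemma taylor_shift al (H : ('I_q -> nat) -> W) : (forall m, m al = p -> H m = 0) ->
  \sum_(m : {ffun 'I_q -> 'I_p.+1}) lsc (tcoef (fun k => m k)) (H (decr_at (fun k => m k) al) *+ m al) =
  \sum_(m : {ffun 'I_q -> 'I_p.+1}) lsc (tcoef (fun k => m k)) (H (fun k => m k)).
Proof.
move=> Hp; have lscMn f (w : W) n : lsc f (w *+ n) = lsc (f *+ n) w.
  by apply: dformP => e l; rewrite /lsc dformMn mulrnAr mulrnAl.
rewrite -(@shift_sum _ _ al (fun m => lsc (tcoef m) (H m))) => [|m /Hp ->]; last first.
  exact: lsc0r.
apply: eq_bigr => m _; case: eqP => [->|/eqP m0].
  by rewrite mulr0n lsc0r.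
rewrite lscMn (tcoef_incr (decr_at _ al) al) (decr_atK (m := fun k => m k : nat)) //.
by rewrite /decr_at eqxx subn1 prednK // lt0n.
Qed.

End Taylor.

(** * Operators on the substituted delta symbols *)

Section Substitution.
Context {R : realType} {A : superAlgType R} {p q : nat}.
Local Notation W := (@dform R A p q).
Variables (J : @supermx R A p q) (E : 'M[A]_q).
Hypothesis DE : inverses (sD J) E.
Implicit Types (w : W) (f g : A) (e : {set 'I_p}) (m n : 'I_q -> nat).

Local Notation DX := (fun j => @dx_mul R A p q j).
Local Notation DT := (fun be => @dtheta_mul R A p q be).
Local Notation DD := (fun be => @ddtheta R A p q be).

Let E0 : evm E := inverses_even (sD_even J) DE.

Lemma nil_mulE al : nil_mul (sC J) al = lin (fun j => sC J al j) DX :> (W -> W).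
Proof. by apply/funext => w; apply: dformP => e l; rewrite /lin dform_sum. Qed.

Lemma ddyE al : ddy (sD J) al = lin (fun be => E be al) DD :> (W -> W).
Proof.
by apply/funext => w; apply: dformP => e l; rewrite /lin dform_sum /ddy (mx_invP DE).
Qed.

Lemma dx'_mulE i w : dx'_mul (sA J) (sB J) i w =
  lin (fun j => sA J i j) DX w + lin (fun be => sB J i be) DT w.
Proof. by apply: dformP => e l; rewrite dformD /lin !dform_sum. Qed.

Definition y_mul al : W -> W := lin (fun be => sD J al be) DT.

Lemma sA_ev i j : ginv (sA J i j) = sA J i j. Proof. exact: evm_entry (sA_even J). Qed.
Lemma sB_od i j : ginv (sB J i j) = - sB J i j. Proof. exact: odm_entry (sB_odd J). Qed.
Lemma sC_od i j : ginv (sC J i j) = - sC J i j. Proof. exact: odm_entry (sC_odd J). Qed.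
Lemma sD_ev i j : ginv (sD J i j) = sD J i j. Proof. exact: evm_entry (sD_even J). Qed.
Lemma E_ev i j : ginv (E i j) = E i j. Proof. exact: evm_entry E0. Qed.

Lemma nil_add al : addop (nil_mul (sC J) al : W -> W).
Proof. by rewrite nil_mulE; apply: lin_add => j; exact: dx_mul_add. Qed.
Lemma ddy_add al : addop (ddy (sD J) al : W -> W).
Proof. by rewrite ddyE; apply: lin_add => j; exact: ddtheta_add. Qed.
Lemma y_add al : addop (y_mul al).
Proof. by apply: lin_add => j; exact: dtheta_mul_add. Qed.
Lemma dx'_add i : addop (dx'_mul (sA J) (sB J) i : W -> W).
Proof.
move=> w w'; rewrite !dx'_mulE addrACA; congr (_ + _).
  by rewrite lin_add // => j; exact: dx_mul_add.
by rewrite lin_add // => j; exact: dtheta_mul_add.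
Qed.

(** An odd coefficient times an odd dx is even. *)
Lemma nilC al be w : nil_mul (sC J) al (nil_mul (sC J) be w) =
  nil_mul (sC J) be (nil_mul (sC J) al w) :> W.
Proof.
rewrite !nil_mulE -[RHS]lsc1.
apply: (lin_comm (gx := ginv) (gy := ginv) (sigma := -1)) => [j|k|j f w'|k f w'|j k w'|j k].
- exact: dx_mul_add.
- exact: dx_mul_add.
- exact: dx_mul_lsc.
- exact: dx_mul_lsc.
- by rewrite lscN1 dx_mul_anti.
- rewrite mul1r !sC_od mulrN1 !mulrN opprK.
  by rewrite (odd_anti (sC_od _ _) (sC_od _ _)).
Qed.

Lemma nil_ddy al be w : nil_mul (sC J) al (ddy (sD J) be w) =
  ddy (sD J) be (nil_mul (sC J) al w) :> W.
Proof.
rewrite nil_mulE ddyE -[RHS]lsc1.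
apply: (lin_comm (gx := ginv) (gy := id) (sigma := 1)) => [j|k|j f w'|k f w'|j k w'|j k].
- exact: dx_mul_add.
- exact: ddtheta_add.
- exact: dx_mul_lsc.
- exact: ddtheta_lsc.
- by rewrite lsc1 dx_mul_ddtheta.
- by rewrite mul1r mulr1 E_ev (evenC _ (E_ev _ _)).
Qed.

Lemma nil_y al be w : nil_mul (sC J) al (y_mul be w) =
  y_mul be (nil_mul (sC J) al w) :> W.
Proof.
rewrite nil_mulE -[RHS]lsc1.
apply: (lin_comm (gx := ginv) (gy := id) (sigma := 1)) => [j|k|j f w'|k f w'|j k w'|j k].
- exact: dx_mul_add.
- exact: dtheta_mul_add.
- exact: dx_mul_lsc.
- exact: dtheta_mul_lsc.
- by rewrite lsc1 dx_mul_dtheta.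
- by rewrite mul1r mulr1 sD_ev (evenC _ (sD_ev _ _)).
Qed.

Lemma ddyC al be w : ddy (sD J) al (ddy (sD J) be w) =
  ddy (sD J) be (ddy (sD J) al w) :> W.
Proof.
rewrite !ddyE -[RHS]lsc1.
apply: (lin_comm (gx := id) (gy := id) (sigma := 1)) => [j|k|j f w'|k f w'|j k w'|j k].
- exact: ddtheta_add.
- exact: ddtheta_add.
- exact: ddtheta_lsc.
- exact: ddtheta_lsc.
- by rewrite lsc1 ddthetaC.
- by rewrite mul1r mulr1 (evenC _ (E_ev _ _)).
Qed.

Lemma nil_lsc al f w : nil_mul (sC J) al (lsc f w) = lsc f (nil_mul (sC J) al w) :> W.
Proof.
rewrite nil_mulE; apply: (lin_lsc (s := ginv) (t := id)) => [j w'|j].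
  exact: dx_mul_lsc.
by rewrite (oddC _ (sC_od _ _)) ginvK.
Qed.
Lemma ddy_lsc al f w : ddy (sD J) al (lsc f w) = lsc f (ddy (sD J) al w) :> W.
Proof.
rewrite ddyE; apply: (lin_lsc (s := id) (t := id)) => [j w'|j].
  exact: ddtheta_lsc.
exact: evenC (E_ev _ _).
Qed.
Lemma y_lsc al f w : y_mul al (lsc f w) = lsc f (y_mul al w).
Proof.
apply: (lin_lsc (s := id) (t := id)) => [j w'|j]; first exact: dtheta_mul_lsc.
exact: evenC (sD_ev _ _).
Qed.
Lemma dx'_lsc i f w : dx'_mul (sA J) (sB J) i (lsc f w) =
  lsc (ginv f) (dx'_mul (sA J) (sB J) i w) :> W.
Proof.
rewrite !dx'_mulE lscDr; congr (_ + _).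
  apply: (lin_lsc (s := ginv) (t := ginv)) => [j w'|j]; first exact: dx_mul_lsc.
  exact: evenC (sA_ev _ _).
apply: (lin_lsc (s := id) (t := ginv)) => [j w'|j]; first exact: dtheta_mul_lsc.
exact: oddC (sB_od _ _).
Qed.

Lemma sum_delta (n : nat) (i : 'I_n) (F : 'I_n -> A) w :
  \sum_j lsc (F j) (if i == j then w else 0) = lsc (F i) w.
Proof.
rewrite (bigD1 i) //= eqxx big1 ?addr0 // => j; rewrite eq_sym => /negbTE ->.
exact: lsc0r.
Qed.

Lemma dx_con_nil k al w : dx_con k (nil_mul (sC J) al w) =
  nil_mul (sC J) al (dx_con k w) + lsc (- sC J al k) w.
Proof.
rewrite nil_mulE (op_lin _ _ _ (@dx_con_add _ _ _ _ k) (@dx_con_lsc _ _ _ _ k)).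
rewrite /lin addrC -(sum_delta k (fun j => - sC J al j)) -big_split.
apply: eq_bigr => j _ /=; rewrite dx_con_mul sC_od lscDr; congr (_ + _).
by rewrite -!lscN1 !lscA mulrN1 opprK.
Qed.

Lemma dx_con_ddy k al w : dx_con k (ddy (sD J) al w) = ddy (sD J) al (dx_con k w) :> W.
Proof.
rewrite ddyE (op_lin _ _ _ (@dx_con_add _ _ _ _ k) (@dx_con_lsc _ _ _ _ k)).
by apply: eq_bigr => j _ /=; rewrite E_ev dx_con_ddtheta.
Qed.

Lemma dx_con_dx' k i w : dx_con k (dx'_mul (sA J) (sB J) i w) =
  lsc (sA J i k) w + lsc ((-1) ^+ true) (dx'_mul (sA J) (sB J) i (dx_con k w)).
Proof.
rewrite !dx'_mulE dx_con_add !(op_lin _ _ _ (@dx_con_add _ _ _ _ k) (@dx_con_lsc _ _ _ _ k)).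
rewrite lscDr addrA; congr (_ + _).
  rewrite /lin -(sum_delta k (fun j => sA J i j)) lsc_sumr -big_split.
  apply: eq_bigr => j _ /=; rewrite dx_con_mul sA_ev lscDr; congr (_ + _).
  by rewrite -!lscN1 !lscA sign_comm.
rewrite /lin lsc_sumr; apply: eq_bigr => j _ /=.
by rewrite sB_od dx_con_dtheta lscA expr1 mulN1r.
Qed.

Lemma ddtheta_dx' ga i w : ddtheta ga (dx'_mul (sA J) (sB J) i w) =
  lsc (sB J i ga) w + lsc ((-1) ^+ false) (dx'_mul (sA J) (sB J) i (ddtheta ga w)).
Proof.
have dl f w' : ddtheta ga (lsc f w') = lsc (id f) (ddtheta ga w') by exact: ddtheta_lsc.
rewrite !dx'_mulE ddtheta_add !(op_lin _ _ _ (@ddtheta_add _ _ _ _ ga) dl).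
rewrite lsc1 addrCA; congr (_ + _).
  by apply: eq_bigr => j _ /=; rewrite dx_mul_ddtheta.
rewrite /lin -(sum_delta ga (fun j => sB J i j)) -big_split.
by apply: eq_bigr => j _ /=; rewrite ddtheta_mul lscDr addrC.
Qed.

(** The Weyl relation survives the linear change of variables because [E] is inverse to [sD J]. *)
Lemma y_ddy al be w : y_mul al (ddy (sD J) be w) =
  ddy (sD J) be (y_mul al w) + (if al == be then - w else 0).
Proof.
have dl ga f w' : ddtheta ga (lsc f w') = lsc (id f) (ddtheta ga w') by exact: ddtheta_lsc.
have tl ga f w' : dtheta_mul ga (lsc f w') = lsc (id f) (dtheta_mul ga w') by exact: dtheta_mul_lsc.
have -> : y_mul al (ddy (sD J) be w) = \sum_ga \sum_de
    lsc (sD J al ga * E de be) (dtheta_mul ga (ddtheta de w)).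
  apply: eq_bigr => ga _; rewrite ddyE (op_lin _ _ _ (@dtheta_mul_add _ _ _ _ ga) (tl ga)).
  by rewrite /lin lsc_sumr; apply: eq_bigr => de _; rewrite lscA.
have -> : ddy (sD J) be (y_mul al w) = \sum_ga \sum_de
    lsc (sD J al ga * E de be) (ddtheta de (dtheta_mul ga w)).
  rewrite exchange_big ddyE; apply: eq_bigr => de _.
  rewrite (op_lin _ _ _ (@ddtheta_add _ _ _ _ de) (dl de)) /lin lsc_sumr.
  by apply: eq_bigr => ga _; rewrite lscA (evenC _ (E_ev _ _)).
have -> : (if al == be then - w else 0) = - \sum_ga \sum_de
    lsc (sD J al ga * E de be) (if de == ga then w else 0) :> W.
  under eq_bigr => ga _.
    under eq_bigr => de _ do rewrite eq_sym.
    rewrite (sum_delta ga (fun de => sD J al ga * E de be)).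
    over.
  rewrite -lsc_suml; have /matrixP /(_ al be) := DE.1; rewrite !mxE => ->.
  by case: (al == be); rewrite ?lsc1 // lsc0l oppr0.
rewrite -sumrB; apply: eq_bigr => ga _; rewrite -sumrB; apply: eq_bigr => de _.
by rewrite ddtheta_mul lscDr addrK.
Qed.

Local Notation Yv := (delta_y (p := p) (sD J)).
Local Notation V := (delta_theta' (sC J) (sD J)).
Local Notation nil := (nil_mul (sC J)).

Lemma delta_y_incr al n : ddy (sD J) al (Yv n : W) = Yv (incr_at n al).
Proof. exact: (iter_all_incr ddyC). Qed.

Lemma dx_con_delta0 k c : dx_con k (delta0 c : W) = 0.
Proof.
apply: dformP => e l; rewrite /dx_con /delta0; case: ifP => // _.
rewrite (_ : (k |: e)%SET == finset.set0 = false) ?ginv0 ?mulr0 //.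
by apply/eqP => /setP /(_ k); rewrite !inE eqxx.
Qed.

Lemma dtheta_delta0 be c : dtheta_mul be (delta0 c : W) = 0.
Proof.
apply: dformP => e l; rewrite /dtheta_mul /delta0.
have -> : [forall al, incr l be al == 0%N] = false.
  by apply/negP => /forallP /(_ be); rewrite ffunE eqxx addn1.
by rewrite andbF mulr0 oppr0.
Qed.

Lemma dx_con_Y k n : dx_con k (Yv n : W) = 0.
Proof.
rewrite /delta_y (@iter_all_comm _ _ _ _ _ _ ddyC (dx_con k)); last exact: dx_con_ddy.
rewrite dx_con_delta0.
elim/(@iter_all_ind q): n => [|n i IH]; first by rewrite iter_all0.
by rewrite -(iter_all_incr ddyC) IH (addop0 (@ddy_add i)).
Qed.

(** The power rule applied to [y_ddy], as y_al kills the delta symbols without derivatives. *)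
Lemma y_Y al n : y_mul al (Yv n : W) = - (Yv (decr_at n al)) *+ n al.
Proof.
have KC i j w : (if al == i then - ddy (sD J) j w else 0) =
    ddy (sD J) j (if al == i then - w else 0) :> W.
  by case: (al == i); rewrite ?(addopN (@ddy_add j)) ?(addop0 (@ddy_add j)).
rewrite /delta_y (iter_all_leibniz ddyC ddy_add (K := fun be w => if al == be then - w else 0)).
- rewrite (_ : y_mul al _ = 0).
    have -> : iter_all (ddy (sD J)) n 0 = 0 :> W.
      elim/(@iter_all_ind q): n => [|n i IH]; first by rewrite iter_all0.
      by rewrite -(iter_all_incr ddyC) IH (addop0 (@ddy_add i)).
    rewrite add0r (bigD1 al) //= eqxx big1 ?addr0 // => j; rewrite eq_sym => /negbTE ->.
    by rewrite mul0rn.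
  rewrite /y_mul /lin big1 // => be _; rewrite dtheta_delta0.
  exact: lsc0r.
- exact: y_add.
- by move=> i w w'; case: (al == i); rewrite ?addr0 // opprD.
- exact: KC.
- exact: y_ddy.
Qed.

Lemma delta_theta'E n : V n = \sum_(m : {ffun 'I_q -> 'I_p.+1})
  lsc (tcoef (fun k => m k)) (iter_all nil (fun k => m k) (Yv (fun k => n k + m k)%N)) :> W.
Proof. by apply: dformP => e l; rewrite dform_sum. Qed.

(** The filtration by the number of dx's. Every nilpotent factor raises it by one, so more than [p]
    of them give zero. *)
Definition low a w := forall e l, (#|e| < a)%N -> w e l = 0.

Lemma low_nil a al w : low a w -> low a.+1 (nil al w).
Proof.
move=> lw e l ea; rewrite /nil_mul big1 // => j _; rewrite /dx_mul; case: ifP => je.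
  rewrite lw ?ginv0 ?mulr0 //; move: ea; by rewrite (cardsD1 j) je.
by rewrite mulr0.
Qed.

Lemma low_iter_nil m w : low (\sum_al m al) (iter_all nil m w).
Proof.
elim/(@iter_all_ind q): m => [|m al IH]; first by rewrite big1 => [e l|].
rewrite -(iter_all_incr nilC); move/(low_nil al): IH.
rewrite (_ : (\sum_i incr_at m al i)%N = (\sum_i m i).+1) //.
rewrite /incr_at big_split /= -addn1; congr addn.
by rewrite (bigD1 al) //= eqxx big1 ?addn0 // => j /negbTE ->.
Qed.

Lemma iter_nil_big m al w : (p < m al)%N -> iter_all nil m w = 0.
Proof.
move=> mp; apply: dformP => e l; apply: low_iter_nil.
apply: leq_ltn_trans (max_card _) _; rewrite card_ord; apply: leq_trans mp _.
by rewrite (bigD1 al) //= leq_addr.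
Qed.

(** The product with one more factor has [p.+1] factors of index [al] and vanishes. Contracted along
    dx_k it yields, by the Leibniz rule, [p.+1] times the term in question, all the other terms
    being zero; and [p.+1] is invertible. *)
Lemma sC_iter_nil k al m n : m al = p ->
  lsc (- sC J al k) (iter_all nil m (Yv n)) = 0 :> W.
Proof.
move=> mp; have := @iter_all_leibniz _ _ _ _ _ _ nilC nil_add (dx_con k)
  (fun be => lsc (- sC J be k)) (incr_at m al) (Yv n) (@dx_con_add _ _ _ _ k)
  (fun i => @lsc_add _ _ _ _ _) (fun i j w => esym (nil_lsc j _ w)) (fun i w => dx_con_nil k i w).
rewrite dx_con_Y (iter_nil_big (al := al)) ?(addop0 (@dx_con_add _ _ _ _ k)); last first.
  by rewrite /incr_at eqxx addn1 mp.
have -> : iter_all nil (incr_at m al) 0 = 0 :> W.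
  by rewrite (iter_nil_big (al := al)) // /incr_at eqxx addn1 mp.
rewrite add0r (bigD1 al) //= big1 => [|j ja]; last first.
  rewrite (iter_nil_big (al := al)) ?lsc0r ?mul0rn //.
  by rewrite /decr_at /incr_at eq_sym (negbTE ja) subn0 eqxx addn1 mp.
rewrite incr_atK {1}/incr_at eqxx addn1 mp addr0 => /esym E1.
apply: dformP => e l; rewrite dform0; have := f_equal (fun w : W => w e l) E1.
rewrite dformMn dform0; set x := lsc _ _ e l => xp.
have scalMn (c : R) k' : scal c *+ k' = scal (c *+ k') :> A.
  by elim: k' => [|k' IHn]; rewrite ?mulrS ?scalD -?IHn // !mulr0n;
    apply: (addrI (scal 0)); rewrite -scalD !addr0.
have : scal (p.+1%:R^-1) * (x *+ p.+1) = 0 by rewrite xp mulr0.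
have c1 : (p.+1%:R^-1 : R) *+ p.+1 = 1 by rewrite -[LHS]mulr_natr mulVf // pnatr_eq0.
by rewrite mulrnAr -mulrnAl scalMn c1 scal1 mul1r.
Qed.

Lemma ddy_V al n : ddy (sD J) al (V n) = V (incr_at n al) :> W.
Proof.
rewrite !delta_theta'E (addop_sum (@ddy_add al)); apply: eq_bigr => m _.
rewrite ddy_lsc (@iter_all_comm _ _ _ _ _ _ nilC (ddy (sD J) al)); last first.
  by move=> i w; rewrite nil_ddy.
rewrite delta_y_incr; congr (lsc _ (iter_all _ _ (Yv _))).
by apply/funext => k; rewrite /incr_at addnAC.
Qed.

Lemma ddtheta_ddy ga w : ddtheta ga w = \sum_al lsc (sD J al ga) (ddy (sD J) al w).
Proof.
under eq_bigr => al _.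
  rewrite ddyE /lin lsc_sumr.
  under eq_bigr => be _ do rewrite lscA (evenC _ (sD_ev _ _)).
  over.
rewrite exchange_big /=; under eq_bigr => be _.
  rewrite -lsc_suml; have /matrixP /(_ be ga) := DE.2; rewrite !mxE => ->.
  over.
rewrite (bigD1 ga) //= eqxx lsc1 big1 ?addr0 // => be /negbTE ->.
exact: lsc0l.
Qed.

Lemma ddtheta_V ga n : ddtheta ga (V n) = \sum_al lsc (sD J al ga) (V (incr_at n al)) :> W.
Proof. by rewrite ddtheta_ddy; apply: eq_bigr => al _; rewrite ddy_V. Qed.

(** The chain rule for delta(y + nil). Contracting one of the nilpotent factors lowers its exponent,
    and the factorials turn this into one more derivative of delta(y). As the sum is truncated, the
    shift needs [sC_iter_nil] at the boundary. *)
Lemma dx_con_V k n : dx_con k (V n) = \sum_al lsc (- sC J al k) (V (incr_at n al)) :> W.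
Proof.
pose H al (m : 'I_q -> nat) : W :=
  lsc (- sC J al k) (iter_all nil m (Yv (fun i => incr_at n al i + m i)%N)).
transitivity (\sum_al \sum_(m : {ffun 'I_q -> 'I_p.+1})
    lsc (tcoef (fun k => m k)) (H al (decr_at (fun k => m k) al) *+ m al)).
  rewrite exchange_big !delta_theta'E (addop_sum (@dx_con_add _ _ _ _ k)); apply: eq_bigr => m _.
  rewrite dx_con_lsc ginv_scal.
  rewrite (iter_all_leibniz nilC nil_add (K := fun be => lsc (- sC J be k))).
  - rewrite dx_con_Y (_ : iter_all _ _ 0 = 0); last first.
      elim/(@iter_all_ind q): (fun k => m k : nat) => [|m' i IH]; first by rewrite iter_all0.
      by rewrite -(iter_all_incr nilC) IH (addop0 (@nil_add i)).
    rewrite add0r lsc_sumr; apply: eq_bigr => al _.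
    case: (posnP (m al)) => [->|mal]; first by rewrite !mulr0n.
    congr (lsc _ (lsc _ (iter_all _ _ (Yv _)) *+ _)); apply/funext => i.
    rewrite /incr_at /decr_at; case: (i =P al) => [->|_]; last by rewrite addn0 subn0.
    by rewrite addnAC -addnA subnK.
  - exact: dx_con_add.
  - by move=> i; apply: lsc_add.
  - by move=> i j w; rewrite nil_lsc.
  - by move=> i w; rewrite dx_con_nil.
apply: eq_bigr => al _; rewrite taylor_shift; last by move=> m mp; exact: sC_iter_nil.
rewrite delta_theta'E lsc_sumr; apply: eq_bigr => m _.
rewrite /H !lscA; congr (lsc _ _); apply: evenC; exact: ginv_scal.
Qed.

(** This is dtheta'_al delta(dtheta') = 0. In the Taylor expansion y_al lowers a derivative of
    delta(y), and the result cancels against the preceding term multiplied by the nilpotent part; at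
    the end of the range there are [p.+1] nilpotent factors, which vanish. *)
Lemma nil_y_V0 al : y_mul al (V (fun _ => 0%N)) = - nil al (V (fun _ => 0%N)) :> W.
Proof.
pose H (m : 'I_q -> nat) : W := nil al (iter_all nil m (Yv m)).
have Hp m : m al = p -> H m = 0.
  by move=> mp; rewrite /H (iter_all_incr nilC) (iter_nil_big (al := al)) // /incr_at eqxx addn1 mp.
have := taylor_shift Hp => /(f_equal -%R) E1.
rewrite !delta_theta'E (addop_sum (@nil_add al)) (addop_sum (@y_add al)).
transitivity (- \sum_(m : {ffun 'I_q -> 'I_p.+1}) lsc (tcoef (fun k => m k)) (H (fun k => m k))).
  rewrite -E1 -sumrN; apply: eq_bigr => m _.
  rewrite y_lsc (@iter_all_comm _ _ _ _ _ _ nilC (y_mul al)); last by move=> i w; rewrite nil_y.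
  rewrite (_ : (fun k => 0 + m k)%N = fun k => m k) // y_Y.
  rewrite -lscNr; congr (lsc _ _).
  have addN : addop (iter_all nil (fun k => m k)).
    move=> w w'; elim/(@iter_all_ind q): (fun k => m k : nat) => [|m' i IH]; first by rewrite !iter_all0.
    by rewrite -!(iter_all_incr nilC) IH nil_add.
  rewrite (addopMn addN) (addopN addN) mulNrn; congr (- _).
  case: (posnP (m al)) => [->|mal]; first by rewrite !mulr0n.
  by congr (_ *+ _); rewrite /H (iter_all_incr nilC) decr_atK // -lt0n.
by congr (- _); apply: eq_bigr => m _; rewrite nil_lsc.
Qed.

Lemma dtheta_V0 ga : dtheta_mul ga (V (fun _ => 0%N)) =
  - \sum_al lsc (E ga al) (nil al (V (fun _ => 0%N))) :> W.
Proof.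
transitivity (\sum_al lsc (E ga al) (y_mul al (V (fun _ => 0%N)))).
  under [RHS]eq_bigr => al _.
    rewrite /y_mul /lin lsc_sumr.
    under eq_bigr => be _ do rewrite lscA.
    over.
  rewrite exchange_big /=; under [RHS]eq_bigr => be _.
    rewrite -lsc_suml; have /matrixP /(_ ga be) := DE.2; rewrite !mxE => ->.
    over.
  rewrite (bigD1 ga) //= eqxx lsc1 big1 ?addr0 // => be; rewrite eq_sym => /negbTE ->.
  exact: lsc0l.
rewrite -sumrN; apply: eq_bigr => al _.
by rewrite nil_y_V0 lscNr.
Qed.

Definition schur : 'M[A]_p := sA J - sB J *m E *m sC J.

Lemma schur_ev i j : ginv (schur i j) = schur i j.
Proof.
apply: evm_entry; apply: evmD; first exact: sA_even.
apply/evmN/evm_odM; last exact: sC_odd.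
exact: odmMl (sB_odd J) E0.
Qed.

(** On delta(dtheta') the differentials dtheta may be replaced by - E C dx, which turns A dx + B
    dtheta into the Schur complement applied to dx: the origin of the numerator of the
    Berezinian. *)
Lemma dx'_V0 i : dx'_mul (sA J) (sB J) i (V (fun _ => 0%N)) =
  lin (fun j => schur i j) DX (V (fun _ => 0%N)) :> W.
Proof.
rewrite dx'_mulE; set v := V _.
transitivity (lin (fun j => sA J i j) DX v + \sum_j lsc (- (sB J *m E *m sC J) i j) (DX j v)).
  congr (_ + _); rewrite /lin.
  under eq_bigr => be _.
    rewrite /v dtheta_V0 -/v lscNr lsc_sumr.
    under eq_bigr => al _ do rewrite lscA.
    over.
  rewrite sumrN exchange_big /= -sumrN.
  transitivity (\sum_al lsc (- (sB J *m E) i al) (nil al v)).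
    by apply: eq_bigr => al _; rewrite lscNl mxE lsc_suml.
  transitivity (\sum_al \sum_j lsc (- ((sB J *m E) i al * sC J al j)) (DX j v)).
    apply: eq_bigr => al _; rewrite nil_mulE /lin lsc_sumr.
    by apply: eq_bigr => j _; rewrite lscA mulNr.
  rewrite exchange_big /=; apply: eq_bigr => j _.
  rewrite -lsc_suml; congr (lsc _ _).
  by rewrite sumrN; congr (- _); rewrite [RHS]mxE.
rewrite -big_split; apply: eq_bigr => j _ /=; rewrite -lscDl; congr (lsc _ _).
by rewrite /schur !mxE.
Qed.

End Substitution.

(** * Substituted monomials: contractions, parity and degree *)

Section Monomials.
Context {R : realType} {A : superAlgType R} {p q : nat}.
Local Notation W := (@dform R A p q).
Variables (J : @supermx R A p q) (E : 'M[A]_q).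
Hypothesis DE : inverses (sD J) E.
Implicit Types (w : W) (f g : A) (e : {set 'I_p}) (m n : 'I_q -> nat).

Local Notation dx' := (dx'_mul (sA J) (sB J)).
Local Notation V := (delta_theta' (sC J) (sD J)).

Definition smon e n : W := subst_monomial (sA J) (sB J) (sC J) (sD J) e n.

Lemma smonE e n : smon e n = prod_set dx' e (V n).
Proof. by []. Qed.

Lemma prod_set_add (n : nat) (op : 'I_n -> W -> W) (e : {set 'I_n}) :
  (forall i, addop (op i)) -> addop (prod_set op e).
Proof.
move=> oadd w w'; rewrite /prod_set /iter_all; elim: (enum 'I_n) => //= i s ->.
by case: (i \in e); rewrite //= oadd.
Qed.

Lemma prod_set_pass (n : nat) (op : 'I_n -> W -> W) (O : W -> W) (b : bool) (e : {set 'I_n}) w :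
  (forall i, addop (op i)) ->
  (forall i w, O (op i w) = lsc ((-1) ^+ b) (op i (O w))) ->
  O (prod_set op e w) = lsc ((-1) ^+ (b && odd #|e|)) (prod_set op e (O w)).
Proof.
move=> oadd HO; rewrite (@prod_set_leibniz _ _ _ _ _ _ e O b (fun _ => 0)) //.
- rewrite big1 ?add0r // => i _; rewrite mulr0; exact: lsc0l.
- by move=> i w'; rewrite HO lsc0l add0r.
- by move=> i j w'; rewrite !lsc0l (addop0 (oadd j)) lsc0r.
Qed.

Lemma prod_set_lsc (e : {set 'I_p}) (b : bool) f w : ginv f = (-1) ^+ b * f ->
  prod_set dx' e (lsc f w) = lsc ((-1) ^+ (b && odd #|e|)) (lsc f (prod_set dx' e w)).
Proof.
move=> fb; rewrite (@prod_set_pass _ _ (lsc f) b); last 2 first.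
- exact: dx'_add.
- move=> i w'; rewrite dx'_lsc fb lscA mulrA -expr2 sqrr_sign mul1r //.
by rewrite lscA -expr2 sqrr_sign lsc1.
Qed.

(** The chain rule for d/d(dx_k): dx'_i depends on dx_k through [A], dtheta'_al through [C], whose
    odd entries cause the minus sign. Together with [ddtheta_smon], [smon_ginv] and the value on the
    top monomial, this is all that [vword_change] needs to know of the substitution. *)
Lemma dx_con_smon k e n : dx_con k (smon e n) =
  \sum_(i in e) lsc ((-1) ^+ #|[pred j in e | (j < i)%N]| * sA J i k) (smon (e :\ i)%SET n) -
  \sum_al lsc (sC J al k) (smon e (incr_at n al)).
Proof.
rewrite smonE (@prod_set_leibniz _ _ _ _ _ _ e (dx_con k) true (fun i => sA J i k)).
- congr (_ + _); rewrite (dx_con_V DE) (addop_sum (prod_set_add _ _)); last exact: dx'_add.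
  rewrite lsc_sumr -sumrN; apply: eq_bigr => al _.
  rewrite (@prod_set_lsc _ true); last by rewrite expr1 mulN1r ginvN (odm_entry _ _ (sC_odd J)).
  by rewrite lscA -expr2 sqrr_sign lsc1 lscNl.
- exact: dx'_add.
- exact: dx_con_dx'.
- move=> i j w; rewrite dx'_lsc (evm_entry _ _ (sA_even J)).
  by rewrite expr1 opprK lsc1.
Qed.

Lemma ddtheta_smon ga e n : ddtheta ga (smon e n) =
  \sum_(i in e) lsc ((-1) ^+ #|[pred j in e | (j < i)%N]| * sB J i ga) (smon (e :\ i)%SET n) +
  \sum_al lsc (sD J al ga) (smon e (incr_at n al)).
Proof.
rewrite smonE (@prod_set_leibniz _ _ _ _ _ _ e (ddtheta ga) false (fun i => sB J i ga)).
- congr (_ + _); rewrite (ddtheta_V DE) (addop_sum (prod_set_add _ _)); last exact: dx'_add.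
  rewrite lsc_sumr; apply: eq_bigr => al _.
  rewrite (@prod_set_lsc _ false); last by rewrite expr0 mul1r (evm_entry _ _ (sD_even J)).
  by rewrite !lsc1.
- exact: dx'_add.
- exact: ddtheta_dx'.
- move=> i j w; rewrite dx'_lsc (odm_entry _ _ (sB_odd J)).
  by rewrite lscA expr0 mulN1r.
Qed.

(** The grade involution with the [q] delta symbols counted as even; the sign (-1)^q dropped in this
    way is common to all monomials. *)
Definition wginv w : W := fun e l => (-1) ^+ #|e| * ginv (w e l).

Lemma wginv_add : addop wginv.
Proof. by move=> w w'; apply: dformP => e l; rewrite dformD /wginv ginvD mulrDr. Qed.
Lemma wginv_lsc f w : wginv (lsc f w) = lsc (ginv f) (wginv w).
Proof. by apply: dformP => e l; rewrite /wginv /lsc ginvM !mulrA sign_comm. Qed.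
Lemma wginv_dx j w : wginv (dx_mul j w) = - dx_mul j (wginv w).
Proof.
apply: dformP => e l; rewrite dformN /wginv /dx_mul; case: ifP => je; last by rewrite ginv0 mulr0 oppr0.
rewrite !ginv_sign (cardsD1 j e) je add1n exprS mulN1r mulNr !mulrA.
by rewrite -!exprD addnC.
Qed.
Lemma wginv_dtheta be w : wginv (dtheta_mul be w) = dtheta_mul be (wginv w).
Proof.
apply: dformP => e l; rewrite /wginv /dtheta_mul ginvN ginvM natr_even mulrN.
by rewrite !mulrA sign_comm.
Qed.
Lemma wginv_ddtheta be w : wginv (ddtheta be w) = ddtheta be (wginv w).
Proof.
by apply: dformP => e l; rewrite /wginv /ddtheta; case: ifP => // _; rewrite ginv0 mulr0.
Qed.

Lemma wginv_nil al w : wginv (nil_mul (sC J) al w) = nil_mul (sC J) al (wginv w).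
Proof.
rewrite !nil_mulE (op_lin _ _ _ wginv_add wginv_lsc); apply: eq_bigr => j _ /=.
by rewrite (odm_entry _ _ (sC_odd J)) wginv_dx lscNl lscNr opprK.
Qed.
Lemma wginv_ddy al w : wginv (ddy (sD J) al w) = ddy (sD J) al (wginv w).
Proof.
rewrite !(ddyE DE) (op_lin _ _ _ wginv_add wginv_lsc); apply: eq_bigr => j _ /=.
by rewrite (E_ev DE) wginv_ddtheta.
Qed.
Lemma wginv_dx' i w : wginv (dx' i w) = lsc ((-1) ^+ true) (dx' i (wginv w)).
Proof.
rewrite !dx'_mulE wginv_add !(op_lin _ _ _ wginv_add wginv_lsc) expr1 lscN1 opprD.
rewrite /lin -!sumrN; congr (_ + _); apply: eq_bigr => j _ /=.
  by rewrite (evm_entry _ _ (sA_even J)) wginv_dx lscNr.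
by rewrite (odm_entry _ _ (sB_odd J)) wginv_dtheta lscNl.
Qed.

Lemma wginv_V n : wginv (V n) = V n.
Proof.
rewrite delta_theta'E (addop_sum wginv_add); apply: eq_bigr => m _.
rewrite wginv_lsc ginv_scal (@iter_all_comm _ _ _ _ _ _ (@nilC _ _ _ _ J) wginv); last exact: wginv_nil.
rewrite /delta_y (@iter_all_comm _ _ _ _ _ _ (ddyC DE) wginv); last exact: wginv_ddy.
congr (lsc _ (iter_all _ _ (iter_all _ _ _))); apply: dformP => e l.
rewrite /wginv /delta0; case: ifP => [/andP [/eqP -> _]|_]; last by rewrite ginv0 mulr0.
rewrite cards0 mul1r ring_inv_even //; exact: (det_even (sD_even J)).
Qed.

Lemma smon_ginv e n e' l : ginv (smon e n e' l) = (-1) ^+ (#|e| + #|e'|) * smon e n e' l.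
Proof.
have := @prod_set_pass _ _ wginv true e (V n) (@dx'_add _ _ _ _ J) wginv_dx'.
rewrite wginv_V andTb signr_odd => /(f_equal (fun w : W => w e' l)).
rewrite /wginv /lsc -smonE => /(f_equal ( *%R ((-1) ^+ #|e'|))).
by rewrite mulrA -expr2 sqrr_sign mul1r mulrA -exprD addnC.
Qed.

(** Homogeneity of degree [b - a]; two natural numbers replace an integer that may be negative. *)
Definition hdeg (a b : nat) w := forall e (l : {ffun 'I_q -> nat}),
  (#|e| + a != \sum_al l al + b)%N -> w e l = 0.

Lemma hdeg_dx a b j w : hdeg a b w -> hdeg a b.+1 (dx_mul j w).
Proof.
move=> hw e l el; rewrite /dx_mul; case: ifP => // je; rewrite hw ?ginv0 ?mulr0 //.
by apply: contra el => /eqP E1; rewrite (cardsD1 j) je add1n addSn E1 addnS.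
Qed.
Lemma sum_incr l (be : 'I_q) : (\sum_al incr l be al = (\sum_al l al).+1)%N.
Proof.
rewrite -addn1; under eq_bigr do rewrite ffunE.
by rewrite big_split /=; congr addn; rewrite (bigD1 be) //= eqxx big1 ?addn0 // => j /negbTE ->.
Qed.
Lemma hdeg_dtheta a b be w : hdeg a b w -> hdeg a b.+1 (dtheta_mul be w).
Proof.
move=> hw e l el; rewrite /dtheta_mul hw ?mulr0 ?oppr0 //.
by apply: contra el => /eqP ->; rewrite sum_incr addnS addSn.
Qed.
Lemma hdeg_ddtheta a b be w : hdeg a b w -> hdeg a.+1 b (ddtheta be w).
Proof.
move=> hw e l el; rewrite /ddtheta; case: eqP => // /eqP l0; apply: hw.
by apply: contra el => /eqP E1; rewrite -(decrK l0) sum_incr addnS E1 addSn.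
Qed.
Lemma hdeg_lin a b (k : nat) (c : 'I_k -> A) X w :
  (forall j, hdeg a b (X j w)) -> hdeg a b (lin c X w).
Proof.
by move=> hX e l el; rewrite /lin dform_sum big1 // => j _; rewrite /lsc hX ?mulr0.
Qed.
Lemma hdegD a b w w' : hdeg a b w -> hdeg a b w' -> hdeg a b (w + w').
Proof. by move=> hw hw' e l el; rewrite dformD hw // hw' // addr0. Qed.
Lemma hdeg_nil a b al w : hdeg a b w -> hdeg a b.+1 (nil_mul (sC J) al w).
Proof. by move=> hw; rewrite nil_mulE; apply: hdeg_lin => j; apply: hdeg_dx. Qed.
Lemma hdeg_ddy a b al w : hdeg a b w -> hdeg a.+1 b (ddy (sD J) al w).
Proof. by move=> hw; rewrite (ddyE DE); apply: hdeg_lin => j; apply: hdeg_ddtheta. Qed.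
Lemma hdeg_dx' a b i w : hdeg a b w -> hdeg a b.+1 (dx' i w).
Proof.
move=> hw; rewrite dx'_mulE; apply: hdegD; apply: hdeg_lin => j.
  exact: hdeg_dx.
exact: hdeg_dtheta.
Qed.
Lemma hdeg_shift a b c w : hdeg (a + c) (b + c) w -> hdeg a b w.
Proof. by move=> hw e l el; apply: hw; rewrite !addnA eqn_add2r. Qed.

Lemma hdeg_iter (k : nat) (op : 'I_k -> W -> W) (x y : nat) a b (m : 'I_k -> nat) w :
  (forall i a b w, hdeg a b w -> hdeg (a + x) (b + y) (op i w)) ->
  hdeg a b w -> hdeg (a + x * \sum_i m i) (b + y * \sum_i m i) (iter_all op m w).
Proof.
move=> hop hw; rewrite /iter_all -[X in (x * X)%N]big_enum -[X in (y * X)%N]big_enum /=.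
elim: (enum _) => [|i s IHs] /=; first by rewrite !big_nil !muln0 !addn0.
rewrite big_cons; elim: (m i) => [|c IHc]; first by rewrite add0n.
have step z t r : (t + z * (c.+1 + r) = t + z * (c + r) + z)%N.
  by rewrite addSn mulnS addnA addnAC.
by rewrite /= !step; apply: hop.
Qed.

Lemma hdeg_V0 : hdeg 0 0 (V (fun _ => 0%N)).
Proof.
rewrite delta_theta'E => e l el; rewrite dform_sum big1 // => m _; rewrite /lsc.
suff H : hdeg 0 0 (iter_all (nil_mul (sC J)) (fun k => m k)
    (delta_y (p := p) (sD J) (fun k => 0 + m k)%N)) by rewrite H ?mulr0.
(* In each Taylor term [s] derivatives lower the degree by [s], and [s] nilpotent factors raise it
   again. *)
pose s := (\sum_k (m k : nat))%N; apply: (@hdeg_shift _ _ s); rewrite !add0n.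
have h0 : hdeg 0 0 (delta0 (ring_inv (\det (sD J))) : W).
  move=> e' l' el'; rewrite /delta0; case: ifP => // /andP [/eqP E1 /forallP l0].
  move: el'; rewrite E1 cards0 big1 ?eqxx // => al _; exact/eqP/l0.
have h1 := @hdeg_iter _ (ddy (sD J)) 1 0 0 0 (fun k => 0 + m k)%N _
  (fun i a b w => _) h0.
have := @hdeg_iter _ (nil_mul (sC J)) 0 1 _ _ (fun k => m k) _ (fun i a b w => _) (h1 _).
rewrite !mul1n !mul0n !add0n !addn0; apply.
- by move=> i a b w hw; rewrite addn0 addn1; apply: hdeg_nil.
- by move=> i a b w hw; rewrite addn0 addn1; apply: hdeg_ddy.
Qed.

(** The image has degree [p], and no other monomial has this degree. *)
Lemma smon_top e l : smon finset.setT (fun _ => 0%N) e l =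
  if (e == finset.setT) && (l == [ffun=> 0%N]) then
    smon finset.setT (fun _ => 0%N) finset.setT [ffun=> 0%N] else 0.
Proof.
case: ifP => [/andP [/eqP -> /eqP ->] //|el].
have := @hdeg_iter _ dx' 0 1 0 0 (fun i => i \in [set: 'I_p]%SET : nat) _ (fun i a b w => _) hdeg_V0.
rewrite mul0n mul1n !add0n => H; apply: H.
  by move=> i a b w hw; rewrite addn0 addn1; apply: hdeg_dx'.
have sT : (\sum_(i < p) (i \in [set: 'I_p]%SET) = p)%N.
  by rewrite -[RHS]card_ord -sum1_card; apply: eq_bigr => i _; rewrite inE.
rewrite addn0 sT; apply: contraFN el => /eqP E1.
have eT : (#|e| <= p)%N by rewrite -[X in (_ <= X)%N]card_ord; exact: max_card.
have l0 : (\sum_al l al = 0)%N.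
  by apply/eqP; rewrite -leqn0 -(leq_add2r p) add0n -E1.
apply/andP; split.
  by rewrite finset.eqEcard finset.subsetT cardsT card_ord E1 l0 add0n leqnn.
apply/eqP/ffunP => al; rewrite ffunE; apply/eqP; rewrite -leqn0 -l0.
by rewrite (bigD1 al) //= leq_addr.
Qed.

End Monomials.

(** * The top monomial and the Berezinian *)

Section ExteriorDeterminant.
Context {R : realType} {A : superAlgType R} {p q : nat}.
Local Notation W := (@dform R A p q).
Local Notation DX := (fun j => @dx_mul R A p q j).
Implicit Types (w : W) (e : {set 'I_p}) (l : {ffun 'I_q -> nat}).

Lemma expand_det_row0_even n (D : 'M[A]_n.+1) : evm D ->
  \det D = \sum_j D ord0 j * ((-1) ^+ j * \det (row' ord0 (col' j D))).
Proof.
move=> /evm_lift [D0 <-]; rewrite det_map_mx (expand_det_row D0 ord0) rmorph_sum.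
apply: eq_bigr => j _; rewrite rmorphM mxE /cofactor rmorphM rmorph_sign add0n.
by rewrite -map_col' -map_row' det_map_mx.
Qed.

Lemma card_image_below n (g : 'I_n -> 'I_p) (j : 'I_n) :
  (forall i i' : 'I_n, (i < i')%N -> (g i < g i')%N) ->
  #|[pred x in (g @: [set: 'I_n])%SET | (x < g j)%N]| = j.
Proof.
move=> gm; have ginj : injective g.
  move=> x y /(f_equal val) /= E; apply/val_inj; case: (ltngtP x y) => // xy.
    by have := gm _ _ xy; rewrite E ltnn.
  by have := gm _ _ xy; rewrite E ltnn.
have gm' i i' : (g i < g i')%N = (i < i')%N.
  case: (ltngtP i i') => [/gm //|/gm h|/val_inj ->]; last by rewrite ltnn.
  by apply/negbTE; rewrite -leqNgt ltnW.
transitivity #|[pred i : 'I_n | (i < j)%N]|.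
  rewrite -(fintype.card_image ginj [pred i : 'I_n | (i < j)%N]).
  apply: eq_card => x; rewrite !inE; apply/andP/fintype.imageP => [[/finset.imsetP [i _ ->]]|[i]].
    by rewrite gm' => ij; exists i.
  by rewrite inE => ij ->; rewrite gm'; split=> //; apply/finset.imset_f; rewrite inE.
rewrite -[RHS](size_iota 0) -sum1_card (eq_bigl (fun i : 'I_n => (i < j)%N)) //.
rewrite -(big_ord_widen n (fun _ => 1%N)) ?sum1_card ?card_ord ?size_iota //.
exact: ltnW.
Qed.

(** Laplace expansion along the first row. Arbitrary minors, with [g] listing the columns, are
    needed for the induction, because removing one linear form leaves a rectangular matrix. *)
Lemma exterior_det n (B : 'M[A]_(n, p)) (g : 'I_n -> 'I_p) w l : evm B ->
  (forall i i' : 'I_n, (i < i')%N -> (g i < g i')%N) -> ginv (w finset.set0 l) = w finset.set0 l ->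
  foldr (fun i => lin (fun j => B i j) DX) w (enum 'I_n) (g @: [set: 'I_n])%SET l =
  \det (\matrix_(i, j) B i (g j)) * w finset.set0 l.
Proof.
elim: n B g => [|n IHn] B g B0 gm w0.
  rewrite (_ : \matrix_(i, j) _ = 1%:M) ?det1_pz; last by apply/matrixP => -[].
  rewrite mul1r (_ : enum 'I_0 = [::]) /=; last by apply: size0nil; rewrite size_enum_ord.
  by congr (w _ l); apply/setP => x; rewrite inE; apply/negbTE/finset.imsetP => -[[]].
have M0 : evm (\matrix_(i, j) B i (g j) : 'M[A]_n.+1).
  by apply/matrixP => i j; rewrite !mxE (evm_entry _ _ B0).
rewrite enum_ordSl /= foldr_map (expand_det_row0_even M0) big_distrl /=.
rewrite /lin dform_sum.
have ginj : injective g.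
  move=> x y /(f_equal val) /= E; apply/val_inj; case: (ltngtP x y) => // xy.
    by have := gm _ _ xy; rewrite E ltnn.
  by have := gm _ _ xy; rewrite E ltnn.
rewrite (bigID (fun j => j \in (g @: [set: 'I_n.+1])%SET)) /= [X in _ + X]big1 ?addr0; last first.
  by move=> j /negbTE gj; rewrite /lsc /dx_mul gj mulr0.
rewrite finset.big_imset /=; last by move=> x y _ _; apply: ginj.
rewrite (eq_bigl predT) => [|j]; last by rewrite inE.
apply: eq_bigr => j _; rewrite /lsc /dx_mul.
rewrite finset.imset_f ?inE // card_image_below // mxE -!mulrA; congr (_ * (_ * _)).
have -> : ((g @: [set: 'I_n.+1]) :\ g j = (g \o lift j) @: [set: 'I_n])%SET.
  apply/setP => x; rewrite !inE; apply/andP/finset.imsetP => [[xj /finset.imsetP [i _ xi]]|[i _ ->]].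
    have ij : j != i by apply/eqP => E1; rewrite xi E1 eqxx in xj.
    by have [k ik _] := unlift_some ij; exists k; rewrite ?inE // xi ik.
  split; last by apply/finset.imset_f; rewrite inE.
  by rewrite /= (inj_eq ginj) eq_sym neq_lift.
have mono : forall i i' : 'I_n, (i < i')%N -> ((g \o lift j) i < (g \o lift j) i')%N.
  move=> i i' ii'; apply: gm; rewrite /= /bump.
  rewrite -addnS leq_add //; case: (leqP j i) => // ji.
  by rewrite (leq_trans ji) // ltnW.
have B0' : evm (row' ord0 B) by apply/matrixP => i k; rewrite !mxE (evm_entry _ _ B0).
have := IHn (row' ord0 B) _ B0' mono w0.
have -> : (fun i => lin (fun k => row' ord0 B i k) DX) = fun i => lin (fun k => B (lift ord0 i) k) DX.
  by apply/funext => i; congr lin; apply/funext => k; rewrite mxE.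
move=> ->; rewrite ginvM w0; congr (_ * _).
have -> : \matrix_(i, k) row' ord0 B i ((g \o lift j) k) = row' ord0 (col' j (\matrix_(i, k) B i (g k))).
  by apply/matrixP => i k; rewrite !mxE.
apply: det_even; apply/matrixP => i k; rewrite !mxE; exact: (evm_entry _ _ B0).
Qed.

End ExteriorDeterminant.

Section TopMonomial.
Context {R : realType} {A : superAlgType R} {p q : nat}.
Local Notation W := (@dform R A p q).
Local Notation DX := (fun j => @dx_mul R A p q j).
Variables (J : @supermx R A p q) (E : 'M[A]_q).
Hypothesis DE : inverses (sD J) E.
Local Notation dx' := (dx'_mul (sA J) (sB J)).
Local Notation V0 := (delta_theta' (sC J) (sD J) (fun _ => 0%N) : W).
Local Notation dS i := (lin (fun j => schur J E i j) DX).

Lemma dx'_schur i k w : dx' i (dS k w) = - dS k (dx' i w) :> W.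
Proof.
have S0 := schur_ev DE; rewrite !dx'_mulE lin_add; last by move=> j; exact: dx_mul_add.
rewrite opprD -!lscN1; congr (_ + _).
- apply: (lin_comm (gx := ginv) (gy := ginv) (sigma := -1)) => [j|j|j f w'|j f w'|j j' w'|j j'].
  + exact: dx_mul_add.
  + exact: dx_mul_add.
  + exact: dx_mul_lsc.
  + exact: dx_mul_lsc.
  + by rewrite lscN1 dx_mul_anti.
  + by rewrite S0 sA_ev mulrN1 mulN1r (evenC _ (S0 _ _)).
- apply: (lin_comm (gx := id) (gy := ginv) (sigma := 1)) => [j|j|j f w'|j f w'|j j' w'|j j'].
  + exact: dtheta_mul_add.
  + exact: dx_mul_add.
  + exact: dtheta_mul_lsc.
  + exact: dx_mul_lsc.
  + by rewrite lsc1 dx_mul_dtheta.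
  + by rewrite sB_od mulr1 mulrN mulN1r opprK (evenC _ (S0 _ _)).
Qed.

Lemma dS_anti i k w : dS i (dS k w) = - dS k (dS i w) :> W.
Proof.
have S0 := schur_ev DE; rewrite -lscN1.
apply: (lin_comm (gx := ginv) (gy := ginv) (sigma := -1)) => [j|j|j f w'|j f w'|j j' w'|j j'].
- exact: dx_mul_add.
- exact: dx_mul_add.
- exact: dx_mul_lsc.
- exact: dx_mul_lsc.
- by rewrite lscN1 dx_mul_anti.
- by rewrite !S0 mulrN1 mulN1r (evenC _ (S0 _ _)).
Qed.

(** [dx'_V0] applies only to a factor that stands next to delta(dtheta'). Each [dx'] is moved there
    past the Schur factors, with which it anticommutes, replaced, and moved back; the two signs
    cancel. *)
Lemma foldr_dx'_V0 s : foldr dx' V0 s = foldr (fun i => dS i) V0 s.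
Proof.
have dSadd i : addop (dS i) by apply: lin_add => j; exact: dx_mul_add.
elim: s => //= i s ->.
have pass (O : W -> W) : addop O -> (forall k w, O (dS k w) = - dS k (O w)) ->
    forall t w, O (foldr (fun i => dS i) w t) = lsc ((-1) ^+ size t) (foldr (fun i => dS i) (O w) t).
  move=> Oadd HO; elim=> [|k t IHt] w /=; first by rewrite lsc1.
  rewrite HO IHt exprS mulN1r lscNl; congr (- _).
  rewrite -signr_odd; case: (odd _); last by rewrite !lsc1.
  by rewrite !lscN1 (addopN (dSadd k)).
rewrite (pass (dx' i)) ?(pass (dS i)) ?(dx'_V0 DE) //.
- by move=> k w; apply: dS_anti.
- exact: dx'_add.
- by move=> k w; apply: dx'_schur.
Qed.

(** The product of the [p] linear forms given by the Schur complement contributes its determinant.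
    The factor [\det E] is the part of delta(dtheta') without dx, to which the zeroth Taylor term
    alone contributes. *)
Lemma smon_ber : smon J finset.setT (fun _ => 0%N) finset.setT [ffun=> 0%N] = sber J.
Proof.
have rd := ring_inv_det (sD_even J) DE.
have dE0 := det_even (inverses_even (sD_even J) DE).
have v0 : V0 finset.set0 [ffun=> 0%N] = \det E.
  rewrite delta_theta'E dform_sum (bigD1 [ffun=> ord0]) //= big1 ?addr0 => [|m m0]; last first.
    have [al mal] : exists al, m al != 0%N :> nat.
      apply/existsP; apply: contraNT m0; rewrite negb_exists => /forallP H.
      by apply/eqP/ffunP => al; rewrite ffunE; apply/val_inj/eqP/negPn/H.
    rewrite /lsc (low_iter_nil J) ?mulr0 // cards0.
    by rewrite (bigD1 al) //= addn_gt0 lt0n mal.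
  set m0 : {ffun 'I_q -> 'I_p.+1} := [ffun=> ord0].
  have m00 : (fun k : 'I_q => m0 k : nat) = fun _ => 0%N by apply/funext => k; rewrite ffunE.
  have m01 : (fun k : 'I_q => 0 + m0 k)%N = fun _ => 0%N by apply/funext => k; rewrite ffunE.
  rewrite m01 ?m00 iter_all0 /delta_y iter_all0 /lsc /tcoef big1 // invr1 scal1 mul1r /delta0 eqxx /=.
  rewrite (_ : [forall al, _] = true) //.
  by apply/forallP => al; rewrite ffunE.
have S0 : evm (schur J E) by apply/matrixP => i j; rewrite mxE (schur_ev DE).
rewrite smonE /prod_set /iter_all.
rewrite (_ : foldr _ _ _ = foldr dx' V0 (enum 'I_p)); last first.
  by elim: (enum _) => //= i s ->; rewrite inE.
rewrite foldr_dx'_V0.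
have -> : finset.setT = (id @: [set: 'I_p])%SET :> {set 'I_p} by rewrite finset.imset_id.
rewrite (exterior_det (g := id)) // ?v0 ?dE0 //.
rewrite (sberE DE) -/(schur J E); congr (\det _ * _).
by apply/matrixP => i j; rewrite mxE.
Qed.

End TopMonomial.

(** * Changes of coordinates *)

Section Jacobian.
Context {R : realType} {p q : nat} {M : supermanifold R p q}.
Implicit Types (a b c : chart M p q) (U V Z : opens M).

Section JacobianMatrix.
Variables (a b : chart M p q) (Z : opens M) (Za : Z `<=` cdom a) (Zb : Z `<=` cdom b).

Lemma jac_evenA : evm (\matrix_(i, j) even_deriv Za j (xcoord Zb i) : 'M[sO Z]_p).
Proof.
apply/matrixP => i j; rewrite !mxE (@even_deriv_parity _ _ _ _ _ _ _ j false) ?mul1r //.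
exact: ginv_xcoord.
Qed.
Lemma jac_oddB : odm (\matrix_(i, j) odd_deriv Za j (xcoord Zb i) : 'M[sO Z]_(p, q)).
Proof.
apply/matrixP => i j; rewrite !mxE (@odd_deriv_parity _ _ _ _ _ _ _ j false) ?mulN1r //.
by rewrite mul1r ginv_xcoord.
Qed.
Lemma jac_oddC : odm (\matrix_(i, j) even_deriv Za j (tcoord Zb i) : 'M[sO Z]_(q, p)).
Proof.
apply/matrixP => i j; rewrite !mxE (@even_deriv_parity _ _ _ _ _ _ _ j true) ?mulN1r //.
exact: ginv_tcoord.
Qed.
Lemma jac_evenD : evm (\matrix_(i, j) odd_deriv Za j (tcoord Zb i) : 'M[sO Z]_q).
Proof.
apply/matrixP => i j; rewrite !mxE (@odd_deriv_parity _ _ _ _ _ _ _ j true) ?mul1r //.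
by rewrite mulN1r ginv_tcoord.
Qed.
(* The Jacobian matrix of the coordinates of b with respect to those of a. *)
Definition jac : supermx := SuperMx jac_evenA jac_oddB jac_oddC jac_evenD.

End JacobianMatrix.

Lemma jac_res a b Z Z' (Za : Z `<=` cdom a) (Zb : Z `<=` cdom b) (Z'a : Z' `<=` cdom a)
    (Z'b : Z' `<=` cdom b) (h : Z' `<=` Z) :
  [/\ sA (jac Z'a Z'b) = map_mx (sres h) (sA (jac Za Zb)),
      sB (jac Z'a Z'b) = map_mx (sres h) (sB (jac Za Zb)),
      sC (jac Z'a Z'b) = map_mx (sres h) (sC (jac Za Zb)) &
      sD (jac Z'a Z'b) = map_mx (sres h) (sD (jac Za Zb))].
Proof.
split; apply/matrixP => i j; rewrite !mxE.
- by rewrite -(sres_even_deriv Za Z'a) (sres_xcoord _ Z'b).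
- by rewrite -(sres_odd_deriv Za Z'a) (sres_xcoord _ Z'b).
- by rewrite -(sres_even_deriv Za Z'a) (sres_tcoord _ Z'b).
- by rewrite -(sres_odd_deriv Za Z'a) (sres_tcoord _ Z'b).
Qed.

Section Chain.
Variables (a b : chart M p q) (Z : opens M) (Za : Z `<=` cdom a) (Zb : Z `<=` cdom b).

Lemma even_deriv_expand j f : even_deriv Za j f =
  \sum_k even_deriv Za j (xcoord Zb k) * even_deriv Zb k f +
  \sum_al even_deriv Za j (tcoord Zb al) * ginv (odd_deriv Zb al f).
Proof.
have := vapp_expand Zb (dx_field Za j) (@subset_refl _ Z) Zb f; rewrite /=.
by rewrite (_ : subset_trans _ Za = Za) //; exact: Prop_irrelevance.
Qed.

Lemma odd_deriv_expand j f : odd_deriv Za j f =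
  \sum_k odd_deriv Za j (xcoord Zb k) * ginv (even_deriv Zb k f) +
  \sum_al odd_deriv Za j (tcoord Zb al) * odd_deriv Zb al f.
Proof.
apply: (can_inj (@ginvK R (sO Z))).
have := vapp_expand Zb (dtheta_field Za j) (@subset_refl _ Z) Zb f; rewrite /=.
rewrite (_ : subset_trans _ Za = Za) => [->|]; last exact: Prop_irrelevance.
rewrite ginvD !ginv_sum; congr (_ + _); apply: eq_bigr => k _; rewrite ginvM //.
by rewrite ginvK.
Qed.

End Chain.

(** Reordering the factors of the chain rule produces signs on the odd entries, which cancel the
    [ginv] brought in by the right odd derivatives: Jacobians multiply as plain matrices. *)
Lemma jac_chain a b c Z (Za : Z `<=` cdom a) (Zb : Z `<=` cdom b) (Zc : Z `<=` cdom c) :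
  jac Za Zc = smul (jac Zb Zc) (jac Za Zb).
Proof.
apply: supermxP; apply/matrixP => i j; rewrite [RHS]mxE [(_ *m _) i j]mxE [(_ *m _) i j]mxE mxE.
- rewrite (even_deriv_expand Za Zb); congr (_ + _); apply: eq_bigr => k _.
    by rewrite !mxE; apply: evenC; have := evm_entry k j (jac_evenA Za Zb); rewrite mxE.
  have o := odm_entry i k (jac_oddB Zb Zc); rewrite mxE in o.
  by rewrite !mxE [RHS](oddC _ o) o mulrN; have := odm_entry k j (jac_oddC Za Zb);
    rewrite mxE => ->; rewrite mulNr.
- rewrite (odd_deriv_expand Za Zb); congr (_ + _); apply: eq_bigr => k _.
    have e := evm_entry i k (jac_evenA Zb Zc); rewrite mxE in e.
    by rewrite !mxE e (evenC _ e).
  by rewrite !mxE; apply: evenC; have := evm_entry k j (jac_evenD Za Zb); rewrite mxE.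
- rewrite (even_deriv_expand Za Zb); congr (_ + _); apply: eq_bigr => k _.
    by rewrite !mxE; apply: evenC; have := evm_entry k j (jac_evenA Za Zb); rewrite mxE.
  have e := evm_entry i k (jac_evenD Zb Zc); rewrite mxE in e.
  by rewrite !mxE e (evenC _ e).
- rewrite (odd_deriv_expand Za Zb); congr (_ + _); apply: eq_bigr => k _.
    have o := odm_entry i k (jac_oddC Zb Zc); rewrite mxE in o.
    by rewrite !mxE [RHS](oddC _ o) o mulrN; have := odm_entry k j (jac_oddB Za Zb);
      rewrite mxE => ->; rewrite mulNr.
  by rewrite !mxE; apply: evenC; have := evm_entry k j (jac_evenD Za Zb); rewrite mxE.
Qed.

Lemma jac_id_D a Z (Za : Z `<=` cdom a) : sD (jac Za Za) = 1%:M.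
Proof. by apply/matrixP => i j; rewrite !mxE odd_deriv_tcoord eq_sym. Qed.

(** Both composites with the reverse change of coordinates are the identity, and their lower right
    blocks are the hypotheses of [supermx_inverses]. *)
Lemma jac_inv a b Z (Za : Z `<=` cdom a) (Zb : Z `<=` cdom b) :
  exists E, inverses (sD (jac Za Zb)) E.
Proof.
apply: (@supermx_inverses _ _ _ _ _ (jac Zb Za)).
  by rewrite -(jac_id_D Za) (jac_chain Za Zb Za).
by rewrite -(jac_id_D Zb) (jac_chain Zb Za Zb).
Qed.

Lemma sber_chain a b c Z (Za : Z `<=` cdom a) (Zb : Z `<=` cdom b) (Zc : Z `<=` cdom c) :
  sber (jac Za Zc) = sber (jac Zb Zc) * sber (jac Za Zb).
Proof.
have [E DE] := jac_inv Zb Zc; have [F DF] := jac_inv Za Zb.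
by rewrite (jac_chain Za Zb Zc) (sberM DE DF).
Qed.

Lemma sber_id a Z (Za : Z `<=` cdom a) : sber (jac Za Za) = 1.
Proof.
have DE : inverses (sD (jac Za Za)) 1%:M by rewrite jac_id_D; exact: inverses1.
rewrite (sberE DE) det1_pz mulr1 mulmx1.
rewrite (_ : sA _ - _ = 1%:M) ?det1_pz //; apply/matrixP => i j.
rewrite !mxE even_deriv_xcoord big1 ?subr0 1?eq_sym // => k _.
by rewrite !mxE odd_deriv_xcoord mul0r.
Qed.

Lemma jac_ber_res a b Z (Za : Z `<=` cdom a) (Zb : Z `<=` cdom b) (h : Z `<=` overlap a b) :
  sres h (jac_ber a b) = sber (jac Za Zb).
Proof.
have [E DE] := jac_inv (@onl _ _ _ _ a b) (@onr _ _ _ _ a b).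
have [eA eB eC eD] := jac_res (@onl _ _ _ _ a b) (@onr _ _ _ _ a b) Za Zb h.
by rewrite (sber_map eA eB eC eD DE).
Qed.

Section FieldComponents.
Variables (U Z : opens M) (X : vfield U) (ZU : Z `<=` U).
Variables (a b : chart M p q) (Za : Z `<=` cdom a) (Zb : Z `<=` cdom b).

Definition xcomp c (Zc : Z `<=` cdom c) i : sO Z := X Z ZU (xcoord Zc i).
(** With this [ginv], scaling by [f] in Pi T_M multiplies [tcomp] by [f] and [xcomp] by [ginv f]:
    what it takes to move [f] past an even contraction in dtheta and an odd one in dx. *)
Definition tcomp c (Zc : Z `<=` cdom c) al : sO Z := ginv (X Z ZU (tcoord Zc al)).

Lemma vapp_expand_sub f : X Z ZU f = \sum_i X Z ZU (xcoord Za i) * even_deriv Za i f +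
    \sum_al X Z ZU (tcoord Za al) * ginv (odd_deriv Za al f).
Proof.
have := vapp_expand Za (vres ZU X) (@subset_refl _ Z) Za f; rewrite /=.
by rewrite (_ : subset_trans _ ZU = ZU) //; exact: Prop_irrelevance.
Qed.

Lemma xcomp_change j : xcomp Zb j =
  \sum_k sA (jac Za Zb) j k * xcomp Za k - \sum_al sB (jac Za Zb) j al * tcomp Za al.
Proof.
rewrite {1}/xcomp vapp_expand_sub -sumrN; congr (_ + _); apply: eq_bigr => k _.
  by rewrite mxE; apply/esym/evenC; have := evm_entry j k (jac_evenA Za Zb); rewrite mxE.
have o := odm_entry j k (jac_oddB Za Zb); rewrite mxE in o.
by rewrite mxE (oddC _ o) ginvK o mulrN.
Qed.

Lemma tcomp_change al : tcomp Zb al =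
  - (\sum_k sC (jac Za Zb) al k * xcomp Za k) + \sum_be sD (jac Za Zb) al be * tcomp Za be.
Proof.
rewrite {1}/tcomp vapp_expand_sub ginvD !ginv_sum -sumrN; congr (_ + _); apply: eq_bigr => k _.
  have o := odm_entry al k (jac_oddC Za Zb); rewrite mxE in o.
  by rewrite mxE ginvM o mulrN (oddC _ o).
have e := evm_entry al k (jac_evenD Za Zb); rewrite mxE in e.
by rewrite mxE ginvM ginvK (evenC _ e).
Qed.

End FieldComponents.
End Jacobian.

(** * Comparison of a sheafification with a sheaf *)

Section SheafificationIso.
Context {R : realType} (M : superspace R) (P : omodPresheaf M) (G : omodSheaf M).
Variable phi : forall U : opens M, psec P U -> psec G U.
Hypothesis phi_linear : forall U (f : sO U) (s t : psec P U),
  phi (f *: s + t) = f *: phi s + phi t.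
Hypothesis phi_res : forall (U V : opens M) (VU : V `<=` U) (t : psec P U),
  phi (pres P VU t) = pres G VU (phi t).
Variable small : opens M -> Prop.
Hypothesis small_sub : forall U V : opens M, V `<=` U -> small U -> small V.
Hypothesis small_cover : forall x : M, exists U : opens M, U x /\ small U.
Hypothesis phi_inj : forall U, small U -> injective (@phi U).
Hypothesis phi_surj : forall U, small U -> forall s, exists t, @phi U t = s.

Lemma loc_eq_phi V (t t' : psec P V) : loc_eq t t' -> phi t = phi t'.
Proof.
move=> tt'; pose C : set (opens M) := [set W : opens M | W `<=` V /\
  forall WV : W `<=` V, pres P WV t = pres P WV t'].
apply: (@omod_separated _ _ G V C) => [W []|x Vx|W WV [_ E]] //.
  have [W [WV [Wx E]]] := tt' x Vx; exists W => //; split=> // WV'.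
  by rewrite (pres_irr WV' WV) E (pres_irr WV' WV).
by rewrite -!phi_res E.
Qed.

Lemma small_near (U : opens M) x : U x -> exists (W : opens M) (WU : W `<=` U), W x /\ small W.
Proof.
move=> Ux; have [W [Wx sW]] := small_cover x.
by exists (opI U W), (@opIl _ U W); split=> //; apply: small_sub sW; exact: opIr.
Qed.

Section Lift.
Variables (U : opens M) (s : psec G U).

Definition lift_rep (V : opens M) (t : psec P V) := exists VU : V `<=` U, phi t = pres G VU s.

Lemma lift_sub V t : lift_rep (V := V) t -> V `<=` U. Proof. by case. Qed.
Lemma lift_res (V W : opens M) (WV : W `<=` V) t : lift_rep t -> lift_rep (pres P WV t).
Proof.
move=> [VU E]; exists (subset_trans WV VU).
by rewrite phi_res E (pres_comp _ _ (subset_trans WV VU)).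
Qed.
Lemma lift_uniq V (t t' : psec P V) : lift_rep t -> lift_rep t' -> loc_eq t t'.
Proof.
move=> [VU E] [VU' E'] x Vx; have [W [WV [Wx sW]]] := small_near Vx.
exists W, WV; split=> //; apply: (phi_inj sW); rewrite !phi_res E E'.
by congr (pres G WV (pres G _ s)).
Qed.
Lemma lift_cover x : U x -> exists V (t : psec P V), V x /\ lift_rep t.
Proof.
move=> Ux; have [W [WU [Wx sW]]] := small_near Ux.
by have [t tE] := phi_surj sW (pres G WU s); exists W, t; split=> //; exists WU.
Qed.

(** A section of [sheafify P] is a set of local representatives, so the map out of [G] is the one
    with a direct definition: the representatives are all the [t] that [phi] sends to a restriction
    of [s]. *)
Definition lift : shsec P U := gensec lift_sub lift_res lift_uniq lift_cover.

Lemma liftI (V : opens M) (VU : V `<=` U) (t : psec P V) : phi t = pres G VU s -> lift V t.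
Proof. by move=> E; apply: (gen_in lift_sub); exists VU. Qed.

Lemma liftE V (t : psec P V) (VU : V `<=` U) : lift V t -> phi t = pres G VU s.
Proof.
move=> [_ H]; pose C : set (opens M) := [set W : opens M | W `<=` V /\
  forall WV : W `<=` V, pres G WV (phi t) = pres G WV (pres G VU s)].
apply: (@omod_separated _ _ G V C) => [W []|x Vx|W WV [_ ->]] //.
have [W [WV [Wx [WU E]]]] := H x Vx; exists W => //; split=> // WV'.
rewrite -phi_res (pres_comp _ _ WU) -E; congr (phi (pres P _ t)).
exact: Prop_irrelevance.
Qed.

End Lift.

Lemma lift_linear U : linear (@lift U).
Proof.
move=> f s t; apply/esym/shsec_loc => V u su x Vx.
have [W [WV [Wx [a [b [sa sb E]]]]]] := shaddE su Vx.
have [Z [ZW [Zx [ZU [c [sc E']]]]]] := shscaleE sa Wx.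
exists Z, (subset_trans ZW WV); split=> //; apply: (liftI (VU := ZU)).
rewrite -(pres_comp WV ZW) E presD E' phi_linear (liftE ZU sc).
rewrite (liftE ZU (shrep_res ZW sb)).
by rewrite presD presZ.
Qed.

HB.instance Definition _ U := GRing.isLinear.Build (sO U) (psec G U) (shsec P U) *:%R
  (@lift U) (@lift_linear U).

Lemma lift_inj U : injective (@lift U).
Proof.
move=> s s' E; pose C : set (opens M) := [set W : opens M | W `<=` U /\
  forall WU : W `<=` U, pres G WU s = pres G WU s'].
apply: (@omod_separated _ _ G U C) => [W []|x Ux|W WU [_ ->]] //.
have [V [t [Vx st]]] := shrep_cover (lift s) Ux.
have st' := st; rewrite E in st'.
exists V => //; split=> [|VU]; first exact: shrep_sub st.
by rewrite -(liftE VU st) (liftE VU st').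
Qed.

(** The images under [phi] of the representatives of [x] agree on overlaps, since representatives
    agree locally and [G] is separated; they glue to the required section. *)
Lemma lift_surj U (x : shsec P U) : exists s, lift s = x.
Proof.
pose C : set (opens M) := [set V : opens M | exists t : psec P V, x V t].
pose fam V : psec G V := if pselect (C V) is left e then phi (projT1 (cid e)) else 0.
have CU V : C V -> V `<=` U by move=> [t /shrep_sub].
have famE V (t : psec P V) : x V t -> fam V = phi t.
  move=> xt; rewrite /fam; case: pselect => [e|]; last by case; exists t.
  by apply: loc_eq_phi; apply: shrep_uniq xt; case: (cid e).
have [|V W Z ZV ZW [t xt] [t' xt']|s sE] := @omod_gluing _ _ G U C CU _ fam.
- by move=> y Uy; have [V [t [Vy xt]]] := shrep_cover x Uy; exists V => //; exists t.
- rewrite (famE _ _ xt) (famE _ _ xt') -!phi_res; apply: loc_eq_phi.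
  exact: shrep_uniq (shrep_res ZV xt) (shrep_res ZW xt').
exists s; apply/esym/shsec_le => V t xt.
have VU := shrep_sub xt; apply: (liftI (VU := VU)).
by rewrite sE ?(famE _ _ xt) //; exists t.
Qed.

Lemma sheafify_iso : omod_iso G (sheafify P).
Proof.
exists (fun U => lift (U := U) : {linear psec G U -> shsec P U}); split=> [U|U V VU s].
  have [g gK] := choice (@lift_surj U).
  by exists g => [s|x]; [apply: lift_inj; rewrite gK|exact: gK].
apply: shsec_le => W t st; have WV := shrep_sub st; split=> //.
apply: (liftI (VU := subset_trans WV VU)).
by rewrite (liftE WV st) (pres_comp _ _ (subset_trans WV VU)).
Qed.

End SheafificationIso.

(** * Right contraction with vector fields *)

Section RightContraction.
Context {R : realType} {A : superAlgType R} {p q : nat}.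
Local Notation W := (@dform R A p q).
Implicit Types (w : W) (f : A) (e : {set 'I_p}) (l : {ffun 'I_q -> nat}).

Definition gp (b : bool) f : A := if b then ginv f else f.

Lemma gpD b : {morph gp b : f g / f + g}.
Proof. by case: b => f g //=; rewrite ginvD. Qed.
Lemma gpM b : {morph gp b : f g / f * g}.
Proof. by case: b => f g //=; rewrite ginvM. Qed.
Lemma gp0 b : gp b 0 = 0. Proof. by case: b; rewrite /= ?ginv0. Qed.
Lemma gpN b f : gp b (- f) = - gp b f. Proof. by case: b; rewrite /= ?ginvN. Qed.
Lemma gp_gp b c f : gp b (gp c f) = gp (b (+) c) f.
Proof. by case: b; case: c; rewrite //= ginvK. Qed.
Lemma gp_sum b (J : Type) (r : seq J) (P : pred J) (F : J -> A) :
  gp b (\sum_(j <- r | P j) F j) = \sum_(j <- r | P j) gp b (F j).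
Proof. by case: b; rewrite //= ginv_sum. Qed.
Lemma gp_ev b f : ginv f = f -> gp b f = f. Proof. by case: b. Qed.
Lemma gp_od b f : ginv f = - f -> gp b f = (-1) ^+ b * f.
Proof. by case: b => /= h; rewrite ?h ?expr0 ?expr1 ?mulN1r ?mul1r. Qed.

Lemma homog_comm (b : bool) (x f : A) : ginv x = (-1) ^+ b * x -> x * f = gp b f * x.
Proof.
case: b => /=; first by rewrite expr1 mulN1r => /oddC ->.
by rewrite expr0 mul1r => /evenC ->.
Qed.

(** The parity of (dx)^e delta^(l): each of the [q] delta symbols is odd, whatever the order of its
    derivative. *)
Definition par e := odd (#|e| + q).

Lemma parU1 e j : j \notin e -> par (j |: e)%SET = ~~ par e.
Proof. by move=> je; rewrite /par cardsU1 je add1n addSn. Qed.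

Lemma parD1 e j : j \in e -> par (e :\ j)%SET = ~~ par e.
Proof. by move=> je; rewrite /par [in RHS](cardsD1 j) je add1n addSn /= negbK. Qed.

(** Multiplication by [f] on the right: [f] is moved past the monomial to join the coefficient on
    the left. *)
Definition rmulW w f : W := fun e l => w e l * gp (par e) f.

(** Up to a constant factor -1, the sign is that of moving dx_j to the right end, past the later
    dx's and the [q] delta symbols. The coefficient on the left is not passed, hence no [ginv]. *)
Definition rdx (j : 'I_p) w : W := fun e l => if j \in e then 0 else
  (-1) ^+ (#|[pred i in e | (i < j)%N]| + ~~ par e) * w (j |: e)%SET l.

(** Acting from the right, it leaves the coefficients on the left alone and so is left linear, see
    [rcon_lsc]; the components [u] and [t] enter by right multiplication, see [rconE]. *)
Definition rcon (u : 'I_p -> A) (t : 'I_q -> A) w : W := fun e l =>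
  \sum_j rdx j w e l * gp (par e) (u j) + \sum_be ddtheta be w e l * gp (par e) (t be).

Lemma rdx_add j : addop (rdx j).
Proof.
by move=> w w'; apply: dformP => e l; rewrite dformD /rdx dformD; case: ifP => _;
  rewrite ?addr0 // mulrDr.
Qed.

Lemma rcon_add u t : addop (rcon u t).
Proof.
move=> w w'; apply: dformP => e l; rewrite dformD /rcon addrACA -!big_split.
congr (_ + _); apply: eq_bigr => j _ /=; rewrite -mulrDl; congr (_ * _).
  exact: (f_equal (fun w : W => w e l) (rdx_add j w w')).
exact: (f_equal (fun w : W => w e l) (ddtheta_add j w w')).
Qed.

Lemma rdx_lsc j f w : rdx j (lsc f w) = lsc f (rdx j w).
Proof.
by apply: dformP => e l; rewrite /rdx /lsc; case: ifP => _; rewrite ?mulr0 // !mulrA sign_comm.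
Qed.

Lemma rcon_lsc u t f w : rcon u t (lsc f w) = lsc f (rcon u t w).
Proof.
apply: dformP => e l; rewrite [RHS]/lsc /rcon mulrDr !big_distrr.
by congr (_ + _); apply: eq_bigr => j _; rewrite ?rdx_lsc ?ddtheta_lsc /lsc /= mulrA.
Qed.

Lemma rconDl u u' t t' w : rcon (fun j => u j + u' j) (fun be => t be + t' be) w =
  rcon u t w + rcon u' t' w.
Proof.
apply: dformP => e l; rewrite dformD /rcon addrACA -!big_split.
by congr (_ + _); apply: eq_bigr => j _ /=; rewrite gpD mulrDr.
Qed.

(** The source of the balancing relations, together with [rcon_rscale]: a scalar between the form
    and the field may be attached to either. The [ginv] comes from passing an odd contraction in
    dx_j. *)
Lemma rcon_scale u t f w :
  rcon (fun j => ginv f * u j) (fun be => f * t be) w = rcon u t (rmulW w f).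
Proof.
apply: dformP => e l; rewrite /rcon; congr (_ + _); apply: eq_bigr => j _.
  rewrite /rdx /rmulW; case: ifPn => je; first by rewrite !mul0r.
  rewrite -!mulrA; congr (_ * (_ * _)); rewrite parU1 // gpM; congr (_ * _).
  by case: (par e) => //=; rewrite ginvK.
rewrite /ddtheta /rmulW; case: ifP => _; first by rewrite !mul0r.
by rewrite gpM mulrA.
Qed.

Lemma rcon_rscale u t f w :
  rcon (fun j => u j * f) (fun be => t be * f) w = rmulW (rcon u t w) f.
Proof.
apply: dformP => e l; rewrite /rcon /rmulW mulrDl !big_distrl.
by congr (_ + _); apply: eq_bigr => j _ /=; rewrite gpM mulrA.
Qed.

Lemma rdxC i j w : rdx i (rdx j w) = - rdx j (rdx i w).
Proof.
apply: dformP => e l; rewrite dformN /rdx !inE.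
case: (i =P j) => [->|/eqP ij]; first by rewrite eqxx /= mulr0 if_same oppr0.
rewrite (eq_sym j i) (negbTE ij) /=.
case: (boolP (i \in e)) => ie; case: (boolP (j \in e)) => je; rewrite /= ?mulr0 ?oppr0 //.
rewrite !mulrA -!exprD (@card_below_U1 _ e i j) // (@card_below_U1 _ e j i) //.
rewrite !parU1 // finset.setUCA -mulNr; congr (_ * _).
have -> : (i < j)%N = ~~ (j < i)%N.
  by rewrite -leqNgt [RHS]leq_eqVlt (negbTE (ij : (i != j :> nat))).
rewrite -(signr_odd _ (_ + _)) -[in RHS](signr_odd _ (_ + _)).
rewrite !oddD !oddb; case: (j < i)%N => /=; case: (odd _); case: (odd _); case: (par e);
  rewrite //= ?expr0 ?expr1 ?opprK //.
Qed.

Lemma rdx_ddtheta j be w : rdx j (ddtheta be w) = ddtheta be (rdx j w).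
Proof.
apply: dformP => e l; rewrite /rdx /ddtheta; case: ifP => _; case: ifP => _ //.
by rewrite mulr0.
Qed.

Lemma rdx_rmulW j w f : rdx j (rmulW w f) = rmulW (rdx j w) (ginv f).
Proof.
apply: dformP => e l; rewrite /rdx /rmulW; case: ifPn => je; first by rewrite mul0r.
by rewrite parU1 // mulrA; case: (par e); rewrite //= ginvK.
Qed.

Lemma ddtheta_rmulW be w f : ddtheta be (rmulW w f) = rmulW (ddtheta be w) f.
Proof.
by apply: dformP => e l; rewrite /ddtheta /rmulW; case: ifP => // _; rewrite mul0r.
Qed.

Lemma rconE u t w : rcon u t w = \sum_j rmulW (rdx j w) (u j) + \sum_be rmulW (ddtheta be w) (t be).
Proof. by apply: dformP => e l; rewrite dformD !dform_sum. Qed.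

Lemma rmulWA w f g : rmulW (rmulW w f) g = rmulW w (f * g).
Proof. by apply: dformP => e l; rewrite /rmulW gpM mulrA. Qed.

Lemma rmulW_sgn w (b : bool) f : rmulW w ((-1) ^+ b * f) = lsc ((-1) ^+ b) (rmulW w f).
Proof.
apply: dformP => e l; rewrite /rmulW /lsc gpM.
rewrite (_ : gp _ ((-1) ^+ b) = (-1) ^+ b); last first.
  by rewrite gp_ev // -[(-1) ^+ b]mulr1 ginv_sign ginv1.
by rewrite !mulrA; congr (_ * _); rewrite sign_comm.
Qed.

Lemma rmulW_sum (J : finType) (F : J -> W) f :
  rmulW (\sum_j F j) f = \sum_j rmulW (F j) f.
Proof. by apply: dformP => e l; rewrite /rmulW !dform_sum big_distrl. Qed.

(* c and c' are the parities of the two elements of Pi T. *)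
Lemma rconC (c c' : bool) u t u' t' w :
  (forall j, ginv (u j) = (-1) ^+ (~~ c) * u j) -> (forall be, ginv (t be) = (-1) ^+ c * t be) ->
  (forall j, ginv (u' j) = (-1) ^+ (~~ c') * u' j) -> (forall be, ginv (t' be) = (-1) ^+ c' * t' be) ->
  rcon u' t' (rcon u t w) = lsc ((-1) ^+ (c && c')) (rcon u t (rcon u' t' w)).
Proof.
move=> hu ht hu' ht'.
have E (v : 'I_p -> A) (s : 'I_q -> A) (v' : 'I_p -> A) (s' : 'I_q -> A) : rcon v' s' (rcon v s w) =
    \sum_i \sum_j rmulW (rdx i (rdx j w)) (ginv (v j) * v' i) +
    \sum_i \sum_be rmulW (rdx i (ddtheta be w)) (ginv (s be) * v' i) +
    (\sum_al \sum_j rmulW (ddtheta al (rdx j w)) (v j * s' al) +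
     \sum_al \sum_be rmulW (ddtheta al (ddtheta be w)) (s be * s' al)).
  rewrite [LHS]rconE [rcon v s w]rconE; congr (_ + _); rewrite -big_split; apply: eq_bigr => i _ /=.
    rewrite rdx_add !(addop_sum (rdx_add i)).
    rewrite (_ : rmulW (_ + _) _ = rmulW (\sum_j rdx i (rmulW (rdx j w) (v j))) (v' i) +
      rmulW (\sum_be rdx i (rmulW (ddtheta be w) (s be))) (v' i)); last first.
      by apply: dformP => e l; rewrite /rmulW dformD mulrDl.
    by rewrite !rmulW_sum; congr (_ + _); apply: eq_bigr => j _; rewrite rdx_rmulW rmulWA.
  rewrite ddtheta_add !(addop_sum (ddtheta_add i)).
  rewrite (_ : rmulW (_ + _) _ = rmulW (\sum_j ddtheta i (rmulW (rdx j w) (v j))) (s' i) +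
    rmulW (\sum_be ddtheta i (rmulW (ddtheta be w) (s be))) (s' i)); last first.
    by apply: dformP => e l; rewrite /rmulW dformD mulrDl.
  by rewrite !rmulW_sum; congr (_ + _); apply: eq_bigr => j _; rewrite ddtheta_rmulW rmulWA.
have lN (x : W) f : rmulW (- x) f = rmulW x (- f).
  by apply: dformP => e l; rewrite /rmulW dformN gpN mulrN mulNr.
rewrite !E !lscDr !lsc_sumr -!addrA.
rewrite [X in _ = _ + X]addrCA; congr (_ + _); last congr (_ + _); last congr (_ + _).
- rewrite exchange_big; apply: eq_bigr => i _ /=.
  rewrite lsc_sumr; apply: eq_bigr => j _.
  rewrite rdxC lN -rmulW_sgn; congr (rmulW _ _); rewrite hu hu' -mulrA (superC _ _ _ _ (hu i) (hu' j)).
  by case: (c); case: (c'); rewrite /= ?expr0 ?expr1 ?mul1r ?mulN1r ?mulNr ?mulrN ?opprK.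
- rewrite exchange_big; apply: eq_bigr => be _ /=.
  rewrite lsc_sumr; apply: eq_bigr => i _.
  rewrite rdx_ddtheta -rmulW_sgn; congr (rmulW _ _); rewrite ht -mulrA (superC _ _ _ _ (ht be) (hu' i)).
  by case: (c); case: (c'); rewrite /= ?expr0 ?expr1 ?mul1r ?mulN1r ?mulNr ?mulrN ?opprK.
- rewrite exchange_big; apply: eq_bigr => j _ /=.
  rewrite lsc_sumr; apply: eq_bigr => al _.
  rewrite rdx_ddtheta -rmulW_sgn; congr (rmulW _ _); rewrite ht' -mulrA (superC _ _ _ _ (hu j) (ht' al)).
  by case: (c); case: (c'); rewrite /= ?expr0 ?expr1 ?mul1r ?mulN1r ?mulNr ?mulrN ?opprK.
- rewrite exchange_big; apply: eq_bigr => be _ /=.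
  rewrite lsc_sumr; apply: eq_bigr => al _.
  by rewrite ddthetaC -rmulW_sgn; congr (rmulW _ _); rewrite (superC _ _ _ _ (ht be) (ht' al)).
Qed.

Lemma hdeg_rcon a b u t w : hdeg a b w -> hdeg a.+1 b (rcon u t w).
Proof.
move=> hw e l el; rewrite /rcon !big1 ?addr0 // => i _.
  by rewrite (hdeg_ddtheta i hw) ?mul0r.
rewrite /rdx; case: ifPn => ie; first by rewrite mul0r.
by rewrite hw ?mulr0 ?mul0r // cardsU1 ie add1n addSn -addnS.
Qed.

Definition top (c : A) : W := fun e l =>
  if (e == finset.setT) && (l == [ffun=> 0%N]) then c else 0.

Lemma hdeg_top c : hdeg 0 p (top c).
Proof.
move=> e l el; rewrite /top; case: ifP => // /andP [/eqP eT /eqP l0]; move: el.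
by rewrite eT l0 cardsT card_ord addn0 big1 ?add0n ?eqxx // => al _; rewrite ffunE.
Qed.

Lemma topD : {morph top : c d / c + d}.
Proof. by move=> c d; apply: dformP => e l; rewrite dformD /top; case: ifP; rewrite ?addr0. Qed.

Lemma topZ f c : top (f * c) = lsc f (top c).
Proof. by apply: dformP => e l; rewrite /lsc /top; case: ifP; rewrite ?mulr0. Qed.

Lemma top_rmulW c f : top (c * gp (odd (p + q)) f) = rmulW (top c) f.
Proof.
apply: dformP => e l; rewrite /rmulW /top; case: ifP => [/andP [/eqP -> _]|_]; last by rewrite mul0r.
by rewrite /par cardsT card_ord.
Qed.

End RightContraction.

(** * Substitution intertwines the contractions *)

Section SubstitutionContraction.
Context {R : realType} {A : superAlgType R} {p q : nat}.
Local Notation W := (@dform R A p q).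
Local Notation parq := (@par p q).
Variables (J : @supermx R A p q) (T : {set 'I_p} -> ('I_q -> nat) -> W).
Hypothesis T_con : forall k e n, dx_con k (T e n) =
  \sum_(i in e) lsc ((-1) ^+ #|[pred j in e | (j < i)%N]| * sA J i k) (T (e :\ i)%SET n) -
  \sum_al lsc (sC J al k) (T e (incr_at n al)).
Hypothesis T_ddtheta : forall ga e n, ddtheta ga (T e n) =
  \sum_(i in e) lsc ((-1) ^+ #|[pred j in e | (j < i)%N]| * sB J i ga) (T (e :\ i)%SET n) +
  \sum_al lsc (sD J al ga) (T e (incr_at n al)).
Hypothesis T_ginv : forall e n e' l, ginv (T e n e' l) = (-1) ^+ (#|e| + #|e'|) * T e n e' l.

Variables (u : 'I_p -> A) (t : 'I_q -> A).
Let ub i := \sum_k sA J i k * u k - \sum_ga sB J i ga * t ga.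
Let tb al := - (\sum_k sC J al k * u k) + \sum_ga sD J al ga * t ga.

(** The coefficient at [e'] has parity [#|e| + #|e'|], the difference of the parities of the two
    monomials. *)
Lemma T_comm e n e' l f :
  T e n e' l * gp (parq e') f = gp (parq e) f * T e n e' l.
Proof.
rewrite (@homog_comm _ _ (odd (#|e| + #|e'|))) ?gp_gp; last by rewrite signr_odd T_ginv.
by congr (gp _ _ * _); rewrite /parq !oddD; case: (odd #|e|); case: (odd #|e'|); case: (odd q).
Qed.

Lemma T_rdx k e n : rdx k (T e n) = lsc ((-1) ^+ parq e) (dx_con k (T e n)).
Proof.
apply: dformP => e' l; rewrite /rdx /lsc /dx_con; case: ifPn => ke; first by rewrite mulr0.
rewrite T_ginv !mulrA -!exprD cardsU1 ke add1n; congr (_ * _).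
rewrite -(signr_odd _ (_ + _)) -[RHS](signr_odd _ (_ + _)) /parq !oddD /= !oddb.
by congr (_ ^+ _); rewrite ?oddD /=; case: (odd _); case: (odd #|e|); case: (odd q); case: (odd #|e'|).
Qed.

(** The entries of [J] pass from the contraction rules for [T] into the components: [ub] and [tb]
    are those of the same vector field in the other coordinates, by [xcomp_change] and
    [tcomp_change]. *)
Lemma T_rcon e n : rcon u t (T e n) =
  \sum_(i in e) lsc ((-1) ^+ (#|[pred j in e | (j < i)%N]| +
    parq e) * gp (~~ parq e) (ub i)) (T (e :\ i)%SET n) +
  \sum_al lsc (gp (parq e) (tb al)) (T e (incr_at n al)).
Proof.
apply: dformP => e' l; rewrite dformD !dform_sum /rcon.
transitivity (\sum_k ((-1) ^+ parq e * (
      \sum_(i in e) (-1) ^+ #|[pred j in e | (j < i)%N]| * sA J i k * (gp (~~ parq e) (u k) * T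
        (e :\ i)%SET n e' l) -
      \sum_al sC J al k * (gp (parq e) (u k) * T e (incr_at n al) e' l))) +
    \sum_ga (\sum_(i in e) (-1) ^+ #|[pred j in e | (j < i)%N]| * sB J i ga * (gp (~~ parq e)
      (t ga) * T (e :\ i)%SET n e' l) +
      \sum_al sD J al ga * (gp (parq e) (t ga) * T e (incr_at n al) e' l))).
  congr (_ + _); apply: eq_bigr => k _.
    rewrite T_rdx T_con /lsc dformD dformN !dform_sum -mulrA; congr (_ * _).
    rewrite mulrBl !big_distrl; congr (_ - _); apply: eq_bigr => i ie;
      rewrite /lsc /= -[LHS]mulrA T_comm //.
    by rewrite parD1.
  rewrite T_ddtheta dformD !dform_sum mulrDl !big_distrl.
  congr (_ + _); apply: eq_bigr => i ie; rewrite /lsc /= -[LHS]mulrA T_comm //.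
  by rewrite parD1.
rewrite -big_distrr /= sumrB big_split /= mulrBr.
rewrite [X in (-1) ^+ _ * X - _ + _]exchange_big [X in _ - (-1) ^+ _ * X + _]exchange_big.
rewrite [X in _ + (X + _)]exchange_big [X in _ + (_ + X)]exchange_big /=.
rewrite addrACA !big_distrr -sumrN -!big_split /=; congr (_ + _).
  apply: eq_bigr => i ie; rewrite /lsc /ub gpD gpN !gp_sum.
  rewrite mulrBr mulrBl !big_distrr !big_distrl -sumrN /=; congr (_ + _); apply: eq_bigr => k _.
    rewrite gpM (gp_ev _ (evm_entry i k (sA_even J))).
    by rewrite [(_ + parq e)%N]addnC exprD !mulrA.
  rewrite gpM (gp_od _ (odm_entry i k (sB_odd J))) !mulrA -!mulNr; congr (_ * _ * _ * _).
  rewrite mulNr -exprD -[RHS]mulN1r -exprS -signr_odd -[RHS]signr_odd.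
  by rewrite /= !oddD; case: (parq e); case: (odd _).
apply: eq_bigr => al _; rewrite /lsc /tb gpD gpN !gp_sum mulrDl !big_distrl -!sumrN !big_distrr.
rewrite -!sumrN /=; congr (_ + _); last first.
  by apply: eq_bigr => ga _; rewrite gpM (gp_ev _ (evm_entry al ga (sD_even J))) mulrA.
rewrite big_distrl /=; apply: eq_bigr => k _.
by rewrite gpM (gp_od _ (odm_entry al k (sC_odd J))) !mulrA -mulNr.
Qed.

(** The linear extension of the substitution to delta forms; the bound [N] on the exponents makes it
    a finite sum. *)
Definition tsum N w : W := \sum_(e : {set 'I_p}) \sum_(l : {ffun 'I_q -> 'I_N.+1})
  lsc (w e [ffun al => l al : nat]) (T e (fun al => l al)).

Lemma sum_U1 (V : nmodType) (j : 'I_p) (F : {set 'I_p} -> V) :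
  \sum_(e : {set 'I_p} | j \notin e) F (j |: e)%SET = \sum_(e : {set 'I_p} | j \in e) F e.
Proof.
rewrite [RHS](reindex_onto (fun e => j |: e)%SET (fun e => e :\ j)%SET) => [|e je]; last first.
  exact: finset.setD1K.
apply: eq_bigl => e; rewrite finset.setU11 /=; apply/idP/eqP => [/finset.setU1K //|<-].
by rewrite finset.setD11.
Qed.

(** The two sides have the same terms in a different indexing: [sum_U1] accounts for the dx that is
    removed, [shift_sum] for the exponent that is raised. The hypothesis leaves room below [N] for
    one more derivative. *)
Lemma tsum_rcon N w : (forall e (l : {ffun 'I_q -> nat}) al, (N <= l al)%N -> w e l = 0) ->
  tsum N (rcon ub tb w) = rcon u t (tsum N w).
Proof.
move=> wN; have radd := rcon_add u t; rewrite /tsum (addop_sum radd).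
transitivity (\sum_(e : {set 'I_p}) \sum_(l : {ffun 'I_q -> 'I_N.+1})
  (\sum_j lsc (rdx j w e [ffun al => l al : nat] * gp (parq e) (ub j)) (T e (fun al => l al)) +
   \sum_al lsc (ddtheta al w e [ffun al => l al : nat] * gp (parq e) (tb al)) (T e (fun al => l al)))).
  by apply: eq_bigr => e _; apply: eq_bigr => l _; rewrite /rcon lscDl !lsc_suml.
transitivity (\sum_(e : {set 'I_p}) \sum_(l : {ffun 'I_q -> 'I_N.+1})
  (\sum_(i in e) lsc (w e [ffun al => l al : nat] * ((-1) ^+ (#|[pred j in e | (j < i)%N]| + parq e) *
      gp (~~ parq e) (ub i))) (T (e :\ i)%SET (fun al => l al)) +
   \sum_al lsc (w e [ffun al => l al : nat] * gp (parq e) (tb al)) (T e (incr_at (fun al =>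
     l al) al)))); last first.
  apply: eq_bigr => e _; rewrite (addop_sum radd); apply: eq_bigr => l _.
  rewrite rcon_lsc T_rcon lscDr !lsc_sumr.
  by congr (_ + _); apply: eq_bigr => i _; rewrite lscA.
under eq_bigr do rewrite big_split /=.
under [RHS]eq_bigr do rewrite big_split /=.
rewrite !big_split /=; congr (_ + _).
  rewrite exchange_big [RHS]exchange_big /=; apply: eq_bigr => l _.
  rewrite exchange_big [RHS](exchange_big_dep xpredT) //=; apply: eq_bigr => j _.
  rewrite -sum_U1 [LHS](bigID (fun e : {set 'I_p} => j \in e)) /= big1 ?add0r => [|e je].
    apply: eq_bigr => e je; rewrite /rdx (negbTE je) parU1 // negbK finset.setU1K //.
    rewrite card_below_U1 // ltnn; congr lsc; rewrite !mulrA.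
    by rewrite add0n [in LHS]sign_comm.
  by rewrite /rdx je mul0r lsc0l.
apply: eq_bigr => e _; rewrite exchange_big [RHS]exchange_big /=; apply: eq_bigr => al _.
rewrite -(@shift_sum q N _ al (fun m => lsc (w e [ffun k => m k] * gp (parq e) (tb al))
   (T e (incr_at m al)))) => [|m mN]; last by rewrite (wN _ _ al) ?mul0r ?lsc0l // ffunE mN.
apply: eq_bigr => l _; rewrite /ddtheta ffunE; case: eqP => [_|/eqP l0].
  by rewrite mul0r lsc0l.
rewrite (@decr_atK _ (fun k => l k) al l0); congr (lsc (w e _ * _) _).
by apply/ffunP => k; rewrite !ffunE.
Qed.

Lemma tsum_top N c : (forall e l, T finset.setT (fun _ => 0%N) e l =
    if (e == finset.setT) && (l == [ffun=> 0%N]) then T finset.setT (fun _ =>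
      0%N) finset.setT [ffun=> 0%N] else 0) ->
  tsum N (top c) = top (c * T finset.setT (fun _ => 0%N) finset.setT [ffun=> 0%N]).
Proof.
move=> Ttop; rewrite /tsum (bigD1 finset.setT) //= [X in _ + X]big1 ?addr0 => [|e eT]; last first.
  by rewrite big1 // => l _; rewrite /top (negbTE eT) lsc0l.
rewrite (bigD1 [ffun=> ord0]) //= [X in _ + X]big1 ?addr0 => [|l l0]; last first.
  rewrite /top eqxx; case: eqP => [E|_]; last exact: lsc0l.
  case/negP: l0; apply/eqP/ffunP => al; apply/val_inj.
  by have := f_equal (fun h : {ffun 'I_q -> nat} => h al) E; rewrite !ffunE.
pose l0 : {ffun 'I_q -> 'I_N.+1} := [ffun=> ord0].
rewrite -/l0; have -> : [ffun al => l0 al : nat] = [ffun=> 0%N].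
  by apply/ffunP => al; rewrite !ffunE.
have -> : (fun al : 'I_q => l0 al : nat) = fun _ => 0%N.
  by apply/funext => al; rewrite ffunE.
apply: dformP => e l; rewrite /lsc Ttop /top !eqxx /=.
by case: ifP; rewrite ?mulr0.
Qed.

End SubstitutionContraction.

(** * Contraction with words of vector fields *)

Section Words.
Context {R : realType} {p q : nat} {M : supermanifold R p q}.
Implicit Types (a b c : chart M p q) (U V Z : opens M).

Section Word.
Variables (U Z : opens M) (ZU : Z `<=` U) (c : chart M p q) (Zc : Z `<=` cdom c).
Local Notation W := (@dform R (sO Z) p q).
Implicit Types (w : W) (X Y : PiT U) (f : sO U).

Definition vcon w X : W := rcon (xcomp X ZU Zc) (tcomp X ZU Zc) w.
Definition vword w (s : seq (PiT U)) : W := foldl vcon w s.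

Lemma vcon_add X : addop (vcon^~ X). Proof. exact: rcon_add. Qed.
Lemma vcon_lsc X g w : vcon (lsc g w) X = lsc g (vcon w X). Proof. exact: rcon_lsc. Qed.

Lemma vword_cat w s s' : vword w (s ++ s') = vword (vword w s) s'.
Proof. exact: foldl_cat. Qed.
Lemma vword_add s : addop (vword^~ s).
Proof. by move=> w w'; elim: s w w' => //= X s IHs w w'; rewrite vcon_add IHs. Qed.
Lemma vword_lsc s g w : vword (lsc g w) s = lsc g (vword w s).
Proof. by elim: s w => //= X s IHs w; rewrite vcon_lsc IHs. Qed.

Lemma vconD w X Y : vcon w (X + Y) = vcon w X + vcon w Y.
Proof.
rewrite /vcon -rconDl; congr rcon; apply/funext => i //.
by rewrite /tcomp -[vapp (X + Y) _ _]/(X _ _ _ + Y _ _ _) ginvD.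
Qed.

Lemma hdeg_vword k l w s : hdeg k l w -> hdeg (size s + k) l (vword w s).
Proof.
elim: s k w => //= X s IHs k w hw; rewrite addSnnS; apply: IHs.
exact: hdeg_rcon.
Qed.

Lemma vcon_scale w f X : vcon w (f *: X) = vcon (rmulW w (sres ZU f)) X.
Proof.
rewrite /vcon -rcon_scale; congr rcon; apply/funext => i.
  by rewrite -sres_ginv.
by rewrite /tcomp -[vapp _ _ _]/(sres ZU (ginv f) * X _ _ _) ginvM -sres_ginv ginvK.
Qed.

Lemma pginvE X V (VU : V `<=` U) g : pginv X V VU g = - ginv (X V VU (ginv g)).
Proof. by rewrite -[LHS]/(sres _ (-1) * _) rmorphN1 mulN1r. Qed.

Lemma xcomp_pginv X i : xcomp (pginv X) ZU Zc i = - ginv (xcomp X ZU Zc i).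
Proof. by rewrite /xcomp pginvE ginv_xcoord. Qed.

Lemma tcomp_pginv X al : tcomp (pginv X) ZU Zc al = ginv (tcomp X ZU Zc al).
Proof. by rewrite /tcomp pginvE ginv_tcoord vappN !ginvN opprK. Qed.

Lemma xcomp_scale f X i : xcomp (f *: X) ZU Zc i = ginv (sres ZU f) * xcomp X ZU Zc i.
Proof. by rewrite -sres_ginv. Qed.
Lemma tcomp_scale f X al : tcomp (f *: X) ZU Zc al = sres ZU f * tcomp X ZU Zc al.
Proof.
by rewrite /tcomp -[vapp _ _ _]/(sres ZU (ginv f) * X _ _ _) ginvM -sres_ginv ginvK.
Qed.
Lemma xcompD X Y i : xcomp (X + Y) ZU Zc i = xcomp X ZU Zc i + xcomp Y ZU Zc i.
Proof. by []. Qed.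
Lemma tcompD X Y al : tcomp (X + Y) ZU Zc al = tcomp X ZU Zc al + tcomp Y ZU Zc al.
Proof. by rewrite /tcomp -[vapp (X + Y) _ _]/(X _ _ _ + Y _ _ _) ginvD. Qed.

Lemma even_odd_mulr (A : superAlgType R) (g u : A) :
  evenpart g * u + oddpart g * ginv u = u * g.
Proof.
by rewrite (evenC u (ginv_even g)) (oddC (ginv u) (ginv_odd g)) ginvK -mulrDr evenpart_odd.
Qed.

Lemma vcon_rscale w f X : vcon w (rscale (@pginv _ _ U) X f) = rmulW (vcon w X) (sres ZU f).
Proof.
rewrite /vcon -rcon_rscale; congr rcon; apply/funext => i.
  rewrite xcompD !xcomp_scale xcomp_pginv -!sres_ginv ginv_even ginv_odd rmorphN mulrNN.
  by rewrite sres_even sres_odd even_odd_mulr.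
by rewrite tcompD !tcomp_scale tcomp_pginv sres_even sres_odd even_odd_mulr.
Qed.

Lemma vcon_swap w X Y (c1 c2 : bool) : pginv X = (-1) ^+ c1 *: X -> pginv Y = (-1) ^+ c2 *: Y ->
  vcon (vcon w X) Y = lsc ((-1) ^+ (c1 && c2)) (vcon (vcon w Y) X).
Proof.
have E (d : bool) T : pginv T = (-1) ^+ d *: T ->
    (forall i, ginv (xcomp T ZU Zc i) = (-1) ^+ (~~ d) * xcomp T ZU Zc i) /\
    (forall al, ginv (tcomp T ZU Zc al) = (-1) ^+ d * tcomp T ZU Zc al).
  move=> Td; split=> i.
    rewrite -[LHS]opprK -xcomp_pginv Td xcomp_scale rmorph_sign -[(-1) ^+ d]mulr1 ginv_sign ginv1 mulr1.
    by case: (d); rewrite /= ?expr0 ?expr1 ?mulN1r ?mul1r ?opprK.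
  by rewrite -tcomp_pginv Td tcomp_scale rmorph_sign.
by move=> /E [uX tX] /E [uY tY]; apply: rconC.
Qed.

End Word.

Lemma vword_res U Z Z' (ZU : Z `<=` U) (Z'U : Z' `<=` U) c (Zc : Z `<=` cdom c)
    (Z'c : Z' `<=` cdom c) (h : Z' `<=` Z) w w' (s : seq (PiT U)) :
  (forall e l, sres h (w e l) = w' e l) ->
  forall e l, sres h (vword ZU Zc w s e l) = vword Z'U Z'c w' s e l.
Proof.
elim: s w w' => //= X s IHs w w' ww'; apply: IHs => e l.
rewrite /vcon /rcon rmorphD !rmorph_sum.
have gpS (d : bool) f : sres h (gp d f) = gp d (sres h f) by case: d; rewrite /= ?sres_ginv.
have uE i : sres h (xcomp X ZU Zc i) = xcomp X Z'U Z'c i.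
  by rewrite /xcomp -(vapp_res X ZU Z'U) sres_xcoord.
have tE al : sres h (tcomp X ZU Zc al) = tcomp X Z'U Z'c al.
  by rewrite /tcomp sres_ginv -(vapp_res X ZU Z'U) sres_tcoord.
congr (_ + _); apply: eq_bigr => j _; rewrite rmorphM gpS ?uE ?tE; congr (_ * _).
  by rewrite /rdx; case: ifP => _; rewrite ?rmorph0 // rmorphMsign ww'.
by rewrite /ddtheta; case: ifP => _; rewrite ?rmorph0 // ww'.
Qed.

Section Change.
Variables (a b : chart M p q) (Z : opens M) (Za : Z `<=` cdom a) (Zb : Z `<=` cdom b).
Variable h : Z `<=` overlap a b.

Definition smon_res e n : @dform R (sO Z) p q := fun e' l =>
  sres h (smon (jac (@onl _ _ _ _ a b) (@onr _ _ _ _ a b)) e n e' l).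

Let DE := jac_inv (@onl _ _ _ _ a b) (@onr _ _ _ _ a b).

(** Induction on the word, starting from the top form, which the substitution multiplies by the
    Berezinian; the letters are moved through one by one with [tsum_rcon]. *)
Lemma vword_change U (ZU : Z `<=` U) (s : seq (PiT U)) (d : sO Z) N : (size s <= N)%N ->
  tsum smon_res N (vword ZU Zb (top d) s) = vword ZU Za (top (d * sber (jac Za Zb))) s.
Proof.
have [E E_inv] := DE.
have [eA eB eC eD] := jac_res (@onl _ _ _ _ a b) (@onr _ _ _ _ a b) Za Zb h.
have T_con k e n : dx_con k (smon_res e n) =
    \sum_(i in e) lsc ((-1) ^+ #|[pred j in e | (j < i)%N]| * sA (jac Za Zb) i k) (smon_res (e
      :\ i)%SET n) -
    \sum_al lsc (sC (jac Za Zb) al k) (smon_res e (incr_at n al)).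
  apply: dformP => e' l; transitivity (sres h (dx_con k (smon (jac (@onl _ _ _ _ a b) (@onr _ _
    _ _ a b)) e n) e' l)).
    by rewrite /dx_con; case: ifP => _; rewrite ?rmorph0 // rmorphMsign sres_ginv.
  rewrite (dx_con_smon E_inv) eA eC !dformD !dformN !dform_sum rmorphB !rmorph_sum.
  congr (_ - _); apply: eq_bigr => i _; rewrite /lsc !rmorphM ?rmorph_sign [map_mx _ _ _ _]mxE //.
have T_ddtheta : forall ga e n, ddtheta ga (smon_res e n) =
    \sum_(i in e) lsc ((-1) ^+ #|[pred j in e | (j < i)%N]| * sB (jac Za Zb) i ga) (smon_res (e
      :\ i)%SET n) +
    \sum_al lsc (sD (jac Za Zb) al ga) (smon_res e (incr_at n al)).
  move=> ga e n; apply: dformP => e' l; transitivity (sres h (ddtheta ga (smon (jac (@onl _ _ _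
    _ a b) (@onr _ _ _ _ a b)) e n) e' l)).
    by rewrite /ddtheta; case: ifP => _; rewrite ?rmorph0.
  rewrite (ddtheta_smon E_inv) eB eD !dformD !dform_sum rmorphD !rmorph_sum.
  congr (_ + _); apply: eq_bigr => i _; rewrite /lsc !rmorphM ?rmorph_sign [map_mx _ _ _ _]mxE //.
have T_ginv e n e' l : ginv (smon_res e n e' l) = (-1) ^+ (#|e| + #|e'|) * smon_res e n e' l.
  by rewrite /smon_res -sres_ginv (smon_ginv E_inv) rmorphMsign.
have step w X k : hdeg k p w -> (k < N)%N ->
    tsum smon_res N (vcon ZU Zb w X) = vcon ZU Za (tsum smon_res N w) X.
  move=> hw kN; rewrite /vcon -(tsum_rcon T_con T_ddtheta T_ginv) => [|e l al lN].
    by congr (tsum _ _ (rcon _ _ _)); apply/funext => i;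
      [exact: (xcomp_change X ZU Za Zb) | exact: (tcomp_change X ZU Za Zb)].
  (* In degree [p - k] the exponents add up to at most [k < N], so the truncation in [tsum] loses
     nothing. *)
  apply: hw; rewrite neq_ltn; apply/orP; left.
  rewrite (@leq_trans (p + N)) //.
    by rewrite -addnS leq_add // -[X in (_ <= X)%N](card_ord p) max_card.
  by rewrite addnC leq_add2r (leq_trans lN) // (bigD1 al) //= leq_addr.
have -> : top (d * sber (jac Za Zb)) = tsum smon_res N (top d).
  rewrite tsum_top => [|e l]; last by rewrite /smon_res (smon_top E_inv); case: ifP; rewrite ?rmorph0.
  by rewrite /smon_res (smon_ber E_inv) -(jac_ber_res Za Zb h).
have := @hdeg_top _ (sO Z) p q d; move: (top d); rewrite -[size s]addn0.
elim: s {d} 0%N => //= X s IHs k w hw sN.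
rewrite (IHs k.+1) ?(step _ _ k) ?addnS //; last exact: hdeg_rcon.
by apply: leq_trans sN; rewrite addSn ltnS leq_addl.
Qed.

End Change.
End Words.

(** * The contraction morphism *)

Section Contraction.
Context {R : realType} {p q : nat} (M : supermanifold R p q) (k : int).
Hypothesis hk : k <= p%:Z.
Local Notation n := (absz (p%:Z - k)).
Implicit Types (a b c : chart M p q) (U V Z : opens M).

Lemma dmon_deg (e : {set 'I_p}) (s : nat) : (#|e|%:Z - s%:Z == k) = (#|e| + n == s + p)%N.
Proof.
have nE : n%:Z = p%:Z - k by rewrite abszE ger0_norm // subr_ge0.
have kE : k = p%:Z - n%:Z by rewrite nE opprB addrC subrK.
move: kE; move: n => n' ->; clear nE.
by rewrite subr_eq addrAC eq_sym subr_eq -!PoszD eqz_nat eq_sym [(p + s)%N]addnC.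
Qed.

Lemma dmon_sum (T : nmodType) (F : {set 'I_p} -> {ffun 'I_q -> 'I_n.+1} -> T) :
  (forall (e : {set 'I_p}) (l : {ffun 'I_q -> 'I_n.+1}), (#|e| + n != \sum_al l al + p)%N ->
    F e l = 0) ->
  \sum_(e : {set 'I_p}) \sum_l F e l = \sum_(m : @dmon p q k) F (val m).1 (val m).2.
Proof.
move=> F0; rewrite pair_big /=.
rewrite (bigID (fun x : {set 'I_p} * {ffun 'I_q -> 'I_n.+1} =>
  #|x.1|%:Z - (\sum_al x.2 al)%N%:Z == k)) /= [X in _ + X]big1 ?addr0.
  exact: (big_sub (fun x : {set 'I_p} * {ffun 'I_q -> 'I_n.+1} =>
  #|x.1|%:Z - (\sum_al x.2 al)%N%:Z == k) (fun x => F x.1 x.2)).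
by move=> [e l] /= el; apply: F0; rewrite -dmon_deg.
Qed.

Lemma tsum_dmon (A : superAlgType R) (T : {set 'I_p} -> ('I_q -> nat) -> @dform R A p q) w e l :
  hdeg n p w -> tsum T n w e l =
  \sum_(m : @dmon p q k) w (dmon_e m) (dmon_l m) * T (dmon_e m) (dmon_l m) e l.
Proof.
move=> hw; rewrite /tsum dform_sum.
under eq_bigr do rewrite dform_sum.
rewrite dmon_sum => [|e' l' el]; last first.
  by rewrite /lsc hw ?mul0r //; under eq_bigr do rewrite ffunE.
apply: eq_bigr => m _; rewrite /lsc /dmon_e /dmon_l; congr (_ * T _ _ _ _).
by apply/funext => al; rewrite ffunE.
Qed.

Definition ctr_val U (g : tgen n U) a (m : @dmon p q k) : sO (opI U (cdom a)) :=
  vword (@opIl _ U (cdom a)) (@opIr _ U (cdom a)) (top (gval g.1 a tt)) (codom g.2)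
    (dmon_e m) (dmon_l m).

Lemma hdeg_word U Z (ZU : Z `<=` U) c (Zc : Z `<=` cdom c) d (v : {ffun 'I_n -> PiT U}) :
  hdeg n p (vword ZU Zc (top d) (codom v)).
Proof. by have := hdeg_vword ZU Zc (s := codom v) (hdeg_top d); rewrite addn0 size_codom card_ord. Qed.

Lemma top_res Z Z' (h : Z' `<=` Z) (d : sO Z) (e : {set 'I_p}) (l : {ffun 'I_q -> nat}) :
  sres h (top d e l) = top (sres h d) e l.
Proof. by rewrite /top; case: ifP => _; rewrite ?rmorph0. Qed.

Lemma ctr_compatible U (g : tgen n U) :
  compatible (fun a b (m' m : @dmon p q k) =>
    subst_monomial (jacA a b) (jacB a b) (jacC a b) (jacD a b)
      (dmon_e m') (dmon_l m') (dmon_e m) (dmon_l m)) (ctr_val g).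
Proof.
move=> a b m; set Z := ov3 U a b.
pose ZU : Z `<=` U := @opIl _ U _.
pose Za : Z `<=` cdom a := subset_trans (@ov3a _ _ _ _ U a b) (@opIr _ U _).
pose Zb : Z `<=` cdom b := subset_trans (@ov3b _ _ _ _ U a b) (@opIr _ U _).
have resE c (h : Z `<=` opI U (cdom c)) (Zc : Z `<=` cdom c) e l :
    sres h (vword (@opIl _ U (cdom c)) (@opIr _ U (cdom c)) (top (gval g.1 c tt)) (codom g.2) e l) =
    vword ZU Zc (top (sres h (gval g.1 c tt))) (codom g.2) e l.
  by apply: vword_res => e' l'; exact: top_res.
rewrite (resE a _ Za).
rewrite (gvalP g.1 a b tt) (big_pred1 tt) => [|[]] //.
(* The transition function of Ber(M) supplies the Berezinian that [vword_change] trades for the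
   substitution. *)
rewrite (jac_ber_res Za Zb) -(@vword_change _ _ _ _ a b Z Za Zb (@ov3o _ _ _ _ U a b) _ _ _ _ n).
  rewrite tsum_dmon; last exact: hdeg_word.
  by apply: eq_bigr => m' _; rewrite (resE b _ Zb).
by rewrite size_codom card_ord.
Qed.

End Contraction.

Section ContractionMap.
Context {R : realType} {p q : nat} (M : supermanifold R p q) (k : int).
Hypothesis hk : k <= p%:Z.
Local Notation n := (absz (p%:Z - k)).
Implicit Types (a b c : chart M p q) (U V Z : opens M).

Definition ctr_gen U (g : tgen n U) : psec (deltaForms M k) U := GSec (ctr_compatible hk g).

Definition ctr_seq U (s : seq (tgen n U)) : psec (deltaForms M k) U :=
  \sum_(g <- s) ctr_gen g.

Lemma ctr_seq1 U (g : tgen n U) : ctr_seq [:: g] = ctr_gen g.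
Proof. exact: big_seq1. Qed.

Lemma ctr_seq2 U (g h : tgen n U) : ctr_seq [:: g; h] = ctr_gen g + ctr_gen h.
Proof. by rewrite /ctr_seq big_cons big_seq1. Qed.

Lemma ctr_seq_cat U (s t : seq (tgen n U)) : ctr_seq (s ++ t) = ctr_seq s + ctr_seq t.
Proof. exact: big_cat. Qed.

Definition cword U a (b : ber U) (s : seq (PiT U)) : @dform R (sO (opI U (cdom a))) p q :=
  vword (@opIl _ U (cdom a)) (@opIr _ U (cdom a)) (top (gval b a tt)) s.

Lemma ctr_genE U (g : tgen n U) a m :
  gval (ctr_gen g) a m = cword a g.1 (codom g.2) (dmon_e m) (dmon_l m).
Proof. by []. Qed.

Lemma gval_add U (x y : psec (deltaForms M k) U) a m :
  gval (x + y) a m = gval x a m + gval y a m.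
Proof. by []. Qed.

Lemma cwordD U a (b b' : ber U) s : cword a (b + b') s = cword a b s + cword a b' s.
Proof. by rewrite /cword -vword_add -topD. Qed.

Lemma cwordZ U a f (b : ber U) s :
  cword a (f *: b) s = lsc (sres (@opIl _ U (cdom a)) f) (cword a b s).
Proof. by rewrite /cword -vword_lsc -topZ. Qed.

Lemma codom_upd U (v : {ffun 'I_n -> PiT U}) j x :
  codom (upd v j x) = take j (codom v) ++ x :: drop j.+1 (codom v).
Proof.
have sz (f : {ffun 'I_n -> PiT U}) : size (codom f) = n by rewrite size_codom card_ord.
apply: (@eq_from_nth _ 0) => [|i].
  by rewrite size_cat /= size_take size_drop !sz ltn_ord addnS -addSn subnKC.
rewrite sz => ilt; rewrite nth_cat size_take sz ltn_ord.
have nthE (f : {ffun 'I_n -> PiT U}) (r : 'I_n) : nth 0 (codom f) r = f r.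
  by rewrite (nth_map r) ?size_enum_ord // nth_ord_enum.
rewrite (nthE _ (Ordinal ilt)) ffunE -val_eqE /=.
case: (ltngtP i j) => [ij|ji|->]; last by rewrite subnn.
  by rewrite nth_take // (nthE _ (Ordinal ilt)).
by rewrite -[(i - j)%N]prednK ?subn_gt0 //= nth_drop -subnS subnKC // (nthE _ (Ordinal ilt)).
Qed.

Lemma upd_id U (v : {ffun 'I_n -> PiT U}) (j : 'I_n) : upd v j (v j) = v.
Proof. by apply/ffunP => i; rewrite ffunE; case: eqP => [->|]. Qed.

Lemma codom_split U (v : {ffun 'I_n -> PiT U}) (j : 'I_n) :
  codom v = take j (codom v) ++ v j :: drop j.+1 (codom v).
Proof.
by rewrite -codom_upd upd_id.
Qed.

Lemma codom_split2 U (v : {ffun 'I_n -> PiT U}) (j j' : 'I_n) : j' = j.+1 :> nat ->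
  exists s s', [/\ forall x y, codom (upd (upd v j x) j' y) = s ++ x :: y :: s',
    forall x, codom (upd v j x) = s ++ x :: v j' :: s',
    forall y, codom (upd v j' y) = s ++ v j :: y :: s' &
    codom v = s ++ v j :: v j' :: s'].
Proof.
move=> jj'; pose s := take j (codom v); pose s' := drop j'.+1 (codom v).
have E x y : codom (upd (upd v j x) j' y) = s ++ x :: y :: s'.
  have sj : size s = j by rewrite size_take size_codom card_ord ltn_ord.
  rewrite !codom_upd jj' take_cat sj ltnNge leqnSn subSnn /= take0 -catA /=.
  congr (_ ++ [:: _, _ & _]); rewrite drop_cat sj ltnNge -addn2 leq_addr /=.
  by rewrite addKn /= drop_drop add1n /s' jj'.
exists s, s'; split=> // [x|y|].
- by rewrite -(upd_id (upd v j x) j') E ffunE -val_eqE /= jj' gtn_eqF.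
- by rewrite -E upd_id.
- by rewrite -E !upd_id.
Qed.

Lemma teq_ctr U (s t : seq (tgen n U)) : teq s t -> ctr_seq s = ctr_seq t.
Proof.
elim=> {s t}.
- by [].
- by [].
- by move=> s t u _ E1 _ E2; rewrite E1 E2.
- by move=> s s' t t' _ E _ E'; rewrite !ctr_seq_cat E E'.
- by move=> s t; rewrite !ctr_seq_cat addrC.
- move=> v; rewrite ctr_seq1 /ctr_seq big_nil; apply: gsecP => a m.
  by rewrite ctr_genE -[(0, v).1](scale0r (0 : ber U)) cwordZ rmorph0 lsc0l.
- move=> b b' v; rewrite ctr_seq1 ctr_seq2; apply: gsecP => a m.
  by rewrite gval_add !ctr_genE cwordD dformD.
- move=> b v j x y; rewrite ctr_seq1 ctr_seq2; apply: gsecP => a m.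
  rewrite gval_add !ctr_genE /= !codom_upd /cword !vword_cat /= vconD -dformD.
  by rewrite -vword_add.
- move=> b f v j j0; rewrite !ctr_seq1; apply: gsecP => a m.
  rewrite !ctr_genE /= codom_upd (codom_split v j) j0 take0 /cword /= drop0 vcon_scale -top_rmulW.
  congr (vword _ _ (vcon _ _ (top _) _) _ _ _).
  (* The sign (-1)^(p + q) in the grade involution of Ber(M) is the parity of the top form: moving
     [f] past D(x) and past that form has the same effect. *)
  transitivity (sres (@opIl _ U (cdom a)) (evenpart f) * gval b a tt +
    sres (@opIl _ U (cdom a)) (oddpart f) * ((-1) ^+ (p + q) * ginv (gval b a tt))) => //.
  rewrite sres_even sres_odd; move: (sres _ f) (gval b a tt) => g d.
  rewrite -signr_odd; case: odd; rewrite /= ?expr0 ?expr1 ?mul1r ?mulN1r; last exact: even_odd_mulr.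
  by rewrite -[RHS]even_odd_mulr evenpart_ginv oddpart_ginv mulNr mulrN.
- move=> b f v j j' /(codom_split2 v) [s [s' [_ E E' _]]]; rewrite !ctr_seq1.
  apply: gsecP => a m; rewrite !ctr_genE /= E E' /cword !vword_cat /=.
  by rewrite vcon_scale -vcon_rscale.
- move=> b v j j' e e' /(codom_split2 v) [s [s' [E _ _ E']]] ej ej'; rewrite !ctr_seq1.
  apply: gsecP => a m; rewrite !ctr_genE /= cwordZ rmorph_sign E E' /cword !vword_cat /=.
  by rewrite (vcon_swap _ _ _ ej ej') vword_lsc /lsc mulrA -expr2 sqrr_sign mul1r.
Qed.

End ContractionMap.

Section ContractionMorphism.
Context {R : realType} {p q : nat} (M : supermanifold R p q) (k : int).
Hypothesis hk : k <= p%:Z.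
Local Notation n := (absz (p%:Z - k)).
Implicit Types (a b c : chart M p q) (U V Z : opens M).

Definition ctr U (x : psec (tens_presheaf M n) U) : psec (deltaForms M k) U :=
  ctr_seq hk (repr (x : tens n U)).

Lemma ctrE U (s : seq (tgen n U)) : ctr (tclass s) = ctr_seq hk s.
Proof. exact/teq_ctr/tclassE. Qed.

Lemma ctr_seqZ U (f : sO U) (s : seq (tgen n U)) :
  ctr_seq hk [seq (f *: g.1, g.2) | g <- s] = f *: ctr_seq hk s.
Proof.
rewrite /ctr_seq big_map scaler_sumr; apply: eq_bigr => g _; apply: gsecP => a m.
by rewrite ctr_genE cwordZ.
Qed.

Lemma ctr_linear U (f : sO U) (s t : psec (tens_presheaf M n) U) :
  ctr (f *: s + t) = f *: ctr s + ctr t.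
Proof.
elim/(@tensP R p q M n U): s => s; elim/(@tensP R p q M n U): t => t.
rewrite [X in ctr X](_ : _ = tadd (tscale f (tclass s)) (tclass t)) //.
by rewrite tscaleE taddE !ctrE ctr_seq_cat ctr_seqZ.
Qed.

Lemma gval_res U V (VU : V `<=` U) (x : psec (deltaForms M k) U) a m :
  gval (pres (deltaForms M k) VU x) a m = sres (opIS VU (@subset_refl _ (cdom a))) (gval x a m).
Proof. by []. Qed.

Lemma ctr_gen_res U V (VU : V `<=` U) (g : tgen n U) :
  ctr_gen hk (tgen_res VU g) = pres (deltaForms M k) VU (ctr_gen hk g).
Proof.
apply: gsecP => a m; rewrite gval_res !ctr_genE /cword.
pose VaU : opI V (cdom a) `<=` U := subset_trans (@opIl _ V (cdom a)) VU.
rewrite (@vword_res _ _ _ _ U _ _ _ VaU _ _ (@opIr _ V (cdom a)) _ _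
  (top (sres (opIS VU (@subset_refl _ (cdom a))) (gval g.1 a tt)))) => [|e l]; last exact: top_res.
have -> : codom (tgen_res VU g).2 = map (pires VU) (codom g.2).
  by rewrite /codom /image_mem -map_comp; apply: eq_map => j; rewrite /= ffunE.
congr (_ _ _); rewrite -[gval (tgen_res VU g).1 a tt]/(sres (opIS VU (@subset_refl _ (cdom a)))
  (gval g.1 a tt)).
by elim: (codom g.2) (top _) => //=.
Qed.

Lemma ctr_res U V (VU : V `<=` U) (t : psec (tens_presheaf M n) U) :
  ctr (pres (tens_presheaf M n) VU t) = pres (deltaForms M k) VU (ctr t).
Proof.
elim/(@tensP R p q M n U): t => s.
rewrite [X in ctr X](_ : _ = tres VU (tclass s)) // tresE !ctrE.
elim: s => [|g s IHs]; first by rewrite /ctr_seq !big_nil pres0.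
by rewrite /= /ctr_seq !big_cons [RHS](@presD _ _ (deltaForms M k) _ _ VU) -ctr_gen_res; congr (_ + _).
Qed.

End ContractionMorphism.

(** * Bijectivity over a coordinate domain *)

Definition bact {R : realType} {A : superAlgType R} {p q : nat} (w : @dform R A p q)
    (I : 'I_p + 'I_q) : @dform R A p q :=
  match I with inl i => rdx i w | inr al => ddtheta al w end.

Section LocalFrame.
Context {R : realType} {p q : nat} (M : supermanifold R p q).
Variables (a : chart M p q) (U : opens M) (Uc : U `<=` cdom a).

Definition frame_sub : U `<=` opI U (cdom a) := fun x Ux => conj Ux (Uc Ux).

(** As [U] lies in the domain of [a], every other component lives on an overlap with [a], where the
    transition functions compute it from that of [a]. *)
Lemma glue_frame_inj (I : finType) (t : forall a b : chart M p q, I -> I -> sO (overlap a b))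
    (x y : gsec t U) :
  (forall i, sres frame_sub (gval x a i) = sres frame_sub (gval y a i)) -> x = y.
Proof.
move=> xy; apply: gsecP => b i.
have h : opI U (cdom b) `<=` ov3 U b a by move=> z [Uz bz]; split=> //; split=> //; exact: Uc.
have hU : ov3 U b a `<=` U := @opIl _ U _.
have E (z : gsec t U) j : sres (@ov3b _ _ _ _ U b a) (gval z a j) =
  sres hU (sres frame_sub (gval z a j)).
  by rewrite (sres_comp _ _ (@ov3b _ _ _ _ U b a)).
have inj (f : sO (opI U (cdom b))) : f = sres h (sres (@ov3a _ _ _ _ U b a) f).
  by rewrite (sres_comp _ _ (@subset_refl _ _)) sres_id.
rewrite [LHS]inj [RHS]inj !gvalP; congr (sres h _); apply: eq_bigr => j _.
by rewrite !E xy.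
Qed.

Lemma sber_res b c (Z Z' : opens M) (Zb : Z `<=` cdom b) (Zc : Z `<=` cdom c)
    (Z'b : Z' `<=` cdom b) (Z'c : Z' `<=` cdom c) (h : Z' `<=` Z) :
  sres h (sber (jac Zb Zc)) = sber (jac Z'b Z'c).
Proof.
have [E DE] := jac_inv Zb Zc; have [eA eB eC eD] := jac_res Zb Zc Z'b Z'c h.
by rewrite (sber_map eA eB eC eD DE).
Qed.

(** The section f D(x), with D(x) the generator attached to [a]. Compatibility of two further charts
    is the cocycle identity of the Berezinians, which is what their multiplicativity was proved
    for. *)
Lemma ber_of_compatible (f : sO U) : compatible (fun b c (_ _ : unit) => jac_ber b c)
  (fun b _ => sres (@opIl _ U (cdom b)) f *
     sber (jac (@opIr _ U (cdom b)) (subset_trans (@opIl _ U (cdom b)) Uc))).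
Proof.
move=> b c i; rewrite (big_pred1 tt) => [|[]] //.
pose Zb := subset_trans (@ov3a _ _ _ _ U b c) (@opIr _ U _).
pose Zc := subset_trans (@ov3b _ _ _ _ U b c) (@opIr _ U _).
pose Za := subset_trans (@opIl _ U (overlap b c)) Uc.
cbv beta; rewrite [LHS]rmorphM [X in _ = X * _]rmorphM (sber_res _ _ Zb Za) (sber_res _ _ Zc
  Za) (jac_ber_res Zb Zc).
by rewrite (sber_chain Zb Zc Za) !(sres_comp _ _ (@opIl _ U (overlap b c))) mulrA.
Qed.
Definition ber_of f : ber U := GSec (ber_of_compatible f).

Lemma ber_ofE f : sres frame_sub (gval (ber_of f) a tt) = f.
Proof.
rewrite [LHS]rmorphM (sber_res _ _ Uc Uc) sber_id mulr1.
by rewrite (sres_comp _ _ (@subset_refl _ _)) sres_id.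
Qed.

Lemma ber_eq (b : ber U) : b = sres frame_sub (gval b a tt) *: ber_of 1.
Proof.
apply: glue_frame_inj => -[]; rewrite [RHS]rmorphM ber_ofE mulr1.
by rewrite (sres_comp _ _ (@subset_refl _ _)) sres_id.
Qed.

Definition basis_field (I : 'I_p + 'I_q) : PiT U :=
  match I with inl i => dx_field Uc i | inr al => dtheta_field Uc al end.

Lemma basis_field_ginv I : pginv (basis_field I) = (-1) ^+ (if I then true else false) *: basis_field I.
Proof.
have E (b : bool) (X : PiT U) (V : opens M) (VU : V `<=` U) f : ((-1) ^+ b *: X) V VU f =
  (-1) ^+ b * X V VU f.
  rewrite -[LHS]/(sres VU (ginv ((-1) ^+ b)) * _) -[(-1) ^+ b in LHS]mulr1 ginv_sign ginv1 mulr1.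
  by rewrite rmorph_sign.
apply: vfieldP => V VU f; rewrite pginvE E; case: I => i /=.
  by rewrite even_deriv_ginv ginvK expr1 mulN1r.
by rewrite odd_deriv_ginv !ginvN !ginvK opprK expr0 mul1r.
Qed.

Lemma PiT_expand (X : PiT U) : exists c : 'I_p + 'I_q -> sO U, X = \sum_I c I *: basis_field I.
Proof.
exists (fun I => ginv (match I with inl i => X U (@subset_refl _ U) (xcoord Uc i)
  | inr al => X U (@subset_refl _ U) (tcoord Uc al) end)).
rewrite big_sumType /= {1}(vfield_expand Uc X).
have E (f : sO U) (Y : PiT U) : ginv f *: Y =
  vscale f Y by rewrite -[LHS]/(vscale (ginv (ginv f)) Y) ginvK.
by congr (_ + _); apply: eq_bigr => i _; rewrite E.
Qed.

Local Notation W := (@dform R (sO U) p q).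

Lemma vcon_basis w I : vcon (@subset_refl _ U) Uc w (basis_field I) = bact w I.
Proof.
have E : subset_trans (@subset_refl _ U) Uc = Uc by exact: Prop_irrelevance.
apply: dformP => e l; rewrite /vcon /rcon; case: I => [i|al] /=.
  rewrite [X in _ + X]big1 ?addr0 => [|be _]; last first.
    by rewrite /tcomp /= E even_deriv_tcoord ginv0 gp0 mulr0.
  rewrite (bigD1 i) //= big1 ?addr0 => [|j ji]; last first.
    by rewrite /xcomp /= E even_deriv_xcoord eq_sym (negbTE ji) gp0 mulr0.
  by rewrite /xcomp /= E even_deriv_xcoord eqxx gp_ev ?ginv1 ?mulr1.
rewrite [X in X + _]big1 ?add0r => [|i _]; last first.
  by rewrite /xcomp /= E odd_deriv_xcoord ginv0 gp0 mulr0.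
rewrite (bigD1 al) //= big1 ?addr0 => [|be ba]; last first.
  by rewrite /tcomp /= E odd_deriv_tcoord eq_sym (negbTE ba) !ginv0 gp0 mulr0.
by rewrite /tcomp /= E odd_deriv_tcoord eqxx gp_ev ?ginv1 ?mulr1.
Qed.

Lemma vword_basis w s :
  vword (@subset_refl _ U) Uc w (map basis_field s) = foldl bact w s.
Proof. by elim: s w => //= I s IHs w; rewrite vcon_basis IHs. Qed.

End LocalFrame.

(** * Words in the coordinate fields *)

Section MonomialWords.
Context {R : realType} {A : superAlgType R} {p q : nat}.
Local Notation W := (@dform R A p q).
Implicit Types (w : W) (f : A) (e : {set 'I_p}) (l : {ffun 'I_q -> nat}) (s : seq ('I_p + 'I_q)).

Definition dmonomial e l : W := fun e' l' => if (e' == e) && (l' == l) then 1 else 0.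

Lemma top1 : top 1 = dmonomial finset.setT [ffun=> 0%N]. Proof. by []. Qed.

Lemma rdx_dmonomial i e l : i \in e ->
  rdx i (dmonomial e l) = lsc ((-1) ^+ odd (#|[pred j in (e :\ i)%SET | (j < i)%N]| +
    ~~ (@par p q (e :\ i)%SET)))
    (dmonomial (e :\ i)%SET l).
Proof.
move=> ie; apply: dformP => e' l'; rewrite /rdx /lsc /dmonomial signr_odd.
case: (e' =P (e :\ i)%SET) => [->|ne]; first by rewrite finset.setD11 finset.setD1K // eqxx.
rewrite /= mulr0; case: ifPn => // ie'; case: eqP => [E|_]; last by rewrite mulr0.
by case: ne; rewrite -E finset.setU1K.
Qed.

Lemma ddtheta_dmonomial al e l : ddtheta al (dmonomial e l) = dmonomial e (incr l al).
Proof.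
apply: dformP => e' l'; rewrite /ddtheta /dmonomial; case: (e' == e) => /=; last by rewrite if_same.
case: eqP => [l0|/eqP l0].
  by case: eqP => // E; move: l0; rewrite E ffunE eqxx addn1.
congr (if _ then _ else _); apply/eqP/eqP => [<-|->]; [by rewrite decrK | exact: incrK].
Qed.

Lemma bact_lsc f w s : foldl bact (lsc f w) s = lsc f (foldl bact w s).
Proof.
by elim: s w => //= -[i|al] s IHs w; rewrite /= -IHs ?rdx_lsc ?ddtheta_lsc.
Qed.

(** By the hypothesis no letter removes a dx that is absent or already gone, so each of them maps a
    monomial to a monomial up to sign. *)
Lemma bact_word s e l : (forall i, (count_mem (inl i) s <= (i \in e))%N) ->
  exists c : bool, foldl bact (dmonomial e l) s =
    lsc ((-1) ^+ c) (dmonomial [set i in e | inl i \notin s]%SET [ffun al =>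
      l al + count_mem (inr al) s]%N).
Proof.
elim: s e l => [|[i|al] s IHs] e l cs.
- exists false; rewrite expr0 lsc1; congr dmonomial.
    by apply/setP => i; rewrite !inE andbT.
  by apply/ffunP => al; rewrite ffunE addn0.
- have ie : i \in e by have := cs i; rewrite /= eqxx; case: (i \in e).
  have is_ : inl i \notin s.
    by have := cs i; rewrite /= eqxx ie add1n ltnS leqn0 => /eqP/count_memPn.
  have [|c E] := IHs (e :\ i)%SET l.
    move=> j; have := cs j; rewrite /= !inE; case: (j =P i) => [->|ji].
      by rewrite eqxx (count_memPn is_).
    by case: eqP => // -[] ij; case: ji.
  rewrite /= rdx_dmonomial // bact_lsc E lscA -signr_addb.
  exists (odd (#|[pred j in (e :\ i)%SET | (j < i)%N]| + ~~ (@par p q (e :\ i)%SET)) (+) c).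
  congr (lsc _ (dmonomial _ _)).
  by apply/setP => j; rewrite !inE negb_or andbCA andbA andbC; case: (j =P i) => [->|ji]; rewrite ?eqxx.
- have [|c E] := IHs e (incr l al).
    by move=> j; have := cs j.
  exists c; rewrite /= ddtheta_dmonomial E; congr (lsc _ (dmonomial _ _)).
  by apply/ffunP => be; rewrite !ffunE /= -addnA eq_sym.
Qed.

End MonomialWords.

(** The head [x] of [t] is carried to the front of [s] by adjacent swaps; the prefix [u] collects
    what is already in place. *)
Lemma perm_adjacent (T : eqType) (P : seq T -> seq T -> Prop) :
  (forall s, P s s) -> (forall s t u, P s t -> P t u -> P s u) ->
  (forall u x y v, P (u ++ x :: y :: v) (u ++ y :: x :: v)) ->
  forall s t, perm_eq s t -> P s t.
Proof.
move=> Pr Pt Ps s t; suff H u : perm_eq s t -> P (u ++ s) (u ++ t) by apply: (H [::]).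
elim: t s u => [|x t IHt] s u st.
  by move: st => /perm_nilP ->; apply: Pr.
have xs : x \in s by rewrite (perm_mem st) mem_head.
move: st; case/splitPr: xs => s1 s2 st.
have {}st : perm_eq (s1 ++ s2) t.
  by rewrite -(perm_cons x) (perm_trans _ st) // -cat1s perm_catCA.
apply: (Pt _ (u ++ x :: s1 ++ s2)); last by rewrite -![u ++ x :: _]cat_rcons; apply: IHt.
elim: s1 u {st} => [|y s1 IHs] u; first exact: Pr.
apply: (Pt _ (u ++ y :: x :: s1 ++ s2)); last exact: Ps.
by rewrite -![u ++ y :: _]cat_rcons; apply: IHs.
Qed.

Section BasisWords.
Context {R : realType} {p q : nat} (M : supermanifold R p q) (k : int).
Hypothesis hk : k <= p%:Z.
Local Notation n := (absz (p%:Z - k)).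
Variables (a : chart M p q) (U : opens M) (Uc : U `<=` cdom a).
Local Notation T := (psec (tens_presheaf M n) U).
Local Notation bas := (basis_field Uc).
Implicit Types (s : seq ('I_p + 'I_q)).

(** Sequences are easier to permute than functions on ['I_n]. The default 0 does not show up for
    words of length [n]. *)
Definition fword (r : seq (PiT U)) : {ffun 'I_n -> PiT U} := [ffun i : 'I_n => nth 0 r i].

Lemma codom_fword r : size r = n -> codom (fword r) = r.
Proof.
move=> sr; apply: (@eq_from_nth _ 0) => [|i]; rewrite size_codom card_ord // => ilt.
have -> : nth 0 (codom (fword r)) (Ordinal ilt) = fword r (Ordinal ilt).
  by rewrite (nth_map (Ordinal ilt)) ?size_enum_ord // nth_ord_enum.
by rewrite ffunE.
Qed.

Lemma tclassD (g h : seq (tgen n U)) : (tclass (g ++ h) : T) = (tclass g : T) + (tclass h : T).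
Proof. exact/esym/taddE. Qed.

Lemma tclassZ f (b : ber U) v : (tclass [:: (f *: b, v)] : T) = f *: (tclass [:: (b, v)] : T).
Proof. by rewrite -[RHS]/(tscale f (tclass [:: (b, v)])) tscaleE. Qed.

Definition wcl s : T := tclass [:: (ber_of Uc 1, fword (map bas s))].

Lemma frame_ctr b (r : seq (PiT U)) (m : dmon k) : size r = n ->
  sres (frame_sub Uc) (gval (ctr hk (tclass [:: (b, fword r)])) a m) =
  vword (@subset_refl _ U) Uc (top (sres (frame_sub Uc) (gval b a tt))) r (dmon_e m) (dmon_l m).
Proof.
move=> sr; rewrite ctrE ctr_seq1 ctr_genE /cword codom_fword //.
by apply: vword_res => e l; apply: top_res.
Qed.

Lemma frame_wcl s (m : dmon k) : size s = n ->
  sres (frame_sub Uc) (gval (ctr hk (wcl s)) a m) = foldl bact (top 1) s (dmon_e m) (dmon_l m).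
Proof. by move=> sn; rewrite frame_ctr ?size_map // ber_ofE vword_basis. Qed.

Definition odd_letter (x : 'I_p + 'I_q) : bool := if x then true else false.

Lemma wcl_swap u x y v : size (u ++ x :: y :: v) = n ->
  wcl (u ++ y :: x :: v) = (-1) ^+ (odd_letter x && odd_letter y) *: wcl (u ++ x :: y :: v).
Proof.
rewrite size_cat /= => sn.
have jn : (size u < n)%N by rewrite -sn -addSnnS leq_addr.
have jn' : ((size u).+1 < n)%N by rewrite -sn -addSnnS -addSnnS leq_addr.
pose j := Ordinal jn; pose j' := Ordinal jn'.
set w := fword (map bas (u ++ x :: y :: v)).
have wj : w j = bas x by rewrite ffunE map_cat nth_cat size_map ltnn subnn.
have wj' : w j' = bas y by rewrite ffunE map_cat nth_cat size_map ltnNge leqnSn /= subSnn.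
rewrite /wcl -tclassZ; apply/tclassP.
have -> : fword (map bas (u ++ y :: x :: v)) = upd (upd w j (w j')) j' (w j).
  rewrite wj wj'; apply/ffunP => i; rewrite !ffunE -!val_eqE /= !map_cat !nth_cat !size_map.
  case: (ltngtP i (size u)) => ij.
  - by rewrite ltn_eqF //; apply: ltn_trans ij _.
  - case: eqP => [->|ne]; first by rewrite subSnn.
    have h : (0 < i - (size u).+1)%N by rewrite subn_gt0 ltn_neqAle ij andbT eq_sym; exact/eqP.
    rewrite -[(i - size u)%N]prednK ?subn_gt0 ?ij // -subnS /=.
    by case: (i - (size u).+1)%N h.
  - by rewrite ij subnn ltn_eqF.
by apply: teq_swap; rewrite // ?wj ?wj' basis_field_ginv.
Qed.

Lemma wcl_perm s t : size s = n -> perm_eq s t -> exists c : bool, wcl s = (-1) ^+ c *: wcl t.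
Proof.
move=> sn st; suff [] : size t = n /\ exists c : bool, wcl s = (-1) ^+ c *: wcl t by [].
move: s t st sn; apply: (@perm_adjacent _ (fun s t =>
  size s = n -> size t = n /\ exists c : bool, wcl s = (-1) ^+ c *: wcl t)).
- by move=> s sn; split=> //; exists false; rewrite expr0 scale1r.
- move=> s t u st tu /st [/tu [un [c cE]] [d dE]]; split=> //.
  by exists (d (+) c); rewrite dE cE scalerA signr_addb.
- move=> u x y v sn; split; first by rewrite -sn !size_cat.
  by exists (odd_letter y && odd_letter x); apply: wcl_swap; rewrite -sn !size_cat.
Qed.

(** Two equal odd letters can be brought to the front, where exchanging them changes the sign; and 2
    is invertible. *)
Lemma wcl_repeat s i : size s = n -> (1 < count_mem (inl i) s)%N -> wcl s = 0.
Proof.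
move=> sn ci; have is_ : inl i \in s by rewrite -has_pred1 has_count; apply: ltn_trans ci.
have st := perm_to_rem is_.
have ir : inl i \in rem (inl i) s.
  rewrite -has_pred1 has_count; have /permP E := st.
  by move: ci; rewrite E /= eqxx.
have {}st : perm_eq s (inl i :: inl i :: rem (inl i) (rem (inl i) s)).
  by rewrite (perm_trans st) // perm_cons perm_to_rem.
have [c ->] := wcl_perm sn st.
set r := _ :: _ in st *; have rn : size r = n by rewrite -(perm_size st).
have E := @wcl_swap [::] (inl i) (inl i) _ rn; rewrite /= expr1 scaleN1r in E.
suff -> : wcl r = 0 by rewrite scaler0.
have E2 : wcl r + wcl r = 0 by rewrite {1}E addNr.
by rewrite -[LHS]scale1r -(scal_half2 (1 : sO U)) -scalerA scalerDl !scale1r E2 scaler0.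
Qed.

(** Contracting the top form with these letters reaches the monomial [(e, l)] up to sign: the dx's
    to be removed are those outside [e]. *)
Definition mword (e : {set 'I_p}) (l : {ffun 'I_q -> nat}) : seq ('I_p + 'I_q) :=
  [seq inl i | i <- enum (~: e)%SET] ++ flatten [seq nseq (l al) (inr al) | al <- enum 'I_q].

Lemma size_mword e l : size (mword e l) = (#|~: e| + \sum_al l al)%N.
Proof.
rewrite size_cat size_map -cardE; congr addn; rewrite size_flatten /shape -map_comp.
rewrite sumnE big_map big_enum /=; apply: eq_bigr => al _; exact: size_nseq.
Qed.

Lemma mword_inl e l i : count_mem (inl i) (mword e l) = (i \notin e).
Proof.
rewrite count_cat count_map count_flatten -map_comp.
rewrite (_ : map _ (enum 'I_q) = map (fun=> 0%N) (enum 'I_q)); last first.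
  by apply: eq_map => al /=; rewrite count_nseq mul0n.
rewrite (_ : sumn _ = 0%N) ?addn0; last by elim: (enum _).
rewrite (eq_count (a2 := pred1 i)) => [|j]; last by rewrite /= (inj_eq (@inl_inj _ _)).
by rewrite count_uniq_mem ?enum_uniq // mem_enum inE.
Qed.

Lemma mword_inr e l al : count_mem (inr al) (mword e l) = l al.
Proof.
rewrite count_cat count_map (eq_count (a2 := pred0)) // count_pred0 add0n.
rewrite count_flatten -map_comp sumnE big_map big_enum (bigD1 al) //= big1 => [|be ba].
  by rewrite count_nseq /= eqxx mul1n addn0.
by rewrite count_nseq /= (inj_eq (@inr_inj _ _)) (negbTE ba).
Qed.

Lemma size_mword_dmon (m : dmon k) : size (mword (dmon_e m) (dmon_l m)) = n.
Proof.
have := valP m; rewrite /= dmon_deg // => /eqP E; rewrite size_mword.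
apply/eqP; rewrite -(eqn_add2l #|dmon_e m|) addnA cardsC card_ord E addnC.
by rewrite eqn_add2r; apply/eqP/eq_bigr => al _; rewrite ffunE.
Qed.

Lemma word_dmon s : size s = n -> (forall i, (count_mem (inl i) s <= 1)%N) ->
  exists m : dmon k, perm_eq s (mword (dmon_e m) (dmon_l m)).
Proof.
move=> sn cs; pose e : {set 'I_p} := [set i | inl i \notin s]%SET.
pose l : {ffun 'I_q -> nat} := [ffun al => count_mem (inr al) s].
have sp : perm_eq s (mword e l).
  apply/allP => -[i|al] _; apply/eqP; rewrite /= ?mword_inl ?mword_inr ?ffunE // inE negbK.
  by have := cs i; case: (boolP (inl i \in s)) => [is_|/count_memPn -> //];
    rewrite -has_pred1 has_count in is_; case: (count_mem _ s) is_ => [|[]].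
(* No letter occurs more than [n] times, so [inord] does not fall back on its default. *)
pose l' : {ffun 'I_q -> 'I_n.+1} := [ffun al => inord (l al)].
have l'E al : l' al = l al :> nat.
  by rewrite ffunE inordK // ltnS -sn ffunE count_size.
have el : #|e|%:Z - (\sum_al l' al)%N%:Z == k.
  rewrite dmon_deg // (eq_bigr l) => [|al _]; last exact: l'E.
  have := perm_size sp; rewrite sn size_mword => ->.
  by rewrite addnA cardsC card_ord addnC.
exists (Sub (e, l') el); rewrite /dmon_e /dmon_l SubK /=.
by rewrite (_ : [ffun al => _] = l) //; apply/ffunP => al; rewrite ffunE l'E.
Qed.

End BasisWords.

(** * Spanning words and their coefficients *)

Section LocalIsomorphism.
Context {R : realType} {p q : nat} (M : supermanifold R p q) (k : int).
Hypothesis hk : k <= p%:Z.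
Local Notation n := (absz (p%:Z - k)).
Variables (a : chart M p q) (U : opens M) (Uc : U `<=` cdom a).
Local Notation T := (psec (tens_presheaf M n) U).
Local Notation bas := (basis_field Uc).
Local Notation dmonk := (@dmon p q k).
Local Notation wcl := (@wcl _ _ _ _ k _ _ Uc).
Local Notation fword := (@fword _ _ _ _ k U).

Definition dmon_word (m : dmonk) := mword (dmon_e m) (dmon_l m).

Lemma dmon_inj (m m' : dmonk) : dmon_e m = dmon_e m' -> dmon_l m = dmon_l m' -> m = m'.
Proof.
move=> ee ll; apply/val_inj; rewrite [val m]surjective_pairing [val m']surjective_pairing.
congr (_, _); first exact: ee.
apply/ffunP => al; apply/val_inj.
by have := f_equal (fun l : {ffun 'I_q -> nat} => l al) ll; rewrite !ffunE.
Qed.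

(** In the basis of monomials the chosen words have a diagonal matrix of signs. *)
Lemma bact_mword (m : dmonk) : exists c : bool, forall m' : dmonk,
  foldl bact (top (1 : sO U)) (dmon_word m) (dmon_e m') (dmon_l m') = (-1) ^+ c * (m' == m)%:R.
Proof.
have [|c E] := @bact_word _ (sO U) _ _ (dmon_word m) finset.setT [ffun=> 0%N].
  by move=> i; rewrite mword_inl inE leq_b1.
exists c => m'; rewrite top1 E /lsc /dmonomial; congr (_ * _).
have -> : [set i in [set: 'I_p] | inl i \notin dmon_word m]%SET = dmon_e m.
  apply/setP => i; rewrite !inE /=; have := mword_inl (dmon_e m) (dmon_l m) i.
  case: (boolP (inl i \in _)) => [im|/count_memPn ->]; last by case: (i \in _).
  by move: im; rewrite -has_pred1 has_count => im h; move: im; rewrite h; case: (i \in _).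
have -> : [ffun al => [ffun=> 0] al + count_mem (inr al) (dmon_word m)]%N = dmon_l m.
  by apply/ffunP => al; rewrite !ffunE mword_inr ffunE.
case: (m' =P m) => [->|ne]; first by rewrite !eqxx.
by case: ifP => // /andP [/eqP ee /eqP ll]; case: ne; apply: dmon_inj.
Qed.

Definition spanned (t : T) := exists f : dmonk -> sO U, t = \sum_m f m *: wcl (dmon_word m).

Lemma spannedZ f t : spanned t -> spanned (f *: t).
Proof.
move=> [g ->]; exists (fun m => f * g m); rewrite scaler_sumr.
by apply: eq_bigr => m _; rewrite scalerA.
Qed.

Lemma spannedD t t' : spanned t -> spanned t' -> spanned (t + t').
Proof.
move=> [g ->] [g' ->]; exists (fun m => g m + g' m); rewrite -big_split.
by apply: eq_bigr => m _; rewrite scalerDl.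
Qed.

Lemma spanned0 : spanned 0.
Proof. by exists (fun=> 0); rewrite big1 // => m _; rewrite scale0r. Qed.

Lemma spanned_wcl s : size s = n -> spanned (wcl s).
Proof.
move=> sn; case: (pickP (fun i => (1 < count_mem (inl i) s)%N)) => [i ci|cs].
  by rewrite (wcl_repeat Uc sn ci); exact: spanned0.
have [|m sm] := word_dmon hk sn; first by move=> i; rewrite leqNgt cs.
have [c ->] := wcl_perm Uc sn sm; apply: spannedZ.
exists (fun m' => (m' == m)%:R); rewrite (bigD1 m) //= eqxx scale1r big1 ?addr0 // => m' /negbTE ->.
by rewrite scale0r.
Qed.

Lemma spanned_basis (b : ber U) (v : {ffun 'I_n -> PiT U}) :
  (forall i, exists I, v i = bas I) -> spanned (tclass [:: (b, v)]).
Proof.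
move=> /fin_all_exists [phi vE].
have -> : v = fword (map bas (map phi (enum 'I_n))).
  apply/ffunP => i; rewrite ffunE -map_comp (nth_map i) ?size_enum_ord //.
  by rewrite nth_ord_enum vE.
rewrite (ber_eq Uc b) tclassZ; apply: spannedZ; apply: spanned_wcl.
by rewrite size_map size_enum_ord.
Qed.

Lemma tclass_upd_sum (b : ber U) (v : {ffun 'I_n -> PiT U}) j (J : finType) (F : J -> PiT U) :
  (tclass [:: (b, upd v j (\sum_i F i))] : T) = \sum_i (tclass [:: (b, upd v j (F i))] : T).
Proof.
have E x y : (tclass [:: (b, upd v j (x + y))] : T) =
    (tclass [:: (b, upd v j x)] : T) + (tclass [:: (b, upd v j y)] : T).
  by rewrite -tclassD; apply/tclassP/teq_addr.
apply: (big_morph _ E); apply: (addrI (tclass [:: (b, upd v j 0)] : T)).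
by rewrite -E !addr0.
Qed.

(** [r] bounds the positions not yet held by coordinate fields. The last of them is expanded, and
    each coefficient is handed over to its left neighbour, which is allowed to be arbitrary, or from
    the first position to Ber(M). *)
Lemma spanned_gen r (b : ber U) (v : {ffun 'I_n -> PiT U}) :
  (forall i : 'I_n, (r <= i)%N -> exists I, v i = bas I) -> spanned (tclass [:: (b, v)]).
Proof.
elim: r b v => [|r IHr] b v hv; first by apply: spanned_basis => i; exact: hv.
case: (ltnP r n) => rn; last first.
  by apply: IHr => i ri; have := leq_ltn_trans (leq_trans rn ri) (ltn_ord i); rewrite ltnn.
pose j := Ordinal rn; have [c cE] := PiT_expand Uc (v j).
have -> : v = upd v j (\sum_I c I *: bas I) by rewrite -cE upd_id.
rewrite tclass_upd_sum.
have H I : spanned (tclass [:: (b, upd v j (c I *: bas I))]).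
  pose w := upd v j (bas I); have wj : w j = bas I by rewrite ffunE eqxx.
  have -> : upd v j (c I *: bas I) = upd w j (c I *: w j).
    by rewrite wj; apply/ffunP => i; rewrite !ffunE; case: eqP.
  have wb (i : 'I_n) : (r <= i)%N -> exists I, w i = bas I.
    rewrite ffunE; case: (i =P j) => [_ _|ij ri]; first by exists I.
    by apply: hv; rewrite ltn_neqAle ri andbT; apply/eqP => E; case: ij; apply/val_inj.
  case: (posnP r) => r0.
    rewrite -(proj1 (tclassP _ _) (teq_bal0 b (c I) w (j := j) r0)).
    exact: IHr.
  have r'n : (r.-1 < n)%N by exact: leq_ltn_trans (leq_pred r) rn.
  rewrite -(proj1 (tclassP _ _) (teq_bal b (c I) w (j := Ordinal r'n) (j' := j) _));
    last by rewrite /= prednK.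
  apply: IHr => i ri; rewrite ffunE; case: eqP => [E|_]; last exact: wb.
  by move: ri; rewrite E /= -{1}(prednK r0) ltnn.
elim/big_ind: _ => [|x y|I _]; [exact: spanned0|exact: spannedD|exact: H].
Qed.

Lemma spannedT (t : T) : spanned t.
Proof.
elim/(@tensP R p q M n U): t => s; elim: s => [|[b v] s IHs]; first exact: spanned0.
rewrite -cat1s [X in spanned X](tclassD [:: (b, v)] s); apply: spannedD => //.
by apply: (@spanned_gen n) => i ni; have := ltn_ord i; rewrite ltnNge ni.
Qed.

Lemma ctr_sum (f : dmonk -> sO U) (w : dmonk -> T) :
  ctr hk (\sum_m f m *: w m) = \sum_m f m *: ctr hk (w m).
Proof.
have c0 : ctr hk (0 : T) = 0.
  by have := ctr_linear hk (-1) (0 : T) 0; rewrite scaler0 addr0 scaleN1r addNr.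
have cD (s t : T) : ctr hk (s + t) = ctr hk s + ctr hk t.
  by rewrite -[s]scale1r ctr_linear !scale1r.
rewrite (big_morph _ cD c0); apply: eq_bigr => m _.
by rewrite -[f m *: w m]addr0 ctr_linear c0 addr0.
Qed.

Lemma gval_sum (J : Type) (r : seq J) (F : J -> psec (deltaForms M k) U) b m :
  gval (\sum_(j <- r) F j) b m = \sum_(j <- r) gval (F j) b m.
Proof. by elim: r => [|j r IHr]; rewrite ?big_nil // !big_cons gval_add IHr. Qed.

Lemma frame_sum : exists c : dmonk -> bool, forall (f : dmonk -> sO U) m,
  sres (frame_sub Uc) (gval (ctr hk (\sum_m f m *: wcl (dmon_word m))) a m) = (-1) ^+ c m * f m.
Proof.
have [c cE] := fin_all_exists bact_mword.
exists c => f m; rewrite ctr_sum.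
rewrite gval_sum rmorph_sum (bigD1 m) //= big1 ?addr0 => [|m' m'm].
  rewrite rmorphM (sres_comp _ _ (@subset_refl _ _)) sres_id frame_wcl ?size_mword_dmon //.
  by rewrite cE eqxx mulr1 sign_comm.
rewrite rmorphM frame_wcl ?size_mword_dmon // cE eq_sym (negbTE m'm) mulr0 mulr0 //.
Qed.

(** As the words span, it is enough that their coefficients can be read off, up to sign, from the
    image in the frame of [a]; linear independence of the words is a by-product. *)
Lemma ctr_inj : injective (@ctr _ _ _ M k hk U).
Proof.
suff H (t : T) : ctr hk t = 0 -> t = 0.
  move=> s t E; apply/eqP; rewrite -subr_eq0; apply/eqP/H.
  by rewrite [s - t]addrC -scaleN1r ctr_linear E scaleN1r addNr.
have [f ->] := spannedT t; have [c cE] := frame_sum => E.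
rewrite big1 // => m _; have := cE f m; rewrite E rmorph0 => /esym/(f_equal ( *%R ((-1) ^+ c m))).
by rewrite mulrA -expr2 sqrr_sign mul1r mulr0 => ->; rewrite scale0r.
Qed.

Lemma ctr_surj (x : psec (deltaForms M k) U) : exists t, ctr hk t = x.
Proof.
have [c cE] := frame_sum.
(* The coefficients of [x] in the frame of [a], with the signs of [frame_sum] undone; agreement in
   this one frame suffices by [glue_frame_inj]. *)
exists (\sum_m ((-1) ^+ c m * sres (frame_sub Uc) (gval x a m)) *: wcl (dmon_word m)).
by refine (@glue_frame_inj _ _ _ _ _ _ Uc _ _ (ctr hk _) x _) => m;
  rewrite cE mulrA -expr2 sqrr_sign mul1r.
Qed.

End LocalIsomorphism.

Theorem theorem9p24 (R : realType) (p q : nat) (M : supermanifold R p q)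
    (k : int) (hk : k <= p%:Z) :
  omod_iso (deltaForms M k) (integralForms M k).
Proof.
(* Small open sets are those inside a chart domain, where the frames behind [ctr_inj] and [ctr_surj]
   exist. *)
apply: (@sheafify_iso _ _ (tens_presheaf M (absz (p%:Z - k))) (deltaForms M k) (@ctr _ _ _ M k hk)
  _ _ (fun U : opens M => exists a : chart M p q, U `<=` cdom a)).
- exact: ctr_linear.
- exact: ctr_res.
- by move=> U V VU [a Ua]; exists a; exact: subset_trans VU Ua.
- by move=> x; have [c cx] := sm_charts x; exists (cdom c); split=> //; exists c.
- by move=> U [a Ua]; exact: (ctr_inj Ua).
- by move=> U [a Ua]; exact: (ctr_surj hk Ua).
Qed.
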